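(* Consider the radial compressible Euler equations in $n>1$ dimensions with equation of state $p=p(\rho,S)$, $p\neq$ const., and consider kinematic conserved integrals $$\frac{d}{dt}\int_{V(t)}\Phi^t\,r^{n-1}dr\Big|_{\mathcal E}=-\big(r^{n-1}\Psi\big)\Big|_{\partial V(t)},\qquad \Phi^t=\Phi^t(t,r,U,\rho,S),\quad \Psi=\Psi(t,r,U,\rho,S),$$ on transported radial domains $V(t)$. (i) For a general equation of state $p=P(\rho,S)$, the only kinematic conserved integral with non-zero moving flux $\Psi\not\equiv0$ is energy: $$\frac{d}{dt}\int_{V(t)}\rho\big(\tfrac12U^2+e\big)\,r^{n-1}dr=-\big(r^{n-1}pU\big)\Big|_{\partial V(t)},\qquad e=\int \frac{P(\rho,S)}{\rho^2}\,d\rho .$$ (ii) The only special equations of state for which additional kinematic conserved integrals with $\Psi\not\equiv0$ exist are the ideal polytropic case $p=\kappa(S)\rho^{1+2/n}$, the barotropic case $p=P(\rho)$, and the entropic case $p=\kappa(S)$. The additional conserved integrals are respectively given by: - for an ideal polytropic equation of state, with $e=\tfrac n2\kappa(S)\rho^{2/n}$, the dilational energy $$\frac{d}{dt}\int_{V(t)}\Big(t\rho\big(\tfrac12U^2+e\big)-\tfrac12r\rho U\Big)r^{n-1}dr=-\Big(r^{n-1}\big(tU-\tfrac12r\big)p\Big)\Big|_{\partial V(t)}$$ and the similarity energy $$\frac{d}{dt}\int_{V(t)}\Big(t^2\rho\big(\tfrac12U^2+e\big)-t\,r\rho U+\tfrac12r^2\rho\Big)r^{n-1}dr=-\Big(r^{n-1}t\,(tU-r)\,p\Big)\Big|_{\partial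 V(t)};$$ - for a barotropic equation of state, with $e=\int p(\rho)/\rho^2\,d\rho$, the enthalpy flux $$\frac{d}{dt}\int_{V(t)}U\,dr\Big|_{\mathcal E}=-\big(e+p/\rho-\tfrac12U^2\big)\Big|_{\partial V(t)};$$ - for an entropic equation of state (where $e=-\kappa(S)/\rho$), the entropy-weighted energy $$\frac{d}{dt}\int_{V(t)}\Big(\tfrac12\rho U^2F(S)-K(S)\Big)r^{n-1}dr\Big|_{\mathcal E}=-\big(r^{n-1}U K(S)\big)\Big|_{\partial V(t)},\qquad K(S)=\int F(S)\kappa'(S)\,dS,$$ with $F$ an arbitrary non-constant function.
   Context: Radial Euler equations: for functions $U(r,t)$ (radial velocity), $\rho(r,t)$ (density), $S(r,t)$ (entropy), with $r>0$ the radial coordinate in $\mathbb{R}^n$, $$U_t+UU_r+(p_S S_r+p_\rho\rho_r)/\rho=0,\quad \rho_t+(U\rho)_r+\tfrac{n-1}{r}U\rho=0,\quad S_t+US_r=0,$$ with equation of state $p=p(\rho,S)$. ''General equation of state'' means $p$ is an arbitrary (non-constant) function of $\rho,S$. $|_{\mathcal E}$ means evaluation on solutions. A transported radial domain $V(t)$ is a radial interval whose endpoints move with the flow, $dr_i/dt=U(r_i(t),t)$; $(\cdot)|_{\partial V(t)}$ denotes the value at the outer endpoint minus the value at the inner endpoint. The relation with density $\Phi^t$ and moving flux $\Psi$ holds for all transported radial domains if and only if $$\big(D_t(r^{n-1}\Phi^t)+D_r(r^{n-1}\Phi^r)\big)\big|_{\mathcal E}=0\quad\text{with}\quad \Phi^r=\Psi+U\Phi^t,$$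 where $D_t,D_r$ are total derivatives and $t$-derivatives of $U,\rho,S$ are eliminated via the Euler equations. Convention: conserved integrals form a linear space, and the classification lists the integrals with $\Psi\not\equiv0$ up to linear combinations, modulo integral invariants (those with $\Psi\equiv0$) and locally trivial ones (those with $r^{n-1}\Phi^t=D_r(r^{n-1}\Theta)$ and $\Phi^r=-D_t\Theta|_{\mathcal E}$ for some function $\Theta$). The function $e$ is determined up to an additive function of $S$.
   Formalization: The polytropic case allows an additive constant, p=κ(S)ρ^{1+2/n}+p0, since only derivatives of p enter the equations; p is smooth, and p_ρ and p_S are each assumed either identically zero or zero on no open set, as the claim fails for p of mixed type. *)

(* Defs.v *)
(* Stdlib reals and Coquelicot. *)
From Stdlib Require Export Reals List.
From Coquelicot Require Export Coquelicot.
Export ListNotations.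
Open Scope R_scope.

(* Functions of (t, r, U, rho, S); the arguments are always in this order, and
   U, S are written [u], [s]. *)
Definition kfun := R -> R -> R -> R -> R -> R.

(* A function of (rho, S), such as p or e, seen as a function of all variables. *)
Definition state_fun (f : R -> R -> R) : kfun := fun _ _ _ rho s => f rho s.

Definition d_t (f : kfun) : kfun :=
  fun t r u rho s => Derive (fun x => f x r u rho s) t.
Definition d_r (f : kfun) : kfun :=
  fun t r u rho s => Derive (fun x => f t x u rho s) r.
Definition d_u (f : kfun) : kfun :=
  fun t r u rho s => Derive (fun x => f t r x rho s) u.
Definition d_rho (f : kfun) : kfun :=
  fun t r u rho s => Derive (fun x => f t r u x s) rho.
Definition d_s (f : kfun) : kfun :=
  fun t r u rho s => Derive (fun x => f t r u rho x) s.

Definition open_interval (I : R -> Prop) : Prop :=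
  exists a b : Rbar, Rbar_lt a b /\
    forall x, I x <-> Rbar_lt a x /\ Rbar_lt x b.

(* The functions live on an arbitrary product of non-empty open intervals, with
   r > 0 and rho > 0.  The whole physical domain (t, U, S real; r, rho positive)
   is one instance; smaller boxes give the local form of the results. *)
Record box := Box {
  dom_t : R -> Prop;
  dom_r : R -> Prop;
  dom_u : R -> Prop;
  dom_rho : R -> Prop;
  dom_s : R -> Prop;
  dom_t_open : open_interval dom_t;
  dom_r_open : open_interval dom_r;
  dom_u_open : open_interval dom_u;
  dom_rho_open : open_interval dom_rho;
  dom_s_open : open_interval dom_s;
  dom_r_pos : forall r, dom_r r -> 0 < r;
  dom_rho_pos : forall rho, dom_rho rho -> 0 < rho
}.

Definition in_dom (D : box) (t r u rho s : R) : Prop :=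
  dom_t D t /\ dom_r D r /\ dom_u D u /\ dom_rho D rho /\ dom_s D s.

Fixpoint Ck (k : nat) (D : box) (f : kfun) : Prop :=
  (forall t r u rho s, in_dom D t r u rho s ->
    continuous
      (fun x : R * R * R * R * R => let '(t, r, u, rho, s) := x in f t r u rho s)
      (t, r, u, rho, s)) /\
  match k with
  | O => True
  | S k' =>
      (forall t r u rho s, in_dom D t r u rho s ->
        ex_derive (fun x => f x r u rho s) t /\
        ex_derive (fun x => f t x u rho s) r /\
        ex_derive (fun x => f t r x rho s) u /\
        ex_derive (fun x => f t r u x s) rho /\
        ex_derive (fun x => f t r u rho x) s) /\
      Ck k' D (d_t f) /\ Ck k' D (d_r f) /\ Ck k' D (d_u f) /\
      Ck k' D (d_rho f) /\ Ck k' D (d_s f)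
  end.

Definition smooth (D : box) (f : kfun) : Prop := forall k, Ck k D f.

Definition vanishes (D : box) (f : kfun) : Prop :=
  forall t r u rho s, in_dom D t r u rho s -> f t r u rho s = 0.

(** * The Euler equations *)

Definition p_rho (p : R -> R -> R) (rho s : R) : R := Derive (fun x => p x s) rho.
Definition p_s (p : R -> R -> R) (rho s : R) : R := Derive (fun x => p rho x) s.

(* U_t, rho_t, S_t as given by the Euler equations, in terms of U, rho, S and
   their r-derivatives [ur], [rhor], [sr]. *)
Definition euler_ut (p : R -> R -> R) (u rho s ur rhor sr : R) : R :=
  - (u * ur) - (p_s p rho s * sr + p_rho p rho s * rhor) / rho.
Definition euler_rhot (n : nat) (r u rho ur rhor : R) : R :=
  - (ur * rho + u * rhor) - (INR n - 1) / r * u * rho.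
Definition euler_st (u sr : R) : R := - (u * sr).

(* Total derivatives of f(t,r,U,rho,S), as functions on the space with the
   independent coordinates t, r, U, rho, S, U_r, rho_r, S_r. *)
Definition Dr (f : kfun) (t r u rho s ur rhor sr : R) : R :=
  d_r f t r u rho s + d_u f t r u rho s * ur
  + d_rho f t r u rho s * rhor + d_s f t r u rho s * sr.

(* D_t f evaluated on solutions. *)
Definition Dt_euler (n : nat) (p : R -> R -> R) (f : kfun)
    (t r u rho s ur rhor sr : R) : R :=
  d_t f t r u rho s
  + d_u f t r u rho s * euler_ut p u rho s ur rhor sr
  + d_rho f t r u rho s * euler_rhot n r u rho ur rhor
  + d_s f t r u rho s * euler_st u sr.

(** * Kinematic conserved integrals *)

Record integral := Integral {
  density : kfun;     (* Phi^t *)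
  moving_flux : kfun  (* Psi *)
}.

(* Phi^r = Psi + U Phi^t. *)
Definition flux (A : integral) : kfun :=
  fun t r u rho s => moving_flux A t r u rho s + u * density A t r u rho s.

Definition radial_weight (n : nat) (f : kfun) : kfun :=
  fun t r u rho s => r ^ (n - 1) * f t r u rho s.

Definition conserved (n : nat) (D : box) (p : R -> R -> R) (A : integral) : Prop :=
  smooth D (density A) /\ smooth D (moving_flux A) /\
  forall t r u rho s ur rhor sr, in_dom D t r u rho s ->
    Dt_euler n p (radial_weight n (density A)) t r u rho s ur rhor sr
    + Dr (radial_weight n (flux A)) t r u rho s ur rhor sr = 0.

Definition C1_on (W : R * R -> Prop) (f : R -> R -> R) : Prop :=
  forall r t, W (r, t) ->
    ex_derive (fun x => f x t) r /\
    ex_derive (fun x => f r x) t /\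
    continuous (fun y : R * R => Derive (fun x => f x (snd y)) (fst y)) (r, t) /\
    continuous (fun y : R * R => Derive (fun x => f (fst y) x) (snd y)) (r, t).

(* Classical solutions U(r,t), rho(r,t), S(r,t) on an open set W of the
   (r,t)-plane, with values in D. *)
Definition euler_solution (n : nat) (D : box) (p : R -> R -> R)
    (W : R * R -> Prop) (u rho s : R -> R -> R) : Prop :=
  open W /\ C1_on W u /\ C1_on W rho /\ C1_on W s /\
  forall r t, W (r, t) ->
    let ur := Derive (fun x => u x t) r in
    let rhor := Derive (fun x => rho x t) r in
    let sr := Derive (fun x => s x t) r in
    in_dom D t r (u r t) (rho r t) (s r t) /\
    Derive (fun x => u r x) t = euler_ut p (u r t) (rho r t) (s r t) ur rhor sr /\
    Derive (fun x => rho r x) t = euler_rhot n r (u r t) (rho r t) ur rhor /\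
    Derive (fun x => s r x) t = euler_st (u r t) sr.

(* d/dt int_{V(t)} Phi^t r^(n-1) dr = - (r^(n-1) Psi)|_{dV(t)} for every solution
   and every transported radial domain V(t) = [a(t), b(t)], t1 < t < t2. *)
Definition transport_relation (n : nat) (D : box) (p : R -> R -> R)
    (A : integral) : Prop :=
  forall (W : R * R -> Prop) (u rho s : R -> R -> R) (a b : R -> R) (t1 t2 : R),
    euler_solution n D p W u rho s ->
    (forall t, t1 < t < t2 ->
      a t <= b t /\ (forall r, a t <= r <= b t -> W (r, t)) /\
      is_derive a t (u (a t) t) /\ is_derive b t (u (b t) t)) ->
    let psi := fun r t =>
      r ^ (n - 1) * moving_flux A t r (u r t) (rho r t) (s r t) in
    forall t, t1 < t < t2 ->
      is_derive
        (fun t => RInt (fun r => density A t r (u r t) (rho r t) (s r t)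
                                 * r ^ (n - 1)) (a t) (b t))
        t (- (psi (b t) t - psi (a t) t)).

(** * Linear combinations, integral invariants, trivial integrals *)

Definition izero : integral :=
  Integral (fun _ _ _ _ _ => 0) (fun _ _ _ _ _ => 0).
Definition iadd (A B : integral) : integral :=
  Integral
    (fun t r u rho s => density A t r u rho s + density B t r u rho s)
    (fun t r u rho s => moving_flux A t r u rho s + moving_flux B t r u rho s).
Definition iscale (c : R) (A : integral) : integral :=
  Integral
    (fun t r u rho s => c * density A t r u rho s)
    (fun t r u rho s => c * moving_flux A t r u rho s).

Definition lin_comb (cs : list R) (As : list integral) : integral :=
  fold_right (fun cA => iadd (iscale (fst cA) (snd cA))) izero (combine cs As).

Definition integral_invariant (n : nat) (D : box) (p : R -> R -> R)
    (A : integral) : Prop :=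
  conserved n D p A /\ vanishes D (moving_flux A).

Definition locally_trivial (n : nat) (D : box) (p : R -> R -> R)
    (A : integral) : Prop :=
  exists Theta : kfun, smooth D Theta /\
    forall t r u rho s ur rhor sr, in_dom D t r u rho s ->
      r ^ (n - 1) * density A t r u rho s
        = Dr (radial_weight n Theta) t r u rho s ur rhor sr /\
      flux A t r u rho s = - Dt_euler n p Theta t r u rho s ur rhor sr.

(* A and B differ by an integral invariant plus a locally trivial integral. *)
Definition equivalent (n : nat) (D : box) (p : R -> R -> R)
    (A B : integral) : Prop :=
  exists I T : integral,
    integral_invariant n D p I /\ locally_trivial n D p T /\
    forall t r u rho s, in_dom D t r u rho s ->
      density A t r u rho s = density B t r u rho s
        + (density I t r u rho s + density T t r u rho s) /\
      moving_flux A t r u rho s = moving_flux B t r u rho s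
        + (moving_flux I t r u rho s + moving_flux T t r u rho s).

(* [As] is a basis of the space of kinematic conserved integrals modulo
   integral invariants and locally trivial ones. *)
Definition classified_by (n : nat) (D : box) (p : R -> R -> R)
    (As : list integral) : Prop :=
  (forall A, In A As -> conserved n D p A /\ ~ vanishes D (moving_flux A)) /\
  (forall A, conserved n D p A ->
    exists cs, length cs = length As /\ equivalent n D p A (lin_comb cs As)) /\
  (forall cs, length cs = length As ->
    equivalent n D p (lin_comb cs As) izero -> forall c, In c cs -> c = 0).

(* A has non-zero moving flux and is not a multiple of E. *)
Definition additional (n : nat) (D : box) (p : R -> R -> R)
    (E A : integral) : Prop :=
  conserved n D p A /\ ~ vanishes D (moving_flux A) /\
  ~ exists c, equivalent n D p A (iscale c E).

(** * Equations of state *)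

Definition eos_constant (D : box) (p : R -> R -> R) : Prop :=
  exists c, forall rho s, dom_rho D rho -> dom_s D s -> p rho s = c.

Definition zero_or_generic (D : box) (f : R -> R -> R) : Prop :=
  (forall rho s, dom_rho D rho -> dom_s D s -> f rho s = 0) \/
  (forall rho s eps, dom_rho D rho -> dom_s D s -> 0 < eps ->
    exists rho' s', dom_rho D rho' /\ dom_s D s' /\
      Rabs (rho' - rho) < eps /\ Rabs (s' - s) < eps /\ f rho' s' <> 0).

(* p is smooth, and each of p_rho, p_S either vanishes identically or vanishes
   on no non-empty open set.  The second condition is automatic for real-analytic
   p, and any smooth p satisfies it on some box inside every given box.  It
   prevents p from being of one type in one region and of another type elsewhere:
   if, say, p = kappa(S) rho^(1+2/n) with kappa = 0 on an interval, then the energy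
   density may be multiplied by any c(S) locally constant where kappa <> 0. *)
Definition eos_regular (D : box) (p : R -> R -> R) : Prop :=
  smooth D (state_fun p) /\
  zero_or_generic D (p_rho p) /\ zero_or_generic D (p_s p).

(* p = kappa(S) rho^(1+2/n) + p0.  The Euler equations contain only the
   derivatives of p, so an equation of state matters only up to an additive
   constant p0. *)
Definition polytropic_with (n : nat) (D : box) (p : R -> R -> R)
    (kappa : R -> R) (p0 : R) : Prop :=
  forall rho s, dom_rho D rho -> dom_s D s ->
    p rho s = kappa s * Rpower rho (1 + 2 / INR n) + p0.
Definition barotropic_with (D : box) (p : R -> R -> R) (P : R -> R) : Prop :=
  forall rho s, dom_rho D rho -> dom_s D s -> p rho s = P rho.
Definition entropic_with (D : box) (p : R -> R -> R) (kappa : R -> R) : Prop :=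
  forall rho s, dom_rho D rho -> dom_s D s -> p rho s = kappa s.

Definition polytropic (n : nat) (D : box) (p : R -> R -> R) : Prop :=
  exists kappa p0, polytropic_with n D p kappa p0.
Definition barotropic (D : box) (p : R -> R -> R) : Prop :=
  exists P, barotropic_with D p P.
Definition entropic (D : box) (p : R -> R -> R) : Prop :=
  exists kappa, entropic_with D p kappa.

(* e = int p / rho^2 drho, determined up to a function of S. *)
Definition internal_energy (D : box) (p e : R -> R -> R) : Prop :=
  smooth D (state_fun e) /\
  forall rho s, dom_rho D rho -> dom_s D s ->
    is_derive (fun x => e x s) rho (p rho s / rho ^ 2).

(** * The conserved integrals *)

Definition energy (p e : R -> R -> R) : integral :=
  Integral
    (fun t r u rho s => rho * (u ^ 2 / 2 + e rho s))
    (fun t r u rho s => p rho s * u).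

Definition polytropic_p (n : nat) (kappa : R -> R) (rho s : R) : R :=
  kappa s * Rpower rho (1 + 2 / INR n).
Definition polytropic_e (n : nat) (kappa : R -> R) (rho s : R) : R :=
  INR n / 2 * kappa s * Rpower rho (2 / INR n).

Definition dilational_energy (n : nat) (kappa : R -> R) : integral :=
  let p := polytropic_p n kappa in
  let e := polytropic_e n kappa in
  Integral
    (fun t r u rho s => t * (rho * (u ^ 2 / 2 + e rho s)) - r * rho * u / 2)
    (fun t r u rho s => (t * u - r / 2) * p rho s).

Definition similarity_energy (n : nat) (kappa : R -> R) : integral :=
  let p := polytropic_p n kappa in
  let e := polytropic_e n kappa in
  Integral
    (fun t r u rho s => t ^ 2 * (rho * (u ^ 2 / 2 + e rho s))
                        - t * r * rho * u + r ^ 2 * rho / 2)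
    (fun t r u rho s => t * (t * u - r) * p rho s).

(* Here r^(n-1) Phi^t = U and r^(n-1) Psi = e + p/rho - U^2/2. *)
Definition enthalpy_flux (n : nat) (P e : R -> R) : integral :=
  Integral
    (fun t r u rho s => u / r ^ (n - 1))
    (fun t r u rho s => (e rho + P rho / rho - u ^ 2 / 2) / r ^ (n - 1)).

Definition weighted_energy (F K : R -> R) : integral :=
  Integral
    (fun t r u rho s => rho * u ^ 2 * F s / 2 - K s)
    (fun t r u rho s => u * K s).

(* F is smooth and K = int F kappa' dS. *)
Definition entropy_weight (D : box) (kappa F K : R -> R) : Prop :=
  smooth D (state_fun (fun _ s => F s)) /\
  forall s, dom_s D s -> is_derive K s (F s * Derive kappa s).

Definition nonconstant_on (I : R -> Prop) (F : R -> R) : Prop :=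
  exists x y, I x /\ I y /\ F x <> F y.

(* Main.v *)
(* Write Phi, Psi for density and moving flux, N = n - 1 and V = Phi_U / rho.  The
   conservation law is affine in U_r, rho_r, S_r, so it splits into four linear
   equations: Psi_U = rho Phi_rho - Phi, Psi_rho = p_rho V, Psi_S = p_S V, and an
   evolution equation in (t, r).  If V = 0 the integral is an integral invariant
   plus a locally trivial one, and equivalence preserves V; so everything comes
   down to finding the possible V.

   Where p_rho is generic, V and H = Phi_rho satisfy an overdetermined linear
   system, and the main point is that V is affine in U.  Put
   k = rho p_rhorho / (2 p_rho), J = H_U - U V_U, w = V_UU.  Then (J, w) satisfies
   a closed first-order system in (t, r, rho), whose (rho, r)- and
   (t, r)-integrability conditions are linear in J, J_U, w.  Eliminating J_U gives
   A J + (a p_rho + b U^2) w = 0 with A, a, b functions of the state.  Where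
   A k_rho <> 0, J is a multiple of w and w solves a first-order ODE in U; the
   remaining conditions become polynomial identities in U without solution.
   Where A = 0, k satisfies a polynomial equation with constant coefficients.
   Either way k_rho = 0, and then the conditions force w = 0.

   Once V is affine in U, the system is solved by hand: up to an enthalpy term
   c / (rho r^N), which requires p_S = 0, V = b U - b' r / 2 with b quadratic in t,
   and b' <> 0 forces p to be polytropic.  If p_rho = 0, one finds V = F(S) U. *)
Require Import Defs.
From Stdlib Require Import Reals List.
From Coquelicot Require Import Coquelicot.
From Stdlib Require Import Lra Lia Classical ClassicalEpsilon.
Import ListNotations.
Open Scope R_scope.

(** * Smooth functions on a box *)

Notation "H $ Hd" := (H _ _ _ _ _ Hd) (at level 11, Hd at level 0, only parsing).

(** On an arbitrary box nothing can be evaluated at a convenient point such as [U = 0], and [p_rho]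
    or [p_S] may still vanish on a nowhere dense set. Information is therefore extracted by
    differentiating identities valid on the whole box and forming explicit linear combinations of
    the results. To show that a smooth function vanishes, a point where it does not is enlarged to a
    sub-box on which it has no zero and may be divided by; factors [p_rho] and [p_S] are cancelled
    by density and continuity. The unknown [J] comes from the geometry: the terms with [N / r] in
    the two evolution equations contain [V - U V_U] and [V - H_U], and [J] is the difference of the
    two. Compatibility gives [(1 - k) (V_r + N/r (V - U V_U)) = N/r J], so [J] determines [V_r]
    except where [k = 1], that is [p_rho] proportional to [rho^2]. The same relation explains the
    exponent [1 + 2/n]. For an affine multiplier with [H_U = V] one has [V_r = - b'/2] and
    [J = V - U V_U = - b' r / 2], so [b' <> 0] requires [n (1 - k) = n - 1], or [k = 1/n], while a
    power law with exponent [gamma] has [k = (gamma - 1) / 2]. *)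

Inductive dir := DT | DR | DU | DRho | DS.

Definition partial (i : dir) (f : kfun) : kfun :=
  match i with
  | DT => d_t f | DR => d_r f | DU => d_u f | DRho => d_rho f | DS => d_s f
  end.

Definition coord (i : dir) : kfun := fun t r u rho s =>
  match i with DT => t | DR => r | DU => u | DRho => rho | DS => s end.

(** The target type is arbitrary because the predicate [in_dom] is sliced as well as functions. *)
Definition slice {T : Type} (i : dir) (f : R -> R -> R -> R -> R -> T) t r u rho s : R -> T :=
  match i with
  | DT => fun x => f x r u rho s
  | DR => fun x => f t x u rho s
  | DU => fun x => f t r x rho s
  | DRho => fun x => f t r u x s
  | DS => fun x => f t r u rho x
  end.

Definition app5 {T : Type} (f : R -> R -> R -> R -> R -> T) : R * R * R * R * R -> T :=
  fun x => let '(t, r, u, rho, s) := x in f t r u rho s.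

Definition cont (D : box) (f : kfun) : Prop :=
  forall t r u rho s, in_dom D t r u rho s -> continuous (app5 f) (t, r, u, rho, s).

Lemma partialE i f t r u rho s :
  partial i f t r u rho s = Derive (slice i f t r u rho s) (coord i t r u rho s).
Proof. destruct i; reflexivity. Qed.

Lemma slice_coord {T : Type} i (f : R -> R -> R -> R -> R -> T) t r u rho s :
  slice i f t r u rho s (coord i t r u rho s) = f t r u rho s.
Proof. destruct i; reflexivity. Qed.

Lemma Ck_S k D f :
  Ck (S k) D f <->
  cont D f /\
  (forall i t r u rho s, in_dom D t r u rho s ->
     ex_derive (slice i f t r u rho s) (coord i t r u rho s)) /\
  (forall i, Ck k D (partial i f)).
Proof.
  simpl; unfold cont, app5; split.
  - intros (H1 & H2 & H3 & H4 & H5 & H6 & H7); split; [exact H1 | split].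
    + intros i t r u rho s H; destruct (H2 _ _ _ _ _ H) as (? & ? & ? & ? & ?).
      destruct i; assumption.
    + intros []; assumption.
  - intros (H1 & H2 & H3); split; [exact H1 | split].
    + intros t r u rho s H; repeat split.
      * exact (H2 DT _ _ _ _ _ H).
      * exact (H2 DR _ _ _ _ _ H).
      * exact (H2 DU _ _ _ _ _ H).
      * exact (H2 DRho _ _ _ _ _ H).
      * exact (H2 DS _ _ _ _ _ H).
    + exact (conj (H3 DT) (conj (H3 DR) (conj (H3 DU) (conj (H3 DRho) (H3 DS))))).
Qed.

Lemma Ck_cont k D f : Ck k D f -> cont D f.
Proof. destruct k; intros H; exact (proj1 H). Qed.

Lemma open_interval_locally I x : Defs.open_interval I -> I x -> locally x I.
Proof.
  intros (a & b & _ & H) Hx.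
  apply H in Hx; destruct Hx as [Ha Hb].
  generalize (open_Rbar_gt' x a Ha) (open_Rbar_lt' x b Hb); intros Ga Gb.
  generalize (filter_and _ _ Ga Gb); apply filter_imp.
  intros y [? ?]; apply H; auto.
Qed.

Lemma open_interval_convex I x y z : Defs.open_interval I -> I x -> I y -> x <= z <= y -> I z.
Proof.
  intros (a & b & _ & H) Hx Hy Hz.
  apply H in Hx; apply H in Hy; apply H; split.
  - destruct Hx as [Hx _]; apply Rbar_lt_le_trans with x; simpl; tauto || exact Hx.
  - destruct Hy as [_ Hy]; apply Rbar_le_lt_trans with y; simpl; tauto || exact Hy.
Qed.

Lemma open_interval_inhabited I : Defs.open_interval I -> exists x, I x.
Proof.
  intros ([a| |] & [b| |] & Hab & H); simpl in Hab; try tauto.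
  - exists ((a + b) / 2); apply H; simpl; lra.
  - exists (a + 1); apply H; simpl; lra.
  - exists (b - 1); apply H; simpl; lra.
  - exists 0; apply H; simpl; tauto.
Qed.

Lemma locally_pair {A B : UniformSpace} (x : A) (y : B) (P : A -> Prop) (Q : B -> Prop) :
  locally x P -> locally y Q -> locally (x, y) (fun z => P (fst z) /\ Q (snd z)).
Proof.
  intros [d1 H1] [d2 H2].
  exists (mkposreal _ (Rmin_stable_in_posreal d1 d2)).
  intros [a b] [Ha Hb]; simpl in *; split.
  - apply H1; apply ball_le with (2 := Ha); apply Rmin_l.
  - apply H2; apply ball_le with (2 := Hb); apply Rmin_r.
Qed.

Lemma in_dom_locally D t r u rho s :
  in_dom D t r u rho s -> locally (t, r, u, rho, s) (app5 (in_dom D)).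
Proof.
  intros (Ht & Hr & Hu & Hrho & Hs).
  pose proof (open_interval_locally _ _ (dom_t_open D) Ht) as Lt.
  pose proof (open_interval_locally _ _ (dom_r_open D) Hr) as Lr.
  pose proof (open_interval_locally _ _ (dom_u_open D) Hu) as Lu.
  pose proof (open_interval_locally _ _ (dom_rho_open D) Hrho) as Lrho.
  pose proof (open_interval_locally _ _ (dom_s_open D) Hs) as Ls.
  pose proof (locally_pair _ _ _ _ (locally_pair _ _ _ _ (locally_pair _ _ _ _
     (locally_pair _ _ _ _ Lt Lr) Lu) Lrho) Ls) as L.
  revert L; apply filter_imp.
  intros [[[[? ?] ?] ?] ?]; simpl; unfold in_dom; tauto.
Qed.

Lemma in_dom_slice D i t r u rho s :
  in_dom D t r u rho s ->
  locally (coord i t r u rho s) (slice i (in_dom D) t r u rho s).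
Proof.
  intros (Ht & Hr & Hu & Hrho & Hs).
  destruct i; simpl.
  - generalize (open_interval_locally _ _ (dom_t_open D) Ht); apply filter_imp; unfold in_dom; tauto.
  - generalize (open_interval_locally _ _ (dom_r_open D) Hr); apply filter_imp; unfold in_dom; tauto.
  - generalize (open_interval_locally _ _ (dom_u_open D) Hu); apply filter_imp; unfold in_dom; tauto.
  - generalize (open_interval_locally _ _ (dom_rho_open D) Hrho); apply filter_imp; unfold in_dom; tauto.
  - generalize (open_interval_locally _ _ (dom_s_open D) Hs); apply filter_imp; unfold in_dom; tauto.
Qed.

(** All functions are total, so identities are only asked for on the box; since the box is open, it
    still determines derivatives of every order. *)
Definition eq_on (D : box) (f g : kfun) : Prop :=
  forall t r u rho s, in_dom D t r u rho s -> f t r u rho s = g t r u rho s.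

Lemma eq_on_slice D f g i t r u rho s :
  eq_on D f g -> in_dom D t r u rho s ->
  locally (coord i t r u rho s) (fun x => slice i f t r u rho s x = slice i g t r u rho s x).
Proof.
  intros H Hd; generalize (in_dom_slice D i $ Hd); apply filter_imp.
  intros x; destruct i; simpl; apply H.
Qed.

Lemma partial_eq_on D f g i : eq_on D f g -> eq_on D (partial i f) (partial i g).
Proof.
  intros H t r u rho s Hd; rewrite !partialE.
  apply Derive_ext_loc; eapply eq_on_slice; eassumption.
Qed.

Lemma cont_ext D f g : eq_on D f g -> cont D f -> cont D g.
Proof.
  intros H Hf t r u rho s Hd.
  apply continuous_ext_loc with (app5 f); [| exact (Hf $ Hd)].
  generalize (in_dom_locally _ _ _ _ _ _ Hd); apply filter_imp.
  intros [[[[? ?] ?] ?] ?]; simpl; apply H.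
Qed.

Lemma Ck_ext k D f g : eq_on D f g -> Ck k D f -> Ck k D g.
Proof.
  revert f g; induction k as [|k IH]; intros f g H Hf.
  - split; [| exact I]; apply (cont_ext _ _ _ H (proj1 Hf)).
  - apply Ck_S in Hf; destruct Hf as (H1 & H2 & H3); apply Ck_S; split; [| split].
    + apply (cont_ext _ _ _ H H1).
    + intros i t r u rho s Hd.
      apply ex_derive_ext_loc with (slice i f t r u rho s); [| auto].
      eapply eq_on_slice; eassumption.
    + intros i; apply IH with (partial i f); [apply partial_eq_on, H | apply H3].
Qed.

Lemma smooth_ext D f g : eq_on D f g -> smooth D f -> smooth D g.
Proof. intros H Hf k; apply (Ck_ext k D f g H (Hf k)). Qed.

Lemma smooth_partial D f i : smooth D f -> smooth D (partial i f).
Proof. intros H k; exact (proj2 (proj2 (proj1 (Ck_S k D f) (H (S k)))) i). Qed.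

Lemma smooth_cont D f : smooth D f -> cont D f.
Proof. intros H; exact (proj1 (H O)). Qed.

Lemma smooth_is_derive D f i t r u rho s :
  smooth D f -> in_dom D t r u rho s ->
  is_derive (slice i f t r u rho s) (coord i t r u rho s) (partial i f t r u rho s).
Proof.
  intros H Hd; rewrite partialE; apply Derive_correct.
  exact (proj1 (proj2 (proj1 (Ck_S 0 D f) (H 1%nat))) i $ Hd).
Qed.

Lemma Ck_of_partials k D f (g : dir -> kfun) :
  cont D f ->
  (forall i t r u rho s, in_dom D t r u rho s ->
     is_derive (slice i f t r u rho s) (coord i t r u rho s) (g i t r u rho s)) ->
  (forall i, Ck k D (g i)) -> Ck (S k) D f.
Proof.
  intros H1 H2 H3; apply Ck_S; split; [exact H1 | split].
  - intros; eexists; eauto.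
  - intros i; apply Ck_ext with (g i); [| apply H3].
    intros t r u rho s Hd; rewrite partialE; symmetry; apply is_derive_unique; auto.
Qed.

Lemma smooth_of_partials D f (g : dir -> kfun) :
  cont D f ->
  (forall i t r u rho s, in_dom D t r u rho s ->
     is_derive (slice i f t r u rho s) (coord i t r u rho s) (g i t r u rho s)) ->
  (forall i, smooth D (g i)) -> smooth D f.
Proof.
  intros H1 H2 H3 [|k]; [exact (conj H1 I) |].
  apply Ck_of_partials with g; auto; intros i; apply H3.
Qed.

Lemma Ck_pred k D f : Ck (S k) D f -> Ck k D f.
Proof.
  revert f; induction k as [|k IH]; intros f H.
  - exact (conj (Ck_cont _ _ _ H) I).
  - apply Ck_S in H; destruct H as (H1 & H2 & H3); apply Ck_S; repeat split; auto.
Qed.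

Lemma smooth_const D c : smooth D (fun _ _ _ _ _ => c).
Proof.
  intros k; revert c; induction k as [|k IH]; intros c.
  - split; [| exact I]; intros t r u rho s _.
    apply continuous_ext with (fun _ => c); [intros [[[[? ?] ?] ?] ?]; reflexivity | apply continuous_const].
  - apply Ck_of_partials with (fun _ _ _ _ _ _ => 0); [exact (Ck_cont _ _ _ (IH c)) | | intros; apply IH].
    intros [] t r u rho s _; simpl; apply @is_derive_const.
Qed.

Lemma continuous_fst_comp {T A B : UniformSpace} (f : T -> A * B) x :
  continuous f x -> continuous (fun z => fst (f z)) x.
Proof. intros H; apply (continuous_comp f fst); [exact H | apply continuous_fst]. Qed.

Lemma continuous_snd_comp {T A B : UniformSpace} (f : T -> A * B) x :
  continuous f x -> continuous (fun z => snd (f z)) x.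
Proof. intros H; apply (continuous_comp f snd); [exact H | apply continuous_snd]. Qed.

Lemma cont_coord D i : cont D (coord i).
Proof.
  intros t r u rho s _.
  apply continuous_ext with (fun x : R * R * R * R * R =>
    match i with
    | DT => fst (fst (fst (fst x))) | DR => snd (fst (fst (fst x)))
    | DU => snd (fst (fst x)) | DRho => snd (fst x) | DS => snd x
    end).
  { intros [[[[? ?] ?] ?] ?]; destruct i; reflexivity. }
  destruct i; repeat first [apply continuous_id | apply continuous_fst_comp | apply continuous_snd_comp].
Qed.

Lemma smooth_coord D i : smooth D (coord i).
Proof.
  apply smooth_of_partials with
    (fun j _ _ _ _ _ => match i, j with
       | DT, DT | DR, DR | DU, DU | DRho, DRho | DS, DS => 1 | _, _ => 0 end).
  - apply cont_coord.
  - intros j t r u rho s _; destruct i, j; simpl;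
      apply @is_derive_id || apply @is_derive_const.
  - intros j; apply smooth_const.
Qed.

Definition kplus (f g : kfun) : kfun := fun t r u rho s => f t r u rho s + g t r u rho s.
Definition kmult (f g : kfun) : kfun := fun t r u rho s => f t r u rho s * g t r u rho s.
Definition kinv (f : kfun) : kfun := fun t r u rho s => / f t r u rho s.

Lemma cont_plus D f g : cont D f -> cont D g -> cont D (kplus f g).
Proof.
  intros Hf Hg t r u rho s Hd.
  apply continuous_ext with (fun x => plus (app5 f x) (app5 g x));
    [intros [[[[? ?] ?] ?] ?]; reflexivity |].
  apply @continuous_plus with (V := R_NormedModule); auto.
Qed.

Lemma cont_mult D f g : cont D f -> cont D g -> cont D (kmult f g).
Proof.
  intros Hf Hg t r u rho s Hd.
  apply continuous_ext with (fun x => mult (app5 f x) (app5 g x));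
    [intros [[[[? ?] ?] ?] ?]; reflexivity |].
  apply @continuous_mult with (K := R_AbsRing); auto.
Qed.

Definition nonzero_on (D : box) (f : kfun) : Prop :=
  forall t r u rho s, in_dom D t r u rho s -> f t r u rho s <> 0.

Lemma cont_inv D f : cont D f -> nonzero_on D f -> cont D (kinv f).
Proof.
  intros Hf Hn t r u rho s Hd.
  apply continuous_ext with (fun x => / (app5 f x));
    [intros [[[[? ?] ?] ?] ?]; reflexivity |].
  apply continuous_comp with (g := Rinv); [apply Hf, Hd |].
  apply (@ex_derive_continuous R_AbsRing R_NormedModule).
  eexists; apply is_derive_inv; [apply @is_derive_id | apply (Hn $ Hd)].
Qed.

Lemma is_derive_Rplus (f g : R -> R) x a b :
  is_derive f x a -> is_derive g x b -> is_derive (fun y => f y + g y) x (a + b).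
Proof. intros; apply @is_derive_plus with (V := R_NormedModule); assumption. Qed.

Lemma is_derive_Rminus (f g : R -> R) x a b :
  is_derive f x a -> is_derive g x b -> is_derive (fun y => f y - g y) x (a - b).
Proof. intros; apply @is_derive_minus with (V := R_NormedModule); assumption. Qed.

Lemma is_derive_Ropp (f : R -> R) x a :
  is_derive f x a -> is_derive (fun y => - f y) x (- a).
Proof. intros; apply @is_derive_opp with (V := R_NormedModule); assumption. Qed.

Lemma is_derive_Rmult (f g : R -> R) x a b :
  is_derive f x a -> is_derive g x b -> is_derive (fun y => f y * g y) x (a * g x + f x * b).
Proof.
  intros; apply @is_derive_mult with (K := R_AbsRing); try assumption.
  intros; apply Rmult_comm.
Qed.

Lemma is_derive_Rinv (f : R -> R) x a :
  is_derive f x a -> f x <> 0 -> is_derive (fun y => / f y) x (- a / (f x * f x)).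
Proof.
  intros; replace (- a / (f x * f x)) with (- a / f x ^ 2) by (simpl; rewrite Rmult_1_r; reflexivity).
  apply is_derive_inv; assumption.
Qed.

Lemma is_derive_Rdiv (f g : R -> R) x a b :
  is_derive f x a -> is_derive g x b -> g x <> 0 ->
  is_derive (fun y => f y / g y) x ((a * g x - f x * b) / (g x * g x)).
Proof.
  intros; replace (g x * g x) with (g x ^ 2) by ring.
  apply is_derive_div; assumption.
Qed.

Lemma is_derive_Rconst (c x : R) : is_derive (fun _ => c) x 0.
Proof. apply @is_derive_const. Qed.

Lemma is_derive_Rid (x : R) : is_derive (fun y => y) x 1.
Proof. apply @is_derive_id. Qed.

Lemma is_derive_eq (f : R -> R) x a b : is_derive f x a -> a = b -> is_derive f x b.
Proof. intros H <-; exact H. Qed.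

Lemma slice_fun i (F : R -> R) (f : kfun) t r u rho s :
  slice i (fun t r u rho s => F (f t r u rho s)) t r u rho s = fun x => F (slice i f t r u rho s x).
Proof. destruct i; reflexivity. Qed.

Lemma slice_fun2 i (F : R -> R -> R) (f g : kfun) t r u rho s :
  slice i (fun t r u rho s => F (f t r u rho s) (g t r u rho s)) t r u rho s
  = fun x => F (slice i f t r u rho s x) (slice i g t r u rho s x).
Proof. destruct i; reflexivity. Qed.

Lemma Ck_is_derive k D f i t r u rho s :
  Ck (S k) D f -> in_dom D t r u rho s ->
  is_derive (slice i f t r u rho s) (coord i t r u rho s) (partial i f t r u rho s).
Proof.
  intros H Hd; rewrite partialE; apply Derive_correct.
  exact (proj1 (proj2 (proj1 (Ck_S k D f) H)) i $ Hd).
Qed.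

Lemma Ck_plus k D f g : Ck k D f -> Ck k D g -> Ck k D (kplus f g).
Proof.
  revert f g; induction k as [|k IH]; intros f g Hf Hg.
  - exact (conj (cont_plus _ _ _ (Ck_cont _ _ _ Hf) (Ck_cont _ _ _ Hg)) I).
  - apply Ck_of_partials with (fun i => kplus (partial i f) (partial i g)).
    + exact (cont_plus _ _ _ (Ck_cont _ _ _ Hf) (Ck_cont _ _ _ Hg)).
    + intros i t r u rho s Hd; unfold kplus; rewrite (slice_fun2 i Rplus).
      apply is_derive_Rplus; eapply Ck_is_derive; eassumption.
    + intros i; apply IH; [apply (proj1 (Ck_S _ _ _) Hf) | apply (proj1 (Ck_S _ _ _) Hg)].
Qed.

Lemma Ck_mult k D f g : Ck k D f -> Ck k D g -> Ck k D (kmult f g).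
Proof.
  revert f g; induction k as [|k IH]; intros f g Hf Hg.
  - exact (conj (cont_mult _ _ _ (Ck_cont _ _ _ Hf) (Ck_cont _ _ _ Hg)) I).
  - apply Ck_of_partials with
      (fun i => kplus (kmult (partial i f) g) (kmult f (partial i g))).
    + exact (cont_mult _ _ _ (Ck_cont _ _ _ Hf) (Ck_cont _ _ _ Hg)).
    + intros i t r u rho s Hd; unfold kplus, kmult; rewrite (slice_fun2 i Rmult).
      eapply is_derive_eq.
      * apply is_derive_Rmult; eapply Ck_is_derive; eassumption.
      * rewrite !slice_coord; reflexivity.
    + intros i; apply Ck_plus; apply IH;
        solve [apply Ck_pred; assumption | apply (proj1 (Ck_S _ _ _) Hf) | apply (proj1 (Ck_S _ _ _) Hg)].
Qed.

Lemma Ck_inv k D f : nonzero_on D f -> Ck k D f -> Ck k D (kinv f).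
Proof.
  intros Hn; induction k as [|k IH]; intros Hf.
  - exact (conj (cont_inv _ _ (Ck_cont _ _ _ Hf) Hn) I).
  - apply Ck_of_partials with
      (fun i => kmult (kmult (fun _ _ _ _ _ => -1) (partial i f)) (kmult (kinv f) (kinv f))).
    + exact (cont_inv _ _ (Ck_cont _ _ _ Hf) Hn).
    + intros i t r u rho s Hd; unfold kmult, kinv; rewrite (slice_fun i Rinv).
      eapply is_derive_eq.
      * apply is_derive_Rinv; [eapply Ck_is_derive; eassumption |].
        rewrite slice_coord; apply Hn, Hd.
      * rewrite !slice_coord; pose proof (Hn $ Hd) as Hz; cbv beta in Hz |- *; simpl; field; assumption.
    + intros i; apply Ck_mult; [apply Ck_mult; [apply smooth_const | apply (proj1 (Ck_S _ _ _) Hf)] |].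
      apply Ck_mult; apply IH, Ck_pred, Hf.
Qed.

Lemma smooth_plus D f g : smooth D f -> smooth D g ->
  smooth D (fun t r u rho s => f t r u rho s + g t r u rho s).
Proof. intros Hf Hg k; apply Ck_plus; auto. Qed.

Lemma smooth_mult D f g : smooth D f -> smooth D g ->
  smooth D (fun t r u rho s => f t r u rho s * g t r u rho s).
Proof. intros Hf Hg k; apply Ck_mult; auto. Qed.

Lemma smooth_inv D f : smooth D f -> nonzero_on D f ->
  smooth D (fun t r u rho s => / f t r u rho s).
Proof. intros Hf Hn k; apply Ck_inv; auto. Qed.

Lemma smooth_opp D f : smooth D f -> smooth D (fun t r u rho s => - f t r u rho s).
Proof.
  intros Hf; apply smooth_ext with (kmult (fun _ _ _ _ _ => -1) f).
  - intros t r u rho s _; unfold kmult; ring.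
  - apply smooth_mult; [apply smooth_const | exact Hf].
Qed.

Lemma smooth_minus D f g : smooth D f -> smooth D g ->
  smooth D (fun t r u rho s => f t r u rho s - g t r u rho s).
Proof.
  intros Hf Hg; apply (smooth_plus D f (fun t r u rho s => - g t r u rho s)); auto.
  apply smooth_opp, Hg.
Qed.

Lemma smooth_div D f g : smooth D f -> smooth D g -> nonzero_on D g ->
  smooth D (fun t r u rho s => f t r u rho s / g t r u rho s).
Proof.
  intros Hf Hg Hn; apply (smooth_mult D f (fun t r u rho s => / g t r u rho s)); auto.
  apply smooth_inv; auto.
Qed.

Lemma smooth_pow D f m : smooth D f -> smooth D (fun t r u rho s => f t r u rho s ^ m).
Proof.
  intros Hf; induction m as [|m IH]; simpl.
  - apply smooth_const.
  - apply (smooth_mult D f (fun t r u rho s => f t r u rho s ^ m)); auto.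
Qed.

Lemma smooth_cont_slice D f i t r u rho s :
  smooth D f -> in_dom D t r u rho s ->
  continuous (slice i f t r u rho s) (coord i t r u rho s).
Proof.
  intros Hf Hd; apply (@ex_derive_continuous R_AbsRing R_NormedModule).
  eexists; eapply smooth_is_derive; eassumption.
Qed.

Definition sub_box (D' D : box) : Prop :=
  forall t r u rho s, in_dom D' t r u rho s -> in_dom D t r u rho s.

Lemma Ck_sub_box k D D' f : sub_box D' D -> Ck k D f -> Ck k D' f.
Proof.
  intros Hs; revert f; induction k as [|k IH]; intros f Hf.
  - split; [| exact I]; intros t r u rho s Hd; apply (proj1 Hf), Hs, Hd.
  - apply Ck_S in Hf; destruct Hf as (H1 & H2 & H3); apply Ck_S; split; [| split].
    + intros t r u rho s Hd; apply H1, Hs, Hd.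
    + intros; apply H2, Hs; assumption.
    + intros i; apply IH, H3.
Qed.

Lemma smooth_sub_box D D' f : sub_box D' D -> smooth D f -> smooth D' f.
Proof. intros Hs Hf k; apply (Ck_sub_box k D D' f Hs (Hf k)). Qed.

Lemma open_interval_ball I x (d : posreal) :
  Defs.open_interval I -> I x ->
  Defs.open_interval (fun y => I y /\ Rabs (y - x) < d).
Proof.
  intros (a & b & Hab & H) Hx.
  pose (a' := match a with Finite a => Rmax a (x - d) | _ => x - d end).
  pose (b' := match b with Finite b => Rmin b (x + d) | _ => x + d end).
  exists a', b'.
  assert (E : forall y, a' < y /\ y < b' <->
                        (Rbar_lt a y /\ Rbar_lt y b) /\ Rabs (y - x) < d).
  { pose proof (proj1 (H x) Hx) as [Hax Hxb].
    intros y; unfold a', b'; destruct a as [a| |], b as [b| |]; simpl in *; try tauto;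
      unfold Rmax, Rmin; repeat destruct Rle_dec; (split; intros Hy;
      repeat match goal with
      | H : _ /\ _ |- _ => destruct H
      | H : Rabs _ < _ |- _ => apply Rabs_def2 in H
      | |- _ /\ _ => split
      | |- Rabs _ < _ => apply Rabs_def1
      end; try tauto; try lra). }
  split.
  - assert (Hx' : a' < x /\ x < b').
    { apply E; split; [apply H, Hx |].
      rewrite Rminus_diag, Rabs_R0; apply cond_pos. }
    simpl; lra.
  - intros y; simpl; rewrite E, H; tauto.
Qed.

(** Turns one nonzero value into a whole box on which division by the function is allowed. The local
    contradictions below all start from here. *)
Lemma sub_box_nonzero D f t r u rho s :
  cont D f -> in_dom D t r u rho s -> f t r u rho s <> 0 ->
  exists D', sub_box D' D /\ in_dom D' t r u rho s /\ nonzero_on D' f.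
Proof.
  intros Hf Hd Hn.
  assert (L : locally (t, r, u, rho, s) (fun x => app5 f x <> 0)).
  { apply ((Hf $ Hd) (fun y => y <> 0)); simpl.
    apply open_neq, Hn. }
  destruct L as [d L].
  pose proof Hd as (Ht & Hr & Hu & Hrho & Hs).
  pose (B := fun (I : R -> Prop) (x y : R) => I y /\ Rabs (y - x) < d).
  unshelve eexists (Box (B (dom_t D) t) (B (dom_r D) r) (B (dom_u D) u)
    (B (dom_rho D) rho) (B (dom_s D) s) _ _ _ _ _ _ _).
  1-5: apply open_interval_ball; try assumption; destruct D; assumption.
  - intros x [Hx _]; apply (dom_r_pos D x Hx).
  - intros x [Hx _]; apply (dom_rho_pos D x Hx).
  - assert (Z : forall x : R, Rabs (x - x) < d).
    { intros x; rewrite Rminus_diag, Rabs_R0; apply cond_pos. }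
    split; [| split].
    + intros t' r' u' rho' s'; unfold in_dom, B; simpl; tauto.
    + unfold in_dom, B; simpl; auto 10.
    + intros t' r' u' rho' s' H; unfold in_dom, B in H; simpl in H.
      apply (L (t', r', u', rho', s')); simpl.
      destruct H as ((_ & ?) & (_ & ?) & (_ & ?) & (_ & ?) & (_ & ?)).
      repeat split; simpl; assumption.
Qed.

Lemma continuous_pair {T A B : UniformSpace} (f : T -> A) (g : T -> B) x :
  continuous f x -> continuous g x -> continuous (fun z => (f z, g z)) x.
Proof.
  intros Hf Hg.
  apply (filterlim_filter_le_2 (G := filter_prod (locally (f x)) (locally (g x)))).
  - intros P [d Hd]; exists (ball (f x) d) (ball (g x) d); try apply locally_ball.
    intros y z Hy Hz; apply Hd; split; assumption.
  - apply filterlim_pair; assumption.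
Qed.

Lemma continuous_comp_app5 {T : UniformSpace} D f (a b c d e : T -> R) (z : T) :
  cont D f -> in_dom D (a z) (b z) (c z) (d z) (e z) ->
  continuous a z -> continuous b z -> continuous c z -> continuous d z -> continuous e z ->
  continuous (fun y => f (a y) (b y) (c y) (d y) (e y)) z.
Proof.
  intros Hf Hd Ha Hb Hc Hdd He.
  apply (continuous_comp (fun y => (a y, b y, c y, d y, e y)) (app5 f)).
  - apply continuous_pair; [| assumption].
    apply continuous_pair; [| assumption].
    apply continuous_pair; [| assumption].
    apply continuous_pair; assumption.
  - apply Hf, Hd.
Qed.

(** * Differentiating identities *)

Lemma smooth_d_t D f : smooth D f -> smooth D (d_t f). Proof. apply (smooth_partial D f DT). Qed.
Lemma smooth_d_r D f : smooth D f -> smooth D (d_r f). Proof. apply (smooth_partial D f DR). Qed.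
Lemma smooth_d_u D f : smooth D f -> smooth D (d_u f). Proof. apply (smooth_partial D f DU). Qed.
Lemma smooth_d_rho D f : smooth D f -> smooth D (d_rho f). Proof. apply (smooth_partial D f DRho). Qed.
Lemma smooth_d_s D f : smooth D f -> smooth D (d_s f). Proof. apply (smooth_partial D f DS). Qed.
Lemma smooth_t D : smooth D (fun t _ _ _ _ => t). Proof. apply (smooth_coord D DT). Qed.
Lemma smooth_r D : smooth D (fun _ r _ _ _ => r). Proof. apply (smooth_coord D DR). Qed.
Lemma smooth_u D : smooth D (fun _ _ u _ _ => u). Proof. apply (smooth_coord D DU). Qed.
Lemma smooth_rho D : smooth D (fun _ _ _ rho _ => rho). Proof. apply (smooth_coord D DRho). Qed.
Lemma smooth_s D : smooth D (fun _ _ _ _ s => s). Proof. apply (smooth_coord D DS). Qed.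

Create HintDb smooth.
#[export] Hint Resolve smooth_d_t smooth_d_r smooth_d_u smooth_d_rho smooth_d_s : smooth.

Lemma in_dom_r_neq0 D t r u rho s : in_dom D t r u rho s -> r <> 0.
Proof. intros (_ & H & _); apply Rgt_not_eq, (dom_r_pos D r H). Qed.

Lemma in_dom_rho_neq0 D t r u rho s : in_dom D t r u rho s -> rho <> 0.
Proof. intros (_ & _ & _ & H & _); apply Rgt_not_eq, (dom_rho_pos D rho H). Qed.

Arguments in_dom_r_neq0 {D t r u rho s} _ _.
Arguments in_dom_rho_neq0 {D t r u rho s} _ _.

Ltac smooth_tac :=
  lazymatch goal with
  | |- smooth _ (fun t r u rho s => @?a t r u rho s + @?b t r u rho s) => apply (smooth_plus _ a b); smooth_tac
  | |- smooth _ (fun t r u rho s => @?a t r u rho s - @?b t r u rho s) => apply (smooth_minus _ a b); smooth_tac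
  | |- smooth _ (fun t r u rho s => @?a t r u rho s * @?b t r u rho s) => apply (smooth_mult _ a b); smooth_tac
  | |- smooth _ (fun t r u rho s => - @?a t r u rho s) => apply (smooth_opp _ a); smooth_tac
  | |- smooth _ (fun t r u rho s => / @?a t r u rho s) => apply (smooth_inv _ a); [smooth_tac | try nonzero_tac]
  | |- smooth _ (fun t r u rho s => @?a t r u rho s / @?b t r u rho s) =>
      apply (smooth_div _ a b); [smooth_tac | smooth_tac | try nonzero_tac]
  | |- smooth _ (fun t r u rho s => @?a t r u rho s ^ ?m) => apply (smooth_pow _ a m); smooth_tac
  | |- smooth _ (fun _ _ _ _ _ => ?c) => apply smooth_const
  | |- smooth _ (fun t _ _ _ _ => t) => apply smooth_t
  | |- smooth _ (fun _ r _ _ _ => r) => apply smooth_r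
  | |- smooth _ (fun _ _ u _ _ => u) => apply smooth_u
  | |- smooth _ (fun _ _ _ rho _ => rho) => apply smooth_rho
  | |- smooth _ (fun _ _ _ _ s => s) => apply smooth_s
  | |- _ => eauto with smooth
  end
with nonzero_tac :=
  let Hd := fresh in
  intros ? ? ? ? ? Hd; cbv beta;
  first [exact (in_dom_r_neq0 Hd)
        | exact (in_dom_rho_neq0 Hd)
        | apply pow_nonzero; exact (in_dom_r_neq0 Hd)
        | eauto; fail].


Ltac coords_neq0 Hd :=
  pose proof (in_dom_r_neq0 Hd) as hr; pose proof (in_dom_rho_neq0 Hd) as hrho.

Lemma diff_eq i D (f g : kfun) t r u rho s a b :
  (forall t r u rho s, in_dom D t r u rho s -> f t r u rho s = g t r u rho s) ->
  in_dom D t r u rho s ->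
  is_derive (slice i f t r u rho s) (coord i t r u rho s) a ->
  is_derive (slice i g t r u rho s) (coord i t r u rho s) b -> a = b.
Proof.
  intros H Hd Ha Hb.
  apply is_derive_unique in Ha; apply is_derive_unique in Hb; rewrite <- Ha, <- Hb.
  apply Derive_ext_loc; eapply eq_on_slice; eassumption.
Qed.

Lemma is_derive_d_t D f t r u rho s : smooth D f -> in_dom D t r u rho s ->
  is_derive (fun x => f x r u rho s) t (d_t f t r u rho s).
Proof. apply (smooth_is_derive D f DT). Qed.
Lemma is_derive_d_r D f t r u rho s : smooth D f -> in_dom D t r u rho s ->
  is_derive (fun x => f t x u rho s) r (d_r f t r u rho s).
Proof. apply (smooth_is_derive D f DR). Qed.
Lemma is_derive_d_u D f t r u rho s : smooth D f -> in_dom D t r u rho s ->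
  is_derive (fun x => f t r x rho s) u (d_u f t r u rho s).
Proof. apply (smooth_is_derive D f DU). Qed.
Lemma is_derive_d_rho D f t r u rho s : smooth D f -> in_dom D t r u rho s ->
  is_derive (fun x => f t r u x s) rho (d_rho f t r u rho s).
Proof. apply (smooth_is_derive D f DRho). Qed.
Lemma is_derive_d_s D f t r u rho s : smooth D f -> in_dom D t r u rho s ->
  is_derive (fun x => f t r u rho x) s (d_s f t r u rho s).
Proof. apply (smooth_is_derive D f DS). Qed.

Lemma is_derive_Rpow (f : R -> R) x a m :
  is_derive f x a -> f x <> 0 -> is_derive (fun y => f y ^ m) x (INR m * a * f x ^ m / f x).
Proof.
  intros Hf Hn; eapply is_derive_eq; [apply is_derive_pow, Hf |].
  match goal with |- ?b = ?c => change (@eq R b c) end.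
  destruct m as [|m]; [simpl; field; assumption |].
  replace (f x ^ S m) with (f x * f x ^ m) by reflexivity.
  change (Init.Nat.pred (S m)) with m; field; assumption.
Qed.

Lemma is_derive_sqr (f : R -> R) x a : is_derive f x a -> is_derive (fun y => f y ^ 2) x (2 * a * f x).
Proof. intros H; eapply is_derive_eq; [apply is_derive_pow, H |].
  match goal with |- ?b = ?c => change (@eq R b c) end; simpl; ring. Qed.

(* Computes the derivative (an evar) of a rational expression in the coordinates
   and in smooth functions evaluated at the point of [Hd]. *)
Ltac der Hd :=
  cbv beta;
  lazymatch goal with
  | |- is_derive (fun _ => ?c) _ _ => apply (is_derive_Rconst c)
  | |- is_derive (fun x => x) _ _ => apply is_derive_Rid
  | |- is_derive (fun x => @?a x + @?b x) _ _ => apply (is_derive_Rplus a b); der Hd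
  | |- is_derive (fun x => @?a x - @?b x) _ _ => apply (is_derive_Rminus a b); der Hd
  | |- is_derive (fun x => @?a x * @?b x) _ _ => apply (is_derive_Rmult a b); der Hd
  | |- is_derive (fun x => - @?a x) _ _ => apply (is_derive_Ropp a); der Hd
  | |- is_derive (fun x => @?a x / @?b x) _ _ => apply (is_derive_Rdiv a b); [der Hd | der Hd | cbv beta; try der_side Hd]
  | |- is_derive (fun x => / @?a x) _ _ => apply (is_derive_Rinv a); [der Hd | cbv beta; try der_side Hd]
  | |- is_derive (fun x => @?a x ^ 2) _ _ => apply (is_derive_sqr a); der Hd
  | |- is_derive (fun x => @?a x ^ ?m) _ _ => apply (is_derive_Rpow a); [der Hd | cbv beta; try der_side Hd]
  | |- is_derive (fun x => ?f x _ _ _ _) _ _ => eapply (is_derive_d_t _ f); [smooth_tac | exact Hd]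
  | |- is_derive (fun x => ?f _ x _ _ _) _ _ => eapply (is_derive_d_r _ f); [smooth_tac | exact Hd]
  | |- is_derive (fun x => ?f _ _ x _ _) _ _ => eapply (is_derive_d_u _ f); [smooth_tac | exact Hd]
  | |- is_derive (fun x => ?f _ _ _ x _) _ _ => eapply (is_derive_d_rho _ f); [smooth_tac | exact Hd]
  | |- is_derive (fun x => ?f _ _ _ _ x) _ _ => eapply (is_derive_d_s _ f); [smooth_tac | exact Hd]
  end
with der_side Hd :=
  first [assumption
        | exact (in_dom_r_neq0 Hd)
        | exact (in_dom_rho_neq0 Hd)
        | apply pow_nonzero; exact (in_dom_r_neq0 Hd)
        | match goal with H : nonzero_on _ ?f |- _ => exact (H $ Hd) end
        | lra
        | apply Rmult_integral_contrapositive_currified; der_side Hd].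

(* [is_derive] leaves equations in the carrier of [R_NormedModule], which [ring] and
   [field] do not recognise as [R]. *)
Ltac req := cbv beta; match goal with |- ?a = ?b => change (@eq R a b) end.

(* [diff i H Hd as E]: differentiate the identity [H], valid on the whole box,
   with respect to the coordinate [i] at the point of [Hd]. *)
Tactic Notation "diff" constr(i) constr(H) constr(Hd) "as" ident(E) :=
  let a := fresh in let b := fresh in
  evar (a : R); evar (b : R);
  assert (E : a = b);
  [ subst a b; eapply (diff_eq i _ _ _ _ _ _ _ _ _ _ H Hd); cbn [slice coord]; der Hd
  | subst a b; cbv beta in E ].

(** Equational proofs are given as certificates: a combination of known equations, written in
    [eq_scope], after which [a - b = c - d] is left to [ring] or [field]. *)
Lemma equation_lincomb (a b c d : R) : c = d -> a - b = c - d -> a = b.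
Proof. lra. Qed.
Lemma eq_add (a b c d : R) : a = b -> c = d -> a + c = b + d.
Proof. congruence. Qed.
Lemma eq_scale (k a b : R) : a = b -> k * a = k * b.
Proof. congruence. Qed.

Lemma locally_2d_of_intervals (I J : R -> Prop) x y :
  Defs.open_interval I -> Defs.open_interval J -> I x -> J y -> locally_2d (fun a b => I a /\ J b) x y.
Proof.
  intros HI HJ Hx Hy; apply locally_2d_locally.
  apply locally_pair with (P := I) (Q := J); apply open_interval_locally; assumption.
Qed.

Ltac schwarz F x y i j D C D1 D2 Hf HI HJ Hx Hy :=
  apply (Schwarz F x y);
  [ generalize (locally_2d_of_intervals _ _ _ _ HI HJ Hx Hy);
    apply locally_2d_impl; apply locally_2d_forall; intros a b [Ha Hb];
    repeat split; eexists;
    [ eapply (D1 i); [exact Hf | unfold in_dom; tauto]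
    | eapply (D1 j); [exact Hf | unfold in_dom; tauto]
    | eapply (D2 i j); [apply smooth_partial, Hf | unfold in_dom; tauto]
    | eapply (D2 j i); [apply smooth_partial, Hf | unfold in_dom; tauto] ]
  | apply continuity_2d_pt_filterlim;
    refine (continuous_comp_app5 D _ _ _ _ _ _ (x, y) (C i j) _ _ _ _ _ _);
    [ unfold in_dom; tauto | ..];
    solve [apply continuous_fst | apply continuous_snd | apply continuous_const]
  | apply continuity_2d_pt_filterlim;
    refine (continuous_comp_app5 D _ _ _ _ _ _ (x, y) (C j i) _ _ _ _ _ _);
    [ unfold in_dom; tauto | ..];
    solve [apply continuous_fst | apply continuous_snd | apply continuous_const] ].

Lemma partial_comm_lt D f t r u rho s : smooth D f -> in_dom D t r u rho s ->
  d_t (d_r f) t r u rho s = d_r (d_t f) t r u rho s /\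
  d_t (d_u f) t r u rho s = d_u (d_t f) t r u rho s /\
  d_t (d_rho f) t r u rho s = d_rho (d_t f) t r u rho s /\
  d_t (d_s f) t r u rho s = d_s (d_t f) t r u rho s /\
  d_r (d_u f) t r u rho s = d_u (d_r f) t r u rho s /\
  d_r (d_rho f) t r u rho s = d_rho (d_r f) t r u rho s /\
  d_r (d_s f) t r u rho s = d_s (d_r f) t r u rho s /\
  d_u (d_rho f) t r u rho s = d_rho (d_u f) t r u rho s /\
  d_u (d_s f) t r u rho s = d_s (d_u f) t r u rho s /\
  d_rho (d_s f) t r u rho s = d_s (d_rho f) t r u rho s.
Proof.
  intros Hf (Ht & Hr & Hu & Hrho & Hs).
  assert (Hd : in_dom D t r u rho s) by (unfold in_dom; tauto).
  pose proof (fun i j => smooth_cont D _ (smooth_partial D _ i (smooth_partial D f j Hf))) as C.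
  pose proof (fun i => smooth_is_derive D f i) as D1.
  pose proof (fun i j => smooth_is_derive D (partial j f) i) as D2.
  repeat match goal with |- _ /\ _ => split end.
  - schwarz (fun x y => f x y u rho s) t r DT DR D C D1 D2 Hf (dom_t_open D) (dom_r_open D) Ht Hr.
  - schwarz (fun x y => f x r y rho s) t u DT DU D C D1 D2 Hf (dom_t_open D) (dom_u_open D) Ht Hu.
  - schwarz (fun x y => f x r u y s) t rho DT DRho D C D1 D2 Hf (dom_t_open D) (dom_rho_open D) Ht Hrho.
  - schwarz (fun x y => f x r u rho y) t s DT DS D C D1 D2 Hf (dom_t_open D) (dom_s_open D) Ht Hs.
  - schwarz (fun x y => f t x y rho s) r u DR DU D C D1 D2 Hf (dom_r_open D) (dom_u_open D) Hr Hu.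
  - schwarz (fun x y => f t x u y s) r rho DR DRho D C D1 D2 Hf (dom_r_open D) (dom_rho_open D) Hr Hrho.
  - schwarz (fun x y => f t x u rho y) r s DR DS D C D1 D2 Hf (dom_r_open D) (dom_s_open D) Hr Hs.
  - schwarz (fun x y => f t r x y s) u rho DU DRho D C D1 D2 Hf (dom_u_open D) (dom_rho_open D) Hu Hrho.
  - schwarz (fun x y => f t r x rho y) u s DU DS D C D1 D2 Hf (dom_u_open D) (dom_s_open D) Hu Hs.
  - schwarz (fun x y => f t r u x y) rho s DRho DS D C D1 D2 Hf (dom_rho_open D) (dom_s_open D) Hrho Hs.
Qed.

(** * The overdetermined system for the multiplier *)

Declare Scope eq_scope.
Delimit Scope eq_scope with eqn.
Notation "a + b" := (eq_add _ _ _ _ a b) : eq_scope.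
Notation "k * a" := (eq_scale k%R _ _ a) : eq_scope.
Ltac lincomb H := apply (equation_lincomb _ _ _ _ H).

Ltac exact_comm H :=
  destruct H as (? & ? & ? & ? & ? & ? & ? & ? & ? & ?); assumption.

Lemma comm_tr D f t r u rho s : smooth D f -> in_dom D t r u rho s ->
  d_t (d_r f) t r u rho s = d_r (d_t f) t r u rho s.
Proof. intros Hf Hd; exact_comm (partial_comm_lt D f t r u rho s Hf Hd). Qed.
Lemma comm_tu D f t r u rho s : smooth D f -> in_dom D t r u rho s ->
  d_t (d_u f) t r u rho s = d_u (d_t f) t r u rho s.
Proof. intros Hf Hd; exact_comm (partial_comm_lt D f t r u rho s Hf Hd). Qed.
Lemma comm_trho D f t r u rho s : smooth D f -> in_dom D t r u rho s ->
  d_t (d_rho f) t r u rho s = d_rho (d_t f) t r u rho s.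
Proof. intros Hf Hd; exact_comm (partial_comm_lt D f t r u rho s Hf Hd). Qed.
Lemma comm_ts D f t r u rho s : smooth D f -> in_dom D t r u rho s ->
  d_t (d_s f) t r u rho s = d_s (d_t f) t r u rho s.
Proof. intros Hf Hd; exact_comm (partial_comm_lt D f t r u rho s Hf Hd). Qed.
Lemma comm_ru D f t r u rho s : smooth D f -> in_dom D t r u rho s ->
  d_r (d_u f) t r u rho s = d_u (d_r f) t r u rho s.
Proof. intros Hf Hd; exact_comm (partial_comm_lt D f t r u rho s Hf Hd). Qed.
Lemma comm_rrho D f t r u rho s : smooth D f -> in_dom D t r u rho s ->
  d_r (d_rho f) t r u rho s = d_rho (d_r f) t r u rho s.
Proof. intros Hf Hd; exact_comm (partial_comm_lt D f t r u rho s Hf Hd). Qed.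
Lemma comm_rs D f t r u rho s : smooth D f -> in_dom D t r u rho s ->
  d_r (d_s f) t r u rho s = d_s (d_r f) t r u rho s.
Proof. intros Hf Hd; exact_comm (partial_comm_lt D f t r u rho s Hf Hd). Qed.
Lemma comm_urho D f t r u rho s : smooth D f -> in_dom D t r u rho s ->
  d_u (d_rho f) t r u rho s = d_rho (d_u f) t r u rho s.
Proof. intros Hf Hd; exact_comm (partial_comm_lt D f t r u rho s Hf Hd). Qed.
Lemma comm_us D f t r u rho s : smooth D f -> in_dom D t r u rho s ->
  d_u (d_s f) t r u rho s = d_s (d_u f) t r u rho s.
Proof. intros Hf Hd; exact_comm (partial_comm_lt D f t r u rho s Hf Hd). Qed.
Lemma comm_rhos D f t r u rho s : smooth D f -> in_dom D t r u rho s ->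
  d_rho (d_s f) t r u rho s = d_s (d_rho f) t r u rho s.
Proof. intros Hf Hd; exact_comm (partial_comm_lt D f t r u rho s Hf Hd). Qed.

(* Moves [d_t] innermost and [d_s] outermost in second derivatives. *)
Ltac canon Hd E :=
  repeat match type of E with
  | context [d_t (d_r ?f) ?t ?r ?u ?rho ?s] => rewrite (comm_tr _ f t r u rho s ltac:(smooth_tac) Hd) in E
  | context [d_t (d_u ?f) ?t ?r ?u ?rho ?s] => rewrite (comm_tu _ f t r u rho s ltac:(smooth_tac) Hd) in E
  | context [d_t (d_rho ?f) ?t ?r ?u ?rho ?s] => rewrite (comm_trho _ f t r u rho s ltac:(smooth_tac) Hd) in E
  | context [d_t (d_s ?f) ?t ?r ?u ?rho ?s] => rewrite (comm_ts _ f t r u rho s ltac:(smooth_tac) Hd) in E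
  | context [d_r (d_u ?f) ?t ?r ?u ?rho ?s] => rewrite (comm_ru _ f t r u rho s ltac:(smooth_tac) Hd) in E
  | context [d_r (d_rho ?f) ?t ?r ?u ?rho ?s] => rewrite (comm_rrho _ f t r u rho s ltac:(smooth_tac) Hd) in E
  | context [d_r (d_s ?f) ?t ?r ?u ?rho ?s] => rewrite (comm_rs _ f t r u rho s ltac:(smooth_tac) Hd) in E
  | context [d_u (d_rho ?f) ?t ?r ?u ?rho ?s] => rewrite (comm_urho _ f t r u rho s ltac:(smooth_tac) Hd) in E
  | context [d_u (d_s ?f) ?t ?r ?u ?rho ?s] => rewrite (comm_us _ f t r u rho s ltac:(smooth_tac) Hd) in E
  | context [d_rho (d_s ?f) ?t ?r ?u ?rho ?s] => rewrite (comm_rhos _ f t r u rho s ltac:(smooth_tac) Hd) in E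
  end.

Tactic Notation "cdiff" constr(i) constr(H) constr(Hd) "as" ident(E) :=
  diff i H Hd as E; canon Hd E.

(* For a conserved integral with [P = p_rho], these are the equations satisfied by
   [V = Phi^t_U / rho] and [H = Phi^t_rho]; [N = n - 1]. *)
Record multiplier_system (D : box) (N : R) (P V H : kfun) : Prop := {
  ms_P : smooth D P;
  ms_V : smooth D V;
  ms_H : smooth D H;
  ms_Pt : forall t r u rho s, in_dom D t r u rho s -> d_t P t r u rho s = 0;
  ms_Pr : forall t r u rho s, in_dom D t r u rho s -> d_r P t r u rho s = 0;
  ms_Pu : forall t r u rho s, in_dom D t r u rho s -> d_u P t r u rho s = 0;
  ms_1 : forall t r u rho s, in_dom D t r u rho s ->
    d_t V t r u rho s + u * d_r V t r u rho s + d_r H t r u rho s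
    + N / r * u * (V t r u rho s - d_u H t r u rho s) = 0;
  ms_2 : forall t r u rho s, in_dom D t r u rho s ->
    d_t H t r u rho s + u * d_r H t r u rho s
    + P t r u rho s * (d_r V t r u rho s
        + N / r * (V t r u rho s - u * d_u V t r u rho s)) = 0;
  ms_3 : forall t r u rho s, in_dom D t r u rho s ->
    rho * d_rho V t r u rho s = d_u H t r u rho s - V t r u rho s;
  ms_4 : forall t r u rho s, in_dom D t r u rho s ->
    rho * d_rho H t r u rho s = P t r u rho s * d_u V t r u rho s
}.

Arguments ms_1 {D N P V H} _.
Arguments ms_2 {D N P V H} _.
Arguments ms_3 {D N P V H} _.
Arguments ms_4 {D N P V H} _.

(** The compatibility condition of the system. When [ms_4] is differentiated along [d_t + U d_r] and
    compared with [rho d_rho] of [ms_2] and [P d_U] of [ms_1], the second derivatives of [H] cancel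
    by commutation and those of [V] with the help of [ms_3]. *)
Lemma multiplier_constraint D N P V H : multiplier_system D N P V H ->
  forall t r u rho s, in_dom D t r u rho s ->
  rho * d_rho P t r u rho s * (d_r V t r u rho s
     + N / r * (V t r u rho s - u * d_u V t r u rho s))
  = 2 * P t r u rho s * (d_r V t r u rho s
     + N / r * (V t r u rho s - d_u H t r u rho s)).
Proof.
  intros [sP sV sH Pt Pr Pu E1 E2 E3 E4] t r u rho s Hd.
  coords_neq0 Hd.
  cdiff DRho E2 Hd as E2rho.
  cdiff DU E1 Hd as E1u.
  cdiff DT E4 Hd as E4t.
  cdiff DR E4 Hd as E4r.
  cdiff DR E3 Hd as E3r.
  cdiff DU E3 Hd as E3u.
  pose proof (E3 $ Hd) as E3'.
  pose proof (Pt $ Hd) as Pt'. pose proof (Pr $ Hd) as Pr'. pose proof (Pu $ Hd) as Pu'.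
  rewrite ?Pt', ?Pr', ?Pu' in *.
  lincomb (rho * E2rho + (- P t r u rho s) * E1u + (-1) * E4t + (- u) * E4r
    + (- P t r u rho s) * E3r + (- P t r u rho s * N / r) * E3'
    + (P t r u rho s * N / r * u) * E3u)%eqn.
  field; auto.
Qed.

(* Here [k = rho p_rhorho / (2 p_rho)], [J = H_U - U V_U] and [w = V_UU];
   [rs_compat_tr] is the equality of V_Utr and V_Urt. *)
Record reduced_system (D : box) (N : R) (P k J w : kfun) : Prop := {
  rs_P : smooth D P;
  rs_k : smooth D k;
  rs_J : smooth D J;
  rs_w : smooth D w;
  rs_k1 : nonzero_on D (fun t r u rho s => 1 - k t r u rho s);
  rs_Pr : forall t r u rho s, in_dom D t r u rho s -> d_r P t r u rho s = 0;
  rs_Pu : forall t r u rho s, in_dom D t r u rho s -> d_u P t r u rho s = 0;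
  rs_kt : forall t r u rho s, in_dom D t r u rho s -> d_t k t r u rho s = 0;
  rs_kr : forall t r u rho s, in_dom D t r u rho s -> d_r k t r u rho s = 0;
  rs_ku : forall t r u rho s, in_dom D t r u rho s -> d_u k t r u rho s = 0;
  rs_Prho : forall t r u rho s, in_dom D t r u rho s ->
    d_rho P t r u rho s = 2 * k t r u rho s * P t r u rho s / rho;
  rs_Jrho : forall t r u rho s, in_dom D t r u rho s ->
    d_rho J t r u rho s = ((P t r u rho s - u * u) * w t r u rho s - u * d_u J t r u rho s) / rho;
  rs_wrho : forall t r u rho s, in_dom D t r u rho s ->
    d_rho w t r u rho s
    = (w t r u rho s + u * d_u w t r u rho s + d_u (d_u J) t r u rho s) / rho;
  rs_Jr : forall t r u rho s, in_dom D t r u rho s ->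
    d_r J t r u rho s = N / (r * (1 - k t r u rho s))
      * ((rho * d_rho k t r u rho s / (1 - k t r u rho s) + k t r u rho s) * J t r u rho s
         + (P t r u rho s - u * u) * w t r u rho s
         - (1 + k t r u rho s) * u * d_u J t r u rho s);
  rs_wr : forall t r u rho s, in_dom D t r u rho s ->
    d_r w t r u rho s = N / r * (w t r u rho s + u * d_u w t r u rho s
        + d_u (d_u J) t r u rho s / (1 - k t r u rho s));
  rs_wt : forall t r u rho s, in_dom D t r u rho s ->
    d_t w t r u rho s = - (N / (r * (1 - k t r u rho s)))
      * ((rho * d_rho k t r u rho s / (1 - k t r u rho s) + 2 * k t r u rho s) * d_u J t r u rho s
         + (P t r u rho s - k t r u rho s * u * u) * d_u w t r u rho s
         - 2 * k t r u rho s * u * w t r u rho s);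
  rs_compat_tr : forall t r u rho s, in_dom D t r u rho s ->
    (rho * d_rho k t r u rho s / (1 - k t r u rho s) + k t r u rho s - (1 - k t r u rho s) / N)
    * ((rho * d_rho k t r u rho s / (1 - k t r u rho s) + 2 * k t r u rho s) * J t r u rho s
       + (P t r u rho s - k t r u rho s * u * u) * w t r u rho s)
    = rho * d_rho k t r u rho s / (1 - k t r u rho s)
      * (J t r u rho s + 2 * u * d_u J t r u rho s
         + (1 - k t r u rho s) * u * u * w t r u rho s)
}.

Lemma multiplier_reduction D N P k V H J : N <> 0 ->
  multiplier_system D N P V H -> nonzero_on D P ->
  smooth D k -> smooth D J ->
  nonzero_on D (fun t r u rho s => 1 - k t r u rho s) ->
  (forall t r u rho s, in_dom D t r u rho s -> d_t k t r u rho s = 0) ->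
  (forall t r u rho s, in_dom D t r u rho s -> d_r k t r u rho s = 0) ->
  (forall t r u rho s, in_dom D t r u rho s -> d_u k t r u rho s = 0) ->
  (forall t r u rho s, in_dom D t r u rho s ->
    d_rho P t r u rho s = 2 * k t r u rho s * P t r u rho s / rho) ->
  (forall t r u rho s, in_dom D t r u rho s ->
    J t r u rho s = d_u H t r u rho s - u * d_u V t r u rho s) ->
  reduced_system D N P k J (d_u (d_u V)).
Proof.
  intros hN MS nP sk sJ nb kt kr ku Prho HJ.
  pose proof (multiplier_constraint _ _ _ _ _ MS) as C.
  destruct MS as [sP sV sH Pt Pr Pu E1 E2 E3 E4].
  (* Where [k <> 1] the constraint can be solved for [V_r], and only [J] enters besides [V] and
     [V_U]. *)
  assert (F1 : forall t r u rho s, in_dom D t r u rho s ->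
    d_r V t r u rho s = N / r * (J t r u rho s / (1 - k t r u rho s) - V t r u rho s + u * d_u V t r u rho s)).
  { intros t r u rho s Hd.
    coords_neq0 Hd.
    pose proof (nb $ Hd) as hb; cbv beta in hb.
    pose proof (nP $ Hd) as hP.
    pose proof (C $ Hd) as C'.
    rewrite (HJ $ Hd).
    rewrite (Prho $ Hd) in C'.
    lincomb (- / (2 * P t r u rho s * (1 - k t r u rho s)) * C')%eqn.
    field; auto. }
  assert (F1u : forall t r u rho s, in_dom D t r u rho s ->
    d_u (d_r V) t r u rho s = N / r * (d_u J t r u rho s / (1 - k t r u rho s) + u * d_u (d_u V) t r u rho s)).
  { intros t r u rho s Hd.
    coords_neq0 Hd.
    pose proof (nb $ Hd) as hb; cbv beta in hb.
    cdiff DU F1 Hd as E; rewrite (ku $ Hd) in E.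
    rewrite E; field; auto. }
  assert (E3u : forall t r u rho s, in_dom D t r u rho s ->
    d_rho (d_u V) t r u rho s = (d_u (d_u H) t r u rho s - d_u V t r u rho s) / rho).
  { intros t r u rho s Hd.
    coords_neq0 Hd.
    cdiff DU E3 Hd as E.
    lincomb (/ rho * E)%eqn; field; auto. }
  assert (Ju : forall t r u rho s, in_dom D t r u rho s ->
    d_u J t r u rho s = d_u (d_u H) t r u rho s - d_u V t r u rho s - u * d_u (d_u V) t r u rho s).
  { intros t r u rho s Hd; cdiff DU HJ Hd as E; rewrite E; ring. }
  assert (Jrho : forall t r u rho s, in_dom D t r u rho s ->
    d_rho J t r u rho s
    = ((P t r u rho s - u * u) * d_u (d_u V) t r u rho s - u * d_u J t r u rho s) / rho).
  { intros t r u rho s Hd.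
    coords_neq0 Hd.
    cdiff DRho HJ Hd as E; cdiff DU E4 Hd as E4u.
    rewrite (Pu $ Hd) in E4u; rewrite (E3u $ Hd) in E.
    rewrite (Ju $ Hd).
    lincomb (E + (/ rho) * E4u)%eqn; field; auto. }
  assert (wrho : forall t r u rho s, in_dom D t r u rho s ->
    d_rho (d_u (d_u V)) t r u rho s
    = (d_u (d_u V) t r u rho s + u * d_u (d_u (d_u V)) t r u rho s + d_u (d_u J) t r u rho s) / rho).
  { intros t r u rho s Hd.
    coords_neq0 Hd.
    cdiff DU E3u Hd as E; cdiff DU Ju Hd as Juu.
    rewrite E, Juu; field; auto. }
  (* The [r]-derivative of [ms_3] expresses [H_{rU}] by [V_{r rho}], and [V_r] is now known; this is
     where [k_rho] enters. *)
  assert (Hru : forall t r u rho s, in_dom D t r u rho s ->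
    d_u (d_r H) t r u rho s = N / (r * (1 - k t r u rho s))
      * ((rho * d_rho k t r u rho s / (1 - k t r u rho s) + k t r u rho s) * J t r u rho s
         + (P t r u rho s - k t r u rho s * u * u) * d_u (d_u V) t r u rho s
         - k t r u rho s * u * d_u J t r u rho s)).
  { intros t r u rho s Hd.
    coords_neq0 Hd.
    pose proof (nb $ Hd) as hb; cbv beta in hb.
    cdiff DRho F1 Hd as E; cdiff DR E3 Hd as E3r.
    pose proof (E3 $ Hd) as E3'.
    pose proof (HJ $ Hd) as HJ'.
    assert (Huu := Ju $ Hd).
    assert (Hu : d_u H t r u rho s = J t r u rho s + u * d_u V t r u rho s) by lra.
    assert (Vrho : d_rho V t r u rho s = (J t r u rho s + u * d_u V t r u rho s - V t r u rho s) / rho).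
    { rewrite <- Hu; lincomb (/ rho * E3')%eqn; field; auto. }
    rewrite Vrho, (Jrho $ Hd), (E3u $ Hd) in E.
    assert (Huu' : d_u (d_u H) t r u rho s = d_u J t r u rho s + d_u V t r u rho s + u * d_u (d_u V) t r u rho s) by lra.
    rewrite Huu' in E.
    assert (X : d_u (d_r H) t r u rho s = d_r V t r u rho s + rho * d_rho (d_r V) t r u rho s) by lra.
    rewrite X, E, (F1 $ Hd); field; auto. }
  assert (Jr : forall t r u rho s, in_dom D t r u rho s ->
    d_r J t r u rho s = N / (r * (1 - k t r u rho s))
      * ((rho * d_rho k t r u rho s / (1 - k t r u rho s) + k t r u rho s) * J t r u rho s
         + (P t r u rho s - u * u) * d_u (d_u V) t r u rho s
         - (1 + k t r u rho s) * u * d_u J t r u rho s)).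
  { intros t r u rho s Hd.
    coords_neq0 Hd.
    pose proof (nb $ Hd) as hb; cbv beta in hb.
    cdiff DR HJ Hd as E; rewrite (Hru $ Hd), (F1u $ Hd) in E.
    rewrite E; field; auto. }
  assert (wr : forall t r u rho s, in_dom D t r u rho s ->
    d_r (d_u (d_u V)) t r u rho s
    = N / r * (d_u (d_u V) t r u rho s + u * d_u (d_u (d_u V)) t r u rho s
        + d_u (d_u J) t r u rho s / (1 - k t r u rho s))).
  { intros t r u rho s Hd.
    coords_neq0 Hd.
    pose proof (nb $ Hd) as hb; cbv beta in hb.
    assert (F1u' : forall t r u rho s, in_dom D t r u rho s ->
      d_r (d_u V) t r u rho s = N / r * (d_u J t r u rho s / (1 - k t r u rho s) + u * d_u (d_u V) t r u rho s)).
    { intros; erewrite comm_ru by eassumption; apply F1u; assumption. }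
    diff DU F1u' Hd as E; rewrite (ku $ Hd) in E.
    rewrite (comm_ru D (d_u V)) by (assumption || smooth_tac).
    rewrite E; field; auto. }
  (* [V_t] still contains [H_r], for which no formula is available. Only [H_{rU}] is known, so the
     closed equation is the one for [V_{Ut}]. *)
  assert (G1 : forall t r u rho s, in_dom D t r u rho s ->
    d_t V t r u rho s = - u * k t r u rho s * N / (r * (1 - k t r u rho s)) * J t r u rho s - d_r H t r u rho s).
  { intros t r u rho s Hd.
    coords_neq0 Hd.
    pose proof (nb $ Hd) as hb; cbv beta in hb.
    pose proof (E1 $ Hd) as E1'.
    rewrite (F1 $ Hd) in E1'.
    assert (Hu : d_u H t r u rho s = J t r u rho s + u * d_u V t r u rho s) by (rewrite (HJ $ Hd); ring).
    rewrite Hu in E1'.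
    lincomb E1'; field; auto. }
  assert (G2 : forall t r u rho s, in_dom D t r u rho s ->
    d_t (d_u V) t r u rho s = - (N / (r * (1 - k t r u rho s)))
      * ((rho * d_rho k t r u rho s / (1 - k t r u rho s) + 2 * k t r u rho s) * J t r u rho s
         + (P t r u rho s - k t r u rho s * u * u) * d_u (d_u V) t r u rho s)).
  { intros t r u rho s Hd.
    coords_neq0 Hd.
    pose proof (nb $ Hd) as hb; cbv beta in hb.
    rewrite (comm_tu D V) by assumption.
    diff DU G1 Hd as E; rewrite (ku $ Hd), (Hru $ Hd) in E.
    rewrite E; field; auto. }
  assert (kurho : forall t r u rho s, in_dom D t r u rho s -> d_rho (d_u k) t r u rho s = 0).
  { intros t r u rho s Hd; diff DRho ku Hd as E; exact E. }
  assert (krrho : forall t r u rho s, in_dom D t r u rho s -> d_rho (d_r k) t r u rho s = 0).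
  { intros t r u rho s Hd; diff DRho kr Hd as E; exact E. }
  assert (wt : forall t r u rho s, in_dom D t r u rho s ->
    d_t (d_u (d_u V)) t r u rho s = - (N / (r * (1 - k t r u rho s)))
      * ((rho * d_rho k t r u rho s / (1 - k t r u rho s) + 2 * k t r u rho s) * d_u J t r u rho s
         + (P t r u rho s - k t r u rho s * u * u) * d_u (d_u (d_u V)) t r u rho s
         - 2 * k t r u rho s * u * d_u (d_u V) t r u rho s)).
  { intros t r u rho s Hd.
    coords_neq0 Hd.
    pose proof (nb $ Hd) as hb; cbv beta in hb.
    rewrite (comm_tu D (d_u V)) by (assumption || smooth_tac).
    diff DU G2 Hd as E; canon Hd E.
    rewrite (ku $ Hd), (kurho $ Hd), (Pu $ Hd) in E.
    rewrite E; field; auto. }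
  assert (Hu : forall t r u rho s, in_dom D t r u rho s ->
    d_u H t r u rho s = J t r u rho s + u * d_u V t r u rho s).
  { intros t r u rho s Hd; rewrite (HJ $ Hd); ring. }
  assert (Ht : forall t r u rho s, in_dom D t r u rho s ->
    d_t H t r u rho s = - u * d_r H t r u rho s
      - P t r u rho s * (N / r) * J t r u rho s / (1 - k t r u rho s)).
  { intros t r u rho s Hd.
    coords_neq0 Hd.
    pose proof (nb $ Hd) as hb; cbv beta in hb.
    pose proof (E2 $ Hd) as E; rewrite (F1 $ Hd) in E.
    lincomb E; field; auto. }
  (* [H_r] reappears, so [J_t] has no place in the reduced system. Its [U]-derivative is closed, and
     that is all the last compatibility condition uses. *)
  assert (Jt : forall t r u rho s, in_dom D t r u rho s ->
    d_t J t r u rho s = - d_r H t r u rho s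
      + N / (r * (1 - k t r u rho s)) * (k t r u rho s * u * J t r u rho s
        + (k t r u rho s * u * u - P t r u rho s) * d_u J t r u rho s)).
  { intros t r u rho s Hd.
    coords_neq0 Hd.
    pose proof (nb $ Hd) as hb; cbv beta in hb.
    cdiff DT HJ Hd as E; diff DU Ht Hd as E'.
    rewrite <- (comm_tu D V), (G2 $ Hd) in E by assumption.
    rewrite (ku $ Hd), (Pu $ Hd), (Hru $ Hd) in E'.
    rewrite E, E'; field; auto. }
  assert (Vur : forall t r u rho s, in_dom D t r u rho s ->
      d_r (d_u V) t r u rho s = N / r * (d_u J t r u rho s / (1 - k t r u rho s) + u * d_u (d_u V) t r u rho s)).
  { intros; erewrite comm_ru by eassumption; apply F1u; assumption. }
  split; try assumption; try smooth_tac.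
  intros t r u rho s Hd.
  coords_neq0 Hd.
  pose proof (nb $ Hd) as hb; cbv beta in hb.
  (* The two expressions for [V_{Utr}]: [G2] differentiated in [r] and [Vur] differentiated in
     [t]. *)
  diff DR G2 Hd as E; diff DT Vur Hd as E'; diff DU Jt Hd as Jut.
  rewrite (comm_tr D (d_u V)) in E' by (assumption || smooth_tac).
  rewrite (comm_tu D J), Jut in E' by assumption.
  rewrite (wt $ Hd), (kt $ Hd), (Hru $ Hd), (ku $ Hd), (Pu $ Hd) in E'.
  rewrite (comm_rrho D k) in E by assumption.
  rewrite (kr $ Hd), (krrho $ Hd), (Pr $ Hd), (wr $ Hd), (Jr $ Hd) in E.
  rewrite E in E'.
  lincomb ((- (r * r) * (1 - k t r u rho s) * (1 - k t r u rho s) / (N * N)) * E')%eqn.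
  field; auto.
Qed.

(** * Functions of the state alone, and the exclusion of multipliers nonlinear in [U] *)

Record state_only (D : box) (f : kfun) : Prop := {
  so_smooth : smooth D f;
  so_t : forall t r u rho s, in_dom D t r u rho s -> d_t f t r u rho s = 0;
  so_r : forall t r u rho s, in_dom D t r u rho s -> d_r f t r u rho s = 0;
  so_u : forall t r u rho s, in_dom D t r u rho s -> d_u f t r u rho s = 0
}.
Arguments so_smooth {D f} _.
Arguments so_t {D f} _.
Arguments so_r {D f} _.
Arguments so_u {D f} _.
#[export] Hint Resolve so_smooth : smooth.

Lemma state_only_const D c : state_only D (fun _ _ _ _ _ => c).
Proof.
  split; [apply smooth_const | ..]; intros; unfold d_t, d_r, d_u; apply Derive_const.
Qed.

Lemma state_only_rho D : state_only D (fun _ _ _ rho _ => rho).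
Proof.
  split; [apply smooth_rho | ..]; intros; unfold d_t, d_r, d_u; apply Derive_const.
Qed.

Ltac state_only_tac :=
  split; [smooth_tac | ..]; intros t r u rho s Hd;
  (eapply eq_trans; [apply is_derive_unique; der Hd |]);
  repeat match goal with
  | H : state_only _ ?f |- context [d_t ?f t r u rho s] => rewrite (so_t H $ Hd)
  | H : state_only _ ?f |- context [d_r ?f t r u rho s] => rewrite (so_r H $ Hd)
  | H : state_only _ ?f |- context [d_u ?f t r u rho s] => rewrite (so_u H $ Hd)
  end.

Lemma state_only_plus D f g : state_only D f -> state_only D g ->
  state_only D (fun t r u rho s => f t r u rho s + g t r u rho s).
Proof. intros Hf Hg; state_only_tac; ring. Qed.

Lemma state_only_minus D f g : state_only D f -> state_only D g ->
  state_only D (fun t r u rho s => f t r u rho s - g t r u rho s).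
Proof. intros Hf Hg; state_only_tac; ring. Qed.

Lemma state_only_opp D f : state_only D f ->
  state_only D (fun t r u rho s => - f t r u rho s).
Proof. intros Hf; state_only_tac; ring. Qed.

Lemma state_only_mult D f g : state_only D f -> state_only D g ->
  state_only D (fun t r u rho s => f t r u rho s * g t r u rho s).
Proof. intros Hf Hg; state_only_tac; ring. Qed.

Lemma state_only_div D f g : state_only D f -> state_only D g -> nonzero_on D g ->
  state_only D (fun t r u rho s => f t r u rho s / g t r u rho s).
Proof. intros Hf Hg Hn; state_only_tac; field; apply (Hn $ Hd). Qed.

Lemma state_only_d_rho D f : state_only D f -> state_only D (d_rho f).
Proof.
  intros Hf; split; [smooth_tac | ..]; intros t r u rho s Hd.
  - diff DRho (so_t Hf) Hd as E.
    rewrite (comm_trho D f) by (assumption || smooth_tac); exact E.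
  - diff DRho (so_r Hf) Hd as E.
    rewrite (comm_rrho D f) by (assumption || smooth_tac); exact E.
  - diff DRho (so_u Hf) Hd as E.
    rewrite (comm_urho D f) by (assumption || smooth_tac); exact E.
Qed.

Lemma state_only_sub_box D D' f : sub_box D' D -> state_only D f -> state_only D' f.
Proof.
  intros Hs [h1 h2 h3 h4]; split; [apply (smooth_sub_box D); assumption | ..];
    intros; auto.
Qed.

Ltac so_tac :=
  lazymatch goal with
  | |- state_only _ (fun t r u rho s => @?a t r u rho s + @?b t r u rho s) => apply (state_only_plus _ a b); so_tac
  | |- state_only _ (fun t r u rho s => @?a t r u rho s - @?b t r u rho s) => apply (state_only_minus _ a b); so_tac
  | |- state_only _ (fun t r u rho s => @?a t r u rho s * @?b t r u rho s) => apply (state_only_mult _ a b); so_tac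
  | |- state_only _ (fun t r u rho s => - @?a t r u rho s) => apply (state_only_opp _ a); so_tac
  | |- state_only _ (fun t r u rho s => @?a t r u rho s / @?b t r u rho s) =>
      apply (state_only_div _ a b); [so_tac | so_tac | try (assumption || nonzero_tac)]
  | |- state_only _ (fun _ _ _ _ _ => ?c) => apply state_only_const
  | |- state_only _ (fun _ _ _ rho _ => rho) => apply state_only_rho
  | |- _ => first [assumption | apply state_only_d_rho; assumption | idtac]
  end.

(** The interval of [U] may avoid [0], so the coefficients are found by six derivatives in [U] and
    back substitution instead of by evaluation. *)
Lemma even_polynomial_zero D c0 c2 c4 c6 :
  state_only D c0 -> state_only D c2 -> state_only D c4 -> state_only D c6 ->
  (forall t r u rho s, in_dom D t r u rho s ->
    c0 t r u rho s + c2 t r u rho s * (u * u) + c4 t r u rho s * (u * u * u * u)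
    + c6 t r u rho s * (u * u * u * u * u * u) = 0) ->
  forall t r u rho s, in_dom D t r u rho s ->
    c0 t r u rho s = 0 /\ c2 t r u rho s = 0 /\ c4 t r u rho s = 0 /\ c6 t r u rho s = 0.
Proof.
  intros S0 S2 S4 S6 H.
  assert (H1 : forall t r u rho s, in_dom D t r u rho s ->
    2 * c2 t r u rho s * u + 4 * c4 t r u rho s * (u * u * u)
    + 6 * c6 t r u rho s * (u * u * u * u * u) = 0).
  { intros t r u rho s Hd; diff DU H Hd as E.
    rewrite (so_u S0), (so_u S2), (so_u S4), (so_u S6) in E by exact Hd.
    lincomb E; ring. }
  assert (H2 : forall t r u rho s, in_dom D t r u rho s ->
    2 * c2 t r u rho s + 12 * c4 t r u rho s * (u * u)
    + 30 * c6 t r u rho s * (u * u * u * u) = 0).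
  { intros t r u rho s Hd; diff DU H1 Hd as E.
    rewrite (so_u S2), (so_u S4), (so_u S6) in E by exact Hd.
    lincomb E; ring. }
  assert (H3 : forall t r u rho s, in_dom D t r u rho s ->
    24 * c4 t r u rho s * u + 120 * c6 t r u rho s * (u * u * u) = 0).
  { intros t r u rho s Hd; diff DU H2 Hd as E.
    rewrite (so_u S2), (so_u S4), (so_u S6) in E by exact Hd.
    lincomb E; ring. }
  assert (H4 : forall t r u rho s, in_dom D t r u rho s ->
    24 * c4 t r u rho s + 360 * c6 t r u rho s * (u * u) = 0).
  { intros t r u rho s Hd; diff DU H3 Hd as E.
    rewrite (so_u S4), (so_u S6) in E by exact Hd.
    lincomb E; ring. }
  assert (H5 : forall t r u rho s, in_dom D t r u rho s -> 720 * c6 t r u rho s * u = 0).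
  { intros t r u rho s Hd; diff DU H4 Hd as E.
    rewrite (so_u S4), (so_u S6) in E by exact Hd.
    lincomb E; ring. }
  intros t r u rho s Hd; diff DU H5 Hd as E.
  rewrite (so_u S6) in E by exact Hd.
  assert (E6 : c6 t r u rho s = 0) by lra.
  pose proof (H4 $ Hd) as E4; rewrite E6 in E4.
  assert (E4' : c4 t r u rho s = 0) by lra.
  pose proof (H2 $ Hd) as E2; rewrite E6, E4' in E2.
  assert (E2' : c2 t r u rho s = 0) by lra.
  pose proof (H $ Hd) as E0; rewrite E6, E4', E2' in E0.
  repeat split; lra.
Qed.

(** Coefficients of powers of [U^2] in the two conditions that remain for a solution with
    [J = - (al + sg U^2) w]. The [G] equations say that an even polynomial divided by the odd
    polynomial [U (al + sg U^2)] is constant in [U]; parity makes the numerator vanish, and then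
    each case fails by the [Q] equations and the formulas for [l0] and [l1]. *)
Lemma proportional_algebra (P lam k c al sg l0 l1 d0 d1 : R) :
  P <> 0 -> lam <> 0 -> 1 - k <> 0 ->
  d0 = P - (lam + 2 * k) * al -> d1 = - k - (lam + 2 * k) * sg ->
  2 * lam * l0 = - (c * d0 + lam * al) ->
  2 * lam * l1 = - (c * d1 + lam * (5 * sg - (1 - k))) ->
  al * (d0 * l0) = 0 ->
  3 * sg * (d0 * l0) - al * (d0 * l1 + d1 * l0 + 2 * d1 * al) = 0 ->
  sg * (d0 * l1 + d1 * l0 + 2 * d1 * al) - 3 * al * (d1 * l1 + 2 * d1 * sg) = 0 ->
  sg * (d1 * l1 + 2 * d1 * sg) = 0 ->
  l0 * l0 - al * l0 = 0 ->
  2 * l1 * sg + l1 * l1 - 3 * sg * l1 + (4 * sg - 2) * l1 + 2 * sg * sg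
    + (2 * (1 - k) - 4) * sg + (lam + k - (1 - k)) * sg + 1 = 0 ->
  2 * l1 * al + 2 * l0 * l1 - al * l1 - 3 * sg * l0 + (4 * sg - 2) * l0 + 2 * sg * al
    + (lam + k - (1 - k)) * al - P = 0 ->
  False.
Proof.
  intros hP hl hb Ed0 Ed1 L0 L1 G0 G2 G4 G6 Q0 Q4 Q2.
  assert (hq : al <> 0 \/ sg <> 0).
  { destruct (Req_dec al 0) as [ha|ha]; [right; intros hs | tauto].
    rewrite ha in Q0; rewrite ha, hs in Q2.
    assert (l0 = 0) by nra.
    subst l0; lra. }
  (* These are the coefficients of the even numerator [(d0 + d1 U^2) (l0 + l1 U^2) + 2 d1 U^2 (al +
     sg U^2)]. They are eliminated from the lowest power upwards if [al <> 0], from the highest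
     downwards if only [sg <> 0]. *)
  assert (g : d0 * l0 = 0 /\ d0 * l1 + d1 * l0 + 2 * d1 * al = 0 /\ d1 * l1 + 2 * d1 * sg = 0).
  { destruct (Req_dec al 0) as [ha|ha].
    - destruct hq as [hq|hq]; [tauto |].
      assert (g4 : d1 * l1 + 2 * d1 * sg = 0) by (apply Rmult_integral in G6; tauto).
      rewrite g4 in G4.
      assert (g2 : d0 * l1 + d1 * l0 + 2 * d1 * al = 0).
      { apply Rmult_eq_reg_l with sg; [lra | exact hq]. }
      rewrite g2 in G2.
      assert (g0 : d0 * l0 = 0).
      { apply Rmult_eq_reg_l with sg; [lra | exact hq]. }
      tauto.
    - assert (g0 : d0 * l0 = 0) by (apply Rmult_integral in G0; tauto).
      rewrite g0 in G2.
      assert (g2 : d0 * l1 + d1 * l0 + 2 * d1 * al = 0).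
      { apply Rmult_eq_reg_l with al; [lra | exact ha]. }
      rewrite g2 in G4.
      assert (g4 : d1 * l1 + 2 * d1 * sg = 0).
      { apply Rmult_eq_reg_l with al; [lra | exact ha]. }
      tauto. }
  destruct g as (g0 & g2 & g4).
  destruct (Req_dec d0 0) as [hd0|hd0].
  - rewrite hd0 in *.
    assert (E : l0 = - al / 2).
    { apply Rmult_eq_reg_l with (2 * lam); [rewrite L0; field | lra]. }
    rewrite E in Q0.
    assert (al = 0) by nra.
    subst al; apply hP; lra.
  - assert (hl0 : l0 = 0) by (apply Rmult_integral in g0; tauto).
    rewrite hl0 in *.
    destruct (Req_dec d1 0) as [hd1|hd1].
    + rewrite hd1 in *.
      assert (hl1 : l1 = 0).
      { apply Rmult_eq_reg_l with d0; [lra | exact hd0]. }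
      rewrite hl1 in *.
      assert (hk : k = 1 - 5 * sg).
      { apply Rmult_eq_reg_l with lam; [lra | exact hl]. }
      assert (hls : lam * sg = - k - 2 * k * sg) by lra.
      (* With [k = 1 - 5 sg] and the value of [lam sg] inserted into [Q4], the constant and linear
         terms cancel. *)
      assert (E : 12 * (sg * sg) = 0).
      { rewrite hk in hls, Q4; nra. }
      assert (sg = 0) by nra.
      subst sg; apply hb; lra.
    + assert (hl1 : l1 = - 2 * sg).
      { apply Rmult_eq_reg_l with d1; [lra | exact hd1]. }
      rewrite hl1 in *.
      assert (X : d1 * al = sg * d0) by lra.
      (* In [al] times [L1] minus [sg] times [L0] the terms with [c] cancel, because
         [d1 al = sg d0]. *)
      assert (Y : lam * ((1 - k) * al) = 0).
      { assert (c * (d1 * al) = c * (sg * d0)) by (rewrite X; reflexivity). nra. }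
      assert (ha : al = 0).
      { apply Rmult_integral in Y; destruct Y as [Y|Y]; [tauto |].
        apply Rmult_integral in Y; tauto. }
      rewrite ha in *.
      assert (sg = 0).
      { apply Rmult_eq_reg_r with d0; [lra | exact hd0]. }
      destruct hq; tauto.
Qed.

(* With q = al + sg U^2 and J = - q w, [rs_compat_tr] becomes U q w_U = l w with
   l = l0 + l1 U^2.  Then w_t / w is a multiple of g / (U q) for a polynomial g, and
   it cannot depend on U because w_U / w does not depend on t: this is [G] below.
   [Q] expresses that the two equations for J_r and w_r agree. *)
Lemma no_proportional_solution D N P k J w al sg :
  N <> 0 ->
  reduced_system D N P k J w -> state_only D P -> state_only D k ->
  state_only D al -> state_only D sg ->
  nonzero_on D P -> nonzero_on D w -> nonzero_on D (d_rho k) ->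
  (forall t r u rho s, in_dom D t r u rho s ->
    J t r u rho s = - ((al t r u rho s + sg t r u rho s * (u * u)) * w t r u rho s)) ->
  forall t r u rho s, in_dom D t r u rho s -> False.
Proof.
  intros hN RS SP Sk Sal Ssg nP nw nk HJ.
  destruct RS as [sP _ sJ sw nb _ _ _ _ _ _ _ _ Jr wr wt C2].
  pose (lam := fun t r u rho s : R => rho * d_rho k t r u rho s / (1 - k t r u rho s)).
  assert (Slam : state_only D lam) by (unfold lam; so_tac).
  assert (nlam : nonzero_on D lam).
  { intros t r u rho s Hd; unfold lam.
    pose proof (nb $ Hd) as hb; cbv beta in hb.
    coords_neq0 Hd.
    apply Rmult_integral_contrapositive_currified; [| apply Rinv_neq_0_compat; exact hb].
    apply Rmult_integral_contrapositive_currified; [assumption | apply (nk $ Hd)]. }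
  pose (c := fun t r u rho s : R => lam t r u rho s + k t r u rho s - (1 - k t r u rho s) / N).
  assert (Sc : state_only D c).
  { unfold c; so_tac; intros ? ? ? ? ? _; exact hN. }
  (* [d0 + d1 U^2] is the factor of [w] in [(lam + 2 k) J + (P - k U^2) w], the expression to which
     [V_{Ut}] is proportional. *)
  pose (d0 := fun t r u rho s : R => P t r u rho s - (lam t r u rho s + 2 * k t r u rho s) * al t r u rho s).
  pose (d1 := fun t r u rho s : R => - k t r u rho s - (lam t r u rho s + 2 * k t r u rho s) * sg t r u rho s).
  assert (Sd0 : state_only D d0) by (unfold d0; so_tac).
  assert (Sd1 : state_only D d1) by (unfold d1; so_tac).
  assert (n2lam : nonzero_on D (fun t r u rho s => 2 * lam t r u rho s)).
  { intros t r u rho s Hd; pose proof (nlam $ Hd); lra. }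
  (* With [J = - q w] inserted, [rs_compat_tr] is linear in [w_U] with leading factor [2 lam], which
     is nonzero because [k_rho] is. Dividing by it yields [l0] and [l1]. *)
  pose (l0 := fun t r u rho s : R =>
    - (c t r u rho s * d0 t r u rho s + lam t r u rho s * al t r u rho s) / (2 * lam t r u rho s)).
  pose (l1 := fun t r u rho s : R =>
    - (c t r u rho s * d1 t r u rho s + lam t r u rho s * (5 * sg t r u rho s - (1 - k t r u rho s))) / (2 * lam t r u rho s)).
  assert (Sl0 : state_only D l0) by (unfold l0; so_tac).
  assert (Sl1 : state_only D l1) by (unfold l1; so_tac).
  assert (Hl0 : forall t r u rho s, in_dom D t r u rho s -> 2 * lam t r u rho s * l0 t r u rho s =
    - (c t r u rho s * d0 t r u rho s + lam t r u rho s * al t r u rho s)).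
  { intros t r u rho s Hd; unfold l0; field; apply (nlam $ Hd). }
  assert (Hl1 : forall t r u rho s, in_dom D t r u rho s -> 2 * lam t r u rho s * l1 t r u rho s =
    - (c t r u rho s * d1 t r u rho s + lam t r u rho s * (5 * sg t r u rho s - (1 - k t r u rho s)))).
  { intros t r u rho s Hd; unfold l1; field; apply (nlam $ Hd). }
  assert (C2' : forall t r u rho s, in_dom D t r u rho s ->
    c t r u rho s
    * ((lam t r u rho s + 2 * k t r u rho s) * J t r u rho s
       + (P t r u rho s - k t r u rho s * u * u) * w t r u rho s)
    = lam t r u rho s
      * (J t r u rho s + 2 * u * d_u J t r u rho s
         + (1 - k t r u rho s) * u * u * w t r u rho s)) by exact C2.
  assert (Jr' : forall t r u rho s, in_dom D t r u rho s ->
    d_r J t r u rho s = N / (r * (1 - k t r u rho s))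
      * ((lam t r u rho s + k t r u rho s) * J t r u rho s
         + (P t r u rho s - u * u) * w t r u rho s
         - (1 + k t r u rho s) * u * d_u J t r u rho s)) by exact Jr.
  assert (wt' : forall t r u rho s, in_dom D t r u rho s ->
    d_t w t r u rho s = - (N / (r * (1 - k t r u rho s)))
      * ((lam t r u rho s + 2 * k t r u rho s) * d_u J t r u rho s
         + (P t r u rho s - k t r u rho s * u * u) * d_u w t r u rho s
         - 2 * k t r u rho s * u * w t r u rho s)) by exact wt.
  assert (Hd0 : forall t r u rho s, d0 t r u rho s
    = P t r u rho s - (lam t r u rho s + 2 * k t r u rho s) * al t r u rho s) by reflexivity.
  assert (Hd1 : forall t r u rho s, d1 t r u rho s
    = - k t r u rho s - (lam t r u rho s + 2 * k t r u rho s) * sg t r u rho s) by reflexivity.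
  clear C2 Jr wt.
  clearbody lam c d0 d1 l0 l1.
  assert (Ju : forall t r u rho s, in_dom D t r u rho s ->
    d_u J t r u rho s = - (2 * sg t r u rho s * u * w t r u rho s
      + (al t r u rho s + sg t r u rho s * (u * u)) * d_u w t r u rho s)).
  { intros t r u rho s Hd; diff DU HJ Hd as E.
    rewrite (so_u Sal), (so_u Ssg) in E by exact Hd; rewrite E; ring. }
  assert (Juu : forall t r u rho s, in_dom D t r u rho s ->
    d_u (d_u J) t r u rho s = - (2 * sg t r u rho s * w t r u rho s + 4 * sg t r u rho s * u * d_u w t r u rho s
      + (al t r u rho s + sg t r u rho s * (u * u)) * d_u (d_u w) t r u rho s)).
  { intros t r u rho s Hd; diff DU Ju Hd as E.
    rewrite (so_u Sal), (so_u Ssg) in E by exact Hd; rewrite E; ring. }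
  assert (Ode : forall t r u rho s, in_dom D t r u rho s ->
    u * (al t r u rho s + sg t r u rho s * (u * u)) * d_u w t r u rho s
    = (l0 t r u rho s + l1 t r u rho s * (u * u)) * w t r u rho s).
  { intros t r u rho s Hd.
    pose proof (nlam $ Hd) as hl.
    pose proof (C2' _ _ _ _ _ Hd) as E.
    rewrite (Ju $ Hd), (HJ $ Hd) in E.
    apply Rmult_eq_reg_l with (2 * lam t r u rho s); [| lra].
    pose proof (Hl0 $ Hd) as e0. pose proof (Hl1 $ Hd) as e1.
    rewrite Hd0 in e0; rewrite Hd1 in e1.
    lincomb (E + (- w t r u rho s) * e0 + (- (u * u) * w t r u rho s) * e1)%eqn.
    ring. }
  assert (Wt : forall t r u rho s, in_dom D t r u rho s ->
    u * (al t r u rho s + sg t r u rho s * (u * u)) * d_t w t r u rho s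
    = - (N / (r * (1 - k t r u rho s)))
      * (d0 t r u rho s * l0 t r u rho s
         + (d0 t r u rho s * l1 t r u rho s + d1 t r u rho s * l0 t r u rho s
            + 2 * d1 t r u rho s * al t r u rho s) * (u * u)
         + (d1 t r u rho s * l1 t r u rho s + 2 * d1 t r u rho s * sg t r u rho s) * (u * u * u * u))
      * w t r u rho s).
  { intros t r u rho s Hd.
    coords_neq0 Hd.
    pose proof (nb $ Hd) as hb; cbv beta in hb.
    rewrite (wt' _ _ _ _ _ Hd), (Ju $ Hd).
    pose proof (Ode $ Hd) as E.
    rewrite !Hd0, !Hd1.
    lincomb (- (N / (r * (1 - k t r u rho s))) *
      (d0 t r u rho s + d1 t r u rho s * (u * u)) * E)%eqn.
    rewrite !Hd0, !Hd1.
    field; auto. }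
  assert (G : forall t r u rho s, in_dom D t r u rho s ->
    al t r u rho s * (d0 t r u rho s * l0 t r u rho s)
    + (3 * sg t r u rho s * (d0 t r u rho s * l0 t r u rho s)
       - al t r u rho s * (d0 t r u rho s * l1 t r u rho s + d1 t r u rho s * l0 t r u rho s
            + 2 * d1 t r u rho s * al t r u rho s)) * (u * u)
    + (sg t r u rho s * (d0 t r u rho s * l1 t r u rho s + d1 t r u rho s * l0 t r u rho s
            + 2 * d1 t r u rho s * al t r u rho s)
       - 3 * al t r u rho s * (d1 t r u rho s * l1 t r u rho s + 2 * d1 t r u rho s * sg t r u rho s)) * (u * u * u * u)
    + (- (sg t r u rho s * (d1 t r u rho s * l1 t r u rho s + 2 * d1 t r u rho s * sg t r u rho s)))
      * (u * u * u * u * u * u) = 0).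
  { intros t r u rho s Hd.
    coords_neq0 Hd.
    pose proof (nb $ Hd) as hb; cbv beta in hb.
    cdiff DT Ode Hd as X1; diff DU Wt Hd as X2.
    rewrite (so_t Sal), (so_t Ssg), (so_t Sl0), (so_t Sl1) in X1 by exact Hd.
    rewrite (so_u Sal), (so_u Ssg), (so_u Sl0), (so_u Sl1), (so_u Sd0),
      (so_u Sd1), (so_u Sk) in X2 by exact Hd.
    pose proof (Wt $ Hd) as X3; pose proof (Ode $ Hd) as X4.
    apply Rmult_eq_reg_r with (w t r u rho s); [| apply (nw $ Hd)].
    set (q := al t r u rho s + sg t r u rho s * (u * u)) in *.
    set (g := d0 t r u rho s * l0 t r u rho s
         + (d0 t r u rho s * l1 t r u rho s + d1 t r u rho s * l0 t r u rho s
            + 2 * d1 t r u rho s * al t r u rho s) * (u * u)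
         + (d1 t r u rho s * l1 t r u rho s + 2 * d1 t r u rho s * sg t r u rho s) * (u * u * u * u)) in *.
    lincomb ((- (r * (1 - k t r u rho s) / N)) *
      ((u * q) * X2 + (- (u * q)) * X1
       + (- (al t r u rho s + 3 * sg t r u rho s * (u * u) + l0 t r u rho s + l1 t r u rho s * (u * u))) * X3
       + (- (N / (r * (1 - k t r u rho s))) * g) * X4))%eqn.
    unfold g, q; field; auto. }
  assert (Q : forall t r u rho s, in_dom D t r u rho s ->
    (l0 t r u rho s * l0 t r u rho s - al t r u rho s * l0 t r u rho s)
    + (2 * l1 t r u rho s * al t r u rho s + 2 * l0 t r u rho s * l1 t r u rho s
       - al t r u rho s * l1 t r u rho s - 3 * sg t r u rho s * l0 t r u rho s
       + (4 * sg t r u rho s - 2) * l0 t r u rho s + 2 * sg t r u rho s * al t r u rho s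
       + (lam t r u rho s + k t r u rho s - (1 - k t r u rho s)) * al t r u rho s - P t r u rho s) * (u * u)
    + (2 * l1 t r u rho s * sg t r u rho s + l1 t r u rho s * l1 t r u rho s
       - 3 * sg t r u rho s * l1 t r u rho s
       + (4 * sg t r u rho s - 2) * l1 t r u rho s + 2 * sg t r u rho s * sg t r u rho s
       + (2 * (1 - k t r u rho s) - 4) * sg t r u rho s
       + (lam t r u rho s + k t r u rho s - (1 - k t r u rho s)) * sg t r u rho s + 1) * (u * u * u * u)
    + 0 * (u * u * u * u * u * u) = 0).
  { intros t r u rho s Hd.
    coords_neq0 Hd.
    pose proof (nb $ Hd) as hb; cbv beta in hb.
    diff DR HJ Hd as E; diff DU Ode Hd as X5.
    rewrite (so_r Sal), (so_r Ssg), (Jr' _ _ _ _ _ Hd), (wr $ Hd),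
      (Ju $ Hd), (Juu $ Hd), (HJ $ Hd) in E by exact Hd.
    rewrite (so_u Sal), (so_u Ssg), (so_u Sl0), (so_u Sl1) in X5 by exact Hd.
    pose proof (Ode $ Hd) as X4.
    apply Rmult_eq_reg_r with (w t r u rho s); [| apply (nw $ Hd)].
    set (q := al t r u rho s + sg t r u rho s * (u * u)) in *.
    lincomb ((- (u * u * r * (1 - k t r u rho s) / N)) * E + (- (u * q)) * X5
       + (- ((u * u) * (4 * sg t r u rho s - 2) - (al t r u rho s + 3 * sg t r u rho s * (u * u))
             + l0 t r u rho s + l1 t r u rho s * (u * u))) * X4)%eqn.
    unfold q; field; auto. }
  intros t r u rho s Hd.
  assert (G' := fun h0 h1 h2 h3 => even_polynomial_zero D _ _ _ _ h0 h1 h2 h3 G $ Hd).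
  assert (Q' := fun h0 h1 h2 h3 => even_polynomial_zero D _ _ _ _ h0 h1 h2 h3 Q $ Hd).
  destruct G' as (G0 & G2 & G4 & G6); [so_tac.. |].
  destruct Q' as (Q0 & Q2 & Q4 & _); [so_tac.. |].
  cbv beta in *.
  apply (proportional_algebra (P t r u rho s) (lam t r u rho s) (k t r u rho s) (c t r u rho s)
    (al t r u rho s) (sg t r u rho s) (l0 t r u rho s) (l1 t r u rho s) (d0 t r u rho s) (d1 t r u rho s));
    auto; lra.
Qed.

(** Equality of [J_{rho r}] and [J_{r rho}]. The terms with [J_UU] and [w_U] cancel, which leaves a
    relation linear in [J], [U J_U] and [w]; [k1] stands for [rho k_rho]. *)
Lemma reduced_compat_rrho D N P k J w (k1 : kfun) : N <> 0 ->
  reduced_system D N P k J w -> smooth D k1 ->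
  (forall t r u rho s, in_dom D t r u rho s -> d_u k1 t r u rho s = 0) ->
  (forall t r u rho s, in_dom D t r u rho s ->
    d_rho k t r u rho s = k1 t r u rho s / rho) ->
  forall t r u rho s, in_dom D t r u rho s ->
  4 * k t r u rho s * (1 - k t r u rho s) * (1 - k t r u rho s) * P t r u rho s * w t r u rho s
  + ((rho * d_rho k1 t r u rho s + k1 t r u rho s) * (1 - k t r u rho s)
     + 2 * k1 t r u rho s * k1 t r u rho s) * J t r u rho s
  + 2 * k1 t r u rho s * (1 - k t r u rho s)
    * ((P t r u rho s - u * u) * w t r u rho s - u * d_u J t r u rho s) = 0.
Proof.
  intros hN [sP sk sJ sw nb Pr Pu kt kr ku Prho Jrho wrho Jr wr wt _] sk1 k1u Hk.
  assert (Jr' : forall t r u rho s, in_dom D t r u rho s ->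
    d_r J t r u rho s = N / (r * (1 - k t r u rho s))
      * ((k1 t r u rho s / (1 - k t r u rho s) + k t r u rho s) * J t r u rho s
         + (P t r u rho s - u * u) * w t r u rho s
         - (1 + k t r u rho s) * u * d_u J t r u rho s)).
  { intros t r u rho s Hd.
    coords_neq0 Hd.
    pose proof (nb $ Hd) as hb; cbv beta in hb.
    rewrite (Jr $ Hd), (Hk $ Hd); field; auto. }
  intros t r u rho s Hd.
  coords_neq0 Hd.
  pose proof (nb $ Hd) as hb; cbv beta in hb.
  diff DRho Jr' Hd as E.
  diff DR Jrho Hd as E'.
  diff DU Jrho Hd as Jur.
  diff DU Jr' Hd as Jurr.
  rewrite (comm_rrho D J), (comm_ru D J), Jurr, E, (wr $ Hd),
    (Pr $ Hd), (ku $ Hd), (Pu $ Hd), (k1u $ Hd) in E' by assumption.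
  rewrite <- (comm_urho D J), Jur, (Jrho $ Hd), (wrho $ Hd), (Prho $ Hd),
    (Hk $ Hd), (Pu $ Hd) in E' by assumption.
  lincomb ((r * rho * (1 - k t r u rho s) * (1 - k t r u rho s) * (1 - k t r u rho s) / N) * E')%eqn.
  field; auto.
Qed.

(** At a zero of [f] the claim is trivial; at a zero of [g] the product rule gives it. So a function
    that vanishes wherever [f] does not can be differentiated as if it vanished everywhere. *)
Lemma mult_zero_diff i D (f g : kfun) : smooth D f ->
  (forall t r u rho s, in_dom D t r u rho s -> f t r u rho s * g t r u rho s = 0) ->
  forall t r u rho s l, in_dom D t r u rho s ->
  is_derive (slice i g t r u rho s) (coord i t r u rho s) l -> f t r u rho s * l = 0.
Proof.
  intros Hf H t r u rho s l Hd Hl.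
  assert (E : partial i f t r u rho s * g t r u rho s + f t r u rho s * l = 0).
  { eapply (diff_eq i D _ _ t r u rho s _ _ H Hd).
    - rewrite (slice_fun2 i Rmult); eapply is_derive_eq.
      + apply is_derive_Rmult; [eapply smooth_is_derive; eassumption | exact Hl].
      + rewrite !slice_coord; reflexivity.
    - destruct i; exact (is_derive_Rconst 0 _). }
  pose proof (H $ Hd) as H0.
  apply Rmult_integral in H0; destruct H0 as [H0|H0].
  - rewrite H0; ring.
  - rewrite H0 in E; lra.
Qed.

Lemma reduced_system_sub_box D D' N P k J w : sub_box D' D ->
  reduced_system D N P k J w -> reduced_system D' N P k J w.
Proof.
  intros Hs []; split; try (apply (smooth_sub_box D); assumption);
    intros t r u rho s Hd; auto.
Qed.

Lemma no_reduced_solution D N P k J w :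
  0 < N -> reduced_system D N P k J w -> state_only D P -> state_only D k ->
  nonzero_on D P -> nonzero_on D w ->
  forall t r u rho s, in_dom D t r u rho s -> False.
Proof.
  intros hN0 RS SP Sk nP nw.
  assert (hN : N <> 0) by lra.
  pose (k1 := fun t r u rho s => rho * d_rho k t r u rho s).
  assert (Sk1 : state_only D k1) by (unfold k1; so_tac).
  assert (Hk : forall t r u rho s, in_dom D t r u rho s ->
    d_rho k t r u rho s = k1 t r u rho s / rho).
  { intros t r u rho s Hd; unfold k1; field; apply (in_dom_rho_neq0 Hd). }
  pose proof (reduced_compat_rrho D N P k J w k1 hN RS (so_smooth Sk1) (so_u Sk1) Hk) as C1.
  pose proof (rs_k1 _ _ _ _ _ _ RS) as nb.
  pose proof (rs_J _ _ _ _ _ _ RS) as sJ.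
  assert (C2 : forall t r u rho s, in_dom D t r u rho s ->
    (k1 t r u rho s / (1 - k t r u rho s) + k t r u rho s - (1 - k t r u rho s) / N)
    * ((k1 t r u rho s / (1 - k t r u rho s) + 2 * k t r u rho s) * J t r u rho s
       + (P t r u rho s - k t r u rho s * u * u) * w t r u rho s)
    = k1 t r u rho s / (1 - k t r u rho s)
      * (J t r u rho s + 2 * u * d_u J t r u rho s
         + (1 - k t r u rho s) * u * u * w t r u rho s)) by exact (rs_compat_tr _ _ _ _ _ _ RS).
  assert (dk : forall t r u rho s, k1 t r u rho s = rho * d_rho k t r u rho s) by reflexivity.
  clearbody k1.
  (* [A], [a] and [b] are the coefficients of [C1 / (1 - k)^2 - C2], the combination free of
     [J_U]. *)
  pose (A := fun t r u rho s =>
    (rho * d_rho k1 t r u rho s + k1 t r u rho s) / (1 - k t r u rho s)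
    + 2 * (k1 t r u rho s / (1 - k t r u rho s)) * (k1 t r u rho s / (1 - k t r u rho s))
    - (k1 t r u rho s / (1 - k t r u rho s) + k t r u rho s - (1 - k t r u rho s) / N)
      * (k1 t r u rho s / (1 - k t r u rho s) + 2 * k t r u rho s)
    + k1 t r u rho s / (1 - k t r u rho s)).
  pose (a := fun t r u rho s =>
    3 * k t r u rho s + k1 t r u rho s / (1 - k t r u rho s) + (1 - k t r u rho s) / N).
  pose (b := fun t r u rho s =>
    - (k1 t r u rho s / (1 - k t r u rho s)) + k t r u rho s * k t r u rho s
    - k t r u rho s * (1 - k t r u rho s) / N).
  assert (SA : state_only D A) by (unfold A; so_tac; intros ? ? ? ? ? _; exact hN).
  assert (Sa : state_only D a) by (unfold a; so_tac; intros ? ? ? ? ? _; exact hN).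
  assert (Sb : state_only D b) by (unfold b; so_tac; intros ? ? ? ? ? _; exact hN).
  assert (Lin : forall t r u rho s, in_dom D t r u rho s ->
    A t r u rho s * J t r u rho s
    + (a t r u rho s * P t r u rho s + b t r u rho s * (u * u)) * w t r u rho s = 0).
  { intros t r u rho s Hd.
    pose proof (nb $ Hd) as hb; cbv beta in hb.
    unfold A, a, b.
    lincomb ((/ ((1 - k t r u rho s) * (1 - k t r u rho s))) * C1 $ Hd
       + (-1) * C2 $ Hd)%eqn.
    field; auto. }
  (* Near a point where [k1 A <> 0], [Lin] makes [J] the multiple [- (a P + b U^2) / A] of [w],
     which [no_proportional_solution] excludes. *)
  assert (K1A : forall t r u rho s, in_dom D t r u rho s -> k1 t r u rho s * A t r u rho s = 0).
  { intros t r u rho s Hd; apply NNPP; intros hn.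
    destruct (sub_box_nonzero D (kmult k1 A) t r u rho s) as (D' & Hs & Hd' & Hn).
    - apply cont_mult; apply smooth_cont; smooth_tac.
    - exact Hd.
    - exact hn.
    - assert (nA : nonzero_on D' A).
      { intros t' r' u' rho' s' Hd1 e; apply (Hn $ Hd1); unfold kmult; rewrite e; ring. }
      apply (no_proportional_solution D' N P k J w
        (fun t r u rho s => a t r u rho s * P t r u rho s / A t r u rho s)
        (fun t r u rho s => b t r u rho s / A t r u rho s)) with t r u rho s;
      try exact Hd'; try (exact hN); try (apply (reduced_system_sub_box D); assumption);
      try (apply (state_only_sub_box D); assumption).
      + pose proof (state_only_sub_box D D' _ Hs SA); pose proof (state_only_sub_box D D' _ Hs Sa).
        pose proof (state_only_sub_box D D' _ Hs SP); so_tac.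
      + pose proof (state_only_sub_box D D' _ Hs SA); pose proof (state_only_sub_box D D' _ Hs Sb); so_tac.
      + intros t' r' u' rho' s' Hd1; apply nP, Hs, Hd1.
      + intros t' r' u' rho' s' Hd1; apply nw, Hs, Hd1.
      + intros t' r' u' rho' s' Hd1 e; apply (Hn $ Hd1); unfold kmult; rewrite dk, e; ring.
      + intros t' r' u' rho' s' Hd1.
        pose proof (nA $ Hd1) as hA.
        lincomb ((/ A t' r' u' rho' s') * Lin _ _ _ _ _ (Hs $ Hd1))%eqn.
        field; exact hA. }
  (* Where [k1 <> 0], [A] vanishes, and with it [a P] and [b], the coefficients of a polynomial in
     [U^2]. The sum [a + b] contains [k] only: the terms with [k1] cancel. *)
  assert (K1ab : forall t r u rho s, in_dom D t r u rho s ->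
    k1 t r u rho s * (3 * k t r u rho s + k t r u rho s * k t r u rho s
       + (1 - k t r u rho s) * (1 - k t r u rho s) / N) = 0).
  { intros t r u rho s Hd.
    assert (X := even_polynomial_zero D (fun t r u rho s => k1 t r u rho s * a t r u rho s * P t r u rho s)
      (fun t r u rho s => k1 t r u rho s * b t r u rho s) (fun _ _ _ _ _ => 0) (fun _ _ _ _ _ => 0)).
    destruct X with t r u rho s as (X0 & X2 & _); try so_tac; try exact Hd.
    - intros t' r' u' rho' s' Hd'.
      apply Rmult_eq_reg_r with (w t' r' u' rho' s'); [| apply (nw $ Hd')].
      lincomb (k1 t' r' u' rho' s' * Lin $ Hd' + (- J t' r' u' rho' s') * K1A $ Hd')%eqn.
      ring.
    - cbv beta in X0, X2; unfold a, b in X0, X2.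
      pose proof (nb $ Hd) as hb; cbv beta in hb.
      pose proof (nP $ Hd) as hP.
      lincomb ((/ P t r u rho s) * X0 + X2)%eqn; field; auto. }
  clear A a b SA Sa Sb Lin K1A.
  assert (sk : smooth D k) by smooth_tac.
  assert (sk1 : smooth D k1) by smooth_tac.
  (* The polynomial in [k] vanishes wherever [k1 = rho k_rho] does not, and so do
     its derivatives. *)
  assert (K2 : forall t r u rho s, in_dom D t r u rho s ->
    k1 t r u rho s * (3 + 2 * k t r u rho s - 2 * (1 - k t r u rho s) / N) = 0).
  { intros t r u rho s Hd.
    evar (l : R).
    assert (X : k1 t r u rho s * l = 0).
    { subst l; apply (mult_zero_diff DRho D k1 _ sk1 K1ab _ _ _ _ _ _ Hd); cbn [slice coord]; der Hd. }
    subst l; cbv beta in X.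
    rewrite (Hk $ Hd) in X.
    coords_neq0 Hd.
    assert (Y : k1 t r u rho s * (k1 t r u rho s * (3 + 2 * k t r u rho s - 2 * (1 - k t r u rho s) / N)) = 0).
    { lincomb (rho * X)%eqn; field; auto. }
    apply Rmult_integral in Y; destruct Y as [Y|Y]; [rewrite Y; ring | exact Y]. }
  assert (K3 : forall t r u rho s, in_dom D t r u rho s -> k1 t r u rho s = 0).
  { intros t r u rho s Hd.
    evar (l : R).
    assert (X : k1 t r u rho s * l = 0).
    { subst l; apply (mult_zero_diff DRho D k1 _ sk1 K2 _ _ _ _ _ _ Hd); cbn [slice coord]; der Hd. }
    subst l; cbv beta in X.
    rewrite (Hk $ Hd) in X.
    coords_neq0 Hd.
    (* [2 + 2 / N] is the second derivative of the polynomial in [k]; it is nonzero because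
       [N > 0]. *)
    assert (Y : (2 + 2 / N) * (k1 t r u rho s * k1 t r u rho s) = 0).
    { lincomb (rho * X)%eqn; field; auto. }
    assert (0 < / N) by (apply Rinv_0_lt_compat; lra).
    apply Rmult_integral in Y; destruct Y as [Y|Y]; [unfold Rdiv in Y; lra | nra]. }
  intros t r u rho s Hd.
  pose proof (nb $ Hd) as hb; cbv beta in hb.
  pose proof (nP $ Hd) as hP.
  pose proof (nw $ Hd) as hw.
  assert (K4 : d_rho k1 t r u rho s = 0) by (diff DRho K3 Hd as E; exact E).
  pose proof (C1 $ Hd) as e1; pose proof (C2 $ Hd) as e2.
  rewrite K4, (K3 $ Hd) in e1; rewrite (K3 $ Hd) in e2.
  (* With [k1 = 0] the first condition is [4 k (1 - k)^2 P w = 0]; with [k = 0] the second then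
     reduces to [P w = 0]. *)
  assert (hk : k t r u rho s = 0).
  { apply Rmult_eq_reg_r with (4 * ((1 - k t r u rho s) * (1 - k t r u rho s)) * P t r u rho s * w t r u rho s).
    - lincomb e1; ring.
    - repeat apply Rmult_integral_contrapositive_currified; auto; lra. }
  rewrite hk in e2.
  assert (Y : P t r u rho s * w t r u rho s = 0).
  { lincomb ((- N) * e2)%eqn; field; auto. }
  apply Rmult_integral in Y; tauto.
Qed.

(** * Generic factors, constancy on a box, and affineness in [U] *)

Definition generic (D : box) (f : R -> R -> R) : Prop :=
  forall rho s eps, dom_rho D rho -> dom_s D s -> 0 < eps ->
    exists rho' s', dom_rho D rho' /\ dom_s D s' /\
      Rabs (rho' - rho) < eps /\ Rabs (s' - s) < eps /\ f rho' s' <> 0.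

(** A nonzero value of [g] persists for nearby [rho] and [S], and among those [f] has a nonzero
    value. *)
Lemma generic_cancel D f g : generic D f -> smooth D g ->
  (forall t r u rho s, in_dom D t r u rho s -> f rho s * g t r u rho s = 0) ->
  forall t r u rho s, in_dom D t r u rho s -> g t r u rho s = 0.
Proof.
  intros Gf Sg H t r u rho s Hd; apply NNPP; intros hn.
  assert (L : locally (t, r, u, rho, s) (fun x => app5 g x <> 0)).
  { apply ((smooth_cont _ _ Sg $ Hd) (fun y => y <> 0)); simpl.
    apply open_neq, hn. }
  destruct L as [d L].
  pose proof Hd as (Ht & Hr & Hu & Hrho & Hs).
  destruct (Gf rho s d Hrho Hs (cond_pos d)) as (rho' & s' & Hrho' & Hs' & d1 & d2 & hf).
  assert (Z : forall x : R, ball x d x) by (intros; apply ball_center).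
  apply (L (t, r, u, rho', s')).
  - repeat split; simpl; try apply Z; assumption.
  - simpl.
    assert (Hd' : in_dom D t r u rho' s') by (unfold in_dom; tauto).
    pose proof (H $ Hd') as E; apply Rmult_integral in E; tauto.
Qed.

Lemma const_of_derive_zero (I : R -> Prop) f : Defs.open_interval I ->
  (forall x, I x -> is_derive f x 0) -> forall x y, I x -> I y -> f x = f y.
Proof.
  intros HI H x y Hx Hy.
  assert (W : forall x y, I x -> I y -> x < y -> f x = f y).
  { intros a b Ha Hb Hab; apply (eq_is_derive f a b); [| exact Hab].
    intros c Hc; apply H, (open_interval_convex I a b c); assumption. }
  destruct (Rtotal_order x y) as [h|[h|h]]; [auto | congruence | symmetry; auto].
Qed.

(** In a product of intervals, two points with the same [S] are joined inside the box by segments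
    parallel to the other four axes. *)
Lemma function_of_entropy D f : smooth D f ->
  (forall i t r u rho s, i <> DS -> in_dom D t r u rho s -> partial i f t r u rho s = 0) ->
  forall t r u rho t' r' u' rho' s, in_dom D t r u rho s -> in_dom D t' r' u' rho' s ->
  f t r u rho s = f t' r' u' rho' s.
Proof.
  intros Sf H t r u rho t' r' u' rho' s (h1 & h2 & h3 & h4 & h5) (h1' & h2' & h3' & h4' & _).
  assert (D1 : forall i t r u rho s, i <> DS -> in_dom D t r u rho s ->
    is_derive (slice i f t r u rho s) (coord i t r u rho s) 0).
  { intros i t1 r1 u1 rho1 s1 hi Hd; rewrite <- (H i _ _ _ _ _ hi Hd).
    eapply smooth_is_derive; eassumption. }
  transitivity (f t' r u rho s).
  { apply (const_of_derive_zero (dom_t D) (fun x => f x r u rho s)); try assumption.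
    - apply dom_t_open.
    - intros x Hx; apply (D1 DT); [discriminate | unfold in_dom; tauto]. }
  transitivity (f t' r' u rho s).
  { apply (const_of_derive_zero (dom_r D) (fun x => f t' x u rho s)); try assumption.
    - apply dom_r_open.
    - intros x Hx; apply (D1 DR t'); [discriminate | unfold in_dom; tauto]. }
  transitivity (f t' r' u' rho s).
  { apply (const_of_derive_zero (dom_u D) (fun x => f t' r' x rho s)); try assumption.
    - apply dom_u_open.
    - intros x Hx; apply (D1 DU t' r'); [discriminate | unfold in_dom; tauto]. }
  apply (const_of_derive_zero (dom_rho D) (fun x => f t' r' u' x s)); try assumption.
  - apply dom_rho_open.
  - intros x Hx; apply (D1 DRho t' r' u'); [discriminate | unfold in_dom; tauto].
Qed.

Lemma const_of_partials_zero D f : smooth D f ->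
  (forall i t r u rho s, in_dom D t r u rho s -> partial i f t r u rho s = 0) ->
  forall t r u rho s t' r' u' rho' s', in_dom D t r u rho s -> in_dom D t' r' u' rho' s' ->
  f t r u rho s = f t' r' u' rho' s'.
Proof.
  intros Sf H t r u rho s t' r' u' rho' s' Hd Hd'.
  assert (Hd2 : in_dom D t' r' u' rho' s) by (unfold in_dom in *; tauto).
  transitivity (f t' r' u' rho' s).
  - apply (function_of_entropy D); auto.
  - apply (const_of_derive_zero (dom_s D) (fun x => f t' r' u' rho' x)).
    + apply dom_s_open.
    + intros x Hx.
      assert (Hx' : in_dom D t' r' u' rho' x) by (unfold in_dom in *; tauto).
      rewrite <- (H DS _ _ _ _ _ Hx'); exact (smooth_is_derive D f DS _ _ _ _ _ Sf Hx').
    + apply Hd.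
    + apply Hd'.
Qed.

Lemma box_inhabited D : exists t r u rho s, in_dom D t r u rho s.
Proof.
  destruct (open_interval_inhabited _ (dom_t_open D)) as [t ?].
  destruct (open_interval_inhabited _ (dom_r_open D)) as [r ?].
  destruct (open_interval_inhabited _ (dom_u_open D)) as [u ?].
  destruct (open_interval_inhabited _ (dom_rho_open D)) as [rho ?].
  destruct (open_interval_inhabited _ (dom_s_open D)) as [s ?].
  exists t, r, u, rho, s; unfold in_dom; tauto.
Qed.

Lemma multiplier_system_sub_box D D' N P V H : sub_box D' D ->
  multiplier_system D N P V H -> multiplier_system D' N P V H.
Proof.
  intros Hs []; split; try (apply (smooth_sub_box D); assumption);
    intros t r u rho s Hd; auto.
Qed.

Lemma multiplier_linear D N P V H : 0 < N -> multiplier_system D N P V H ->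
  (forall g, smooth D g ->
    (forall t r u rho s, in_dom D t r u rho s -> P t r u rho s * g t r u rho s = 0) ->
    forall t r u rho s, in_dom D t r u rho s -> g t r u rho s = 0) ->
  forall t r u rho s, in_dom D t r u rho s -> d_u (d_u V) t r u rho s = 0.
Proof.
  intros hN MS gen.
  (* It is enough that [P V_UU] vanishes. A point where it does not gives a sub-box on which both
     factors are nonzero, as dividing by them requires. *)
  apply gen; [destruct MS; smooth_tac |].
  intros t0 r0 u0 rho0 s0 Hd0; apply NNPP; intros hn.
  assert (sPw : smooth D (kmult P (d_u (d_u V)))).
  { destruct MS; apply smooth_mult; smooth_tac. }
  destruct (sub_box_nonzero D _ _ _ _ _ _ (smooth_cont _ _ sPw) Hd0 hn) as (D1 & Hs1 & Hd1 & Hn1).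
  assert (nP : nonzero_on D1 P).
  { intros t r u rho s Hd e; apply (Hn1 $ Hd); unfold kmult; rewrite e; ring. }
  assert (nw : nonzero_on D1 (d_u (d_u V))).
  { intros t r u rho s Hd e; apply (Hn1 $ Hd); unfold kmult; rewrite e; ring. }
  apply (multiplier_system_sub_box _ _ _ _ _ _ Hs1) in MS.
  clear D gen hn sPw Hn1 Hs1 Hd0.
  pose proof MS as [sP sV sH Pt Pr Pu E1 E2 E3 E4].
  assert (SP : state_only D1 P) by (split; assumption).
  assert (n2P : nonzero_on D1 (fun t r u rho s => 2 * P t r u rho s)).
  { intros t r u rho s Hd; pose proof (nP $ Hd); lra. }
  pose (k := fun t r u rho s => rho * d_rho P t r u rho s / (2 * P t r u rho s)).
  assert (Sk : state_only D1 k) by (unfold k; so_tac).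
  assert (Prho : forall t r u rho s, in_dom D1 t r u rho s ->
    d_rho P t r u rho s = 2 * k t r u rho s * P t r u rho s / rho).
  { intros t r u rho s Hd; unfold k.
    pose proof (nP $ Hd); coords_neq0 Hd; field; auto. }
  clearbody k.
  pose (J := fun t r u rho s => d_u H t r u rho s - u * d_u V t r u rho s).
  assert (sJ : smooth D1 J) by (unfold J; smooth_tac).
  assert (HJ : forall t r u rho s, in_dom D1 t r u rho s ->
    J t r u rho s = d_u H t r u rho s - u * d_u V t r u rho s) by reflexivity.
  clearbody J.
  (* One point with [k <> 1] suffices, since the contradiction is local. *)
  destruct (classic (exists t r u rho s, in_dom D1 t r u rho s /\ 1 - k t r u rho s <> 0))
    as [(t & r & u & rho & s & Hd & hb) | hb].
  - assert (cb : cont D1 (fun t r u rho s => 1 - k t r u rho s)).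
    { apply smooth_cont; smooth_tac. }
    destruct (sub_box_nonzero D1 _ _ _ _ _ _ cb Hd hb) as (D2 & Hs2 & Hd2 & Hn2).
    assert (RS : reduced_system D2 N P k J (d_u (d_u V))).
    { apply (multiplier_reduction D2 N P k V H J).
      - lra.
      - apply (multiplier_system_sub_box D1); assumption.
      - intros ? ? ? ? ? h; apply nP, Hs2, h.
      - apply (smooth_sub_box D1); smooth_tac.
      - apply (smooth_sub_box D1); assumption.
      - exact Hn2.
      - intros; apply (so_t Sk), Hs2; assumption.
      - intros; apply (so_r Sk), Hs2; assumption.
      - intros; apply (so_u Sk), Hs2; assumption.
      - intros; apply Prho, Hs2; assumption.
      - intros; apply HJ, Hs2; assumption. }
    apply (no_reduced_solution D2 N P k J (d_u (d_u V)) hN RS) with t r u rho s; try exact Hd2.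
    + apply (state_only_sub_box D1); assumption.
    + apply (state_only_sub_box D1); assumption.
    + intros ? ? ? ? ? h; apply nP, Hs2, h.
    + intros ? ? ? ? ? h; apply nw, Hs2, h.
  - (* [k = 1] identically: then [J = 0] and [p_rho = U^2]. *)
    assert (hk : forall t r u rho s, in_dom D1 t r u rho s -> k t r u rho s = 1).
    { intros t r u rho s Hd; apply NNPP; intros hk; apply hb.
      exists t, r, u, rho, s; split; [exact Hd | lra]. }
    assert (J0 : forall t r u rho s, in_dom D1 t r u rho s -> J t r u rho s = 0).
    { intros t r u rho s Hd.
      pose proof (multiplier_constraint _ _ _ _ _ MS $ Hd) as C.
      coords_neq0 Hd.
      pose proof (nP $ Hd) as hP.
      rewrite (Prho $ Hd), (hk $ Hd) in C.
      rewrite (HJ $ Hd).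
      lincomb (r / (2 * N * P t r u rho s) * C)%eqn; field; repeat split; auto; lra. }
    assert (X : forall t r u rho s, in_dom D1 t r u rho s ->
      P t r u rho s + (-1) * (u * u) + 0 * (u * u * u * u) + 0 * (u * u * u * u * u * u) = 0).
    { intros t r u rho s Hd.
      coords_neq0 Hd.
      cdiff DRho HJ Hd as Jrho; cdiff DU HJ Hd as Ju.
      cdiff DU E4 Hd as E4u; cdiff DU E3 Hd as E3u.
      rewrite (Pu $ Hd) in E4u.
      assert (J0u : d_u J t r u rho s = 0) by (diff DU J0 Hd as E; exact E).
      assert (J0rho : d_rho J t r u rho s = 0) by (diff DRho J0 Hd as E; exact E).
      rewrite J0u in Ju; rewrite J0rho in Jrho.
      apply Rmult_eq_reg_r with (d_u (d_u V) t r u rho s); [| apply (nw $ Hd)].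
      lincomb ((-1) * E4u + (- rho) * Jrho + u * E3u + (- u) * Ju)%eqn; ring. }
    destruct (box_inhabited D1) as (t & r & u & rho & s & Hd).
    destruct (even_polynomial_zero D1 P (fun _ _ _ _ _ => -1) (fun _ _ _ _ _ => 0) (fun _ _ _ _ _ => 0)
      SP (state_only_const _ _) (state_only_const _ _) (state_only_const _ _) X t r u rho s Hd) as (_ & Y & _).
    lra.
Qed.

(** * The determining equations *)

(* The conservation law is affine in U_r, rho_r, S_r; these are its coefficients
   after division by r^(n-1), with [N = n - 1]. *)
Record determining_equations (N : R) (D : box) (p : R -> R -> R) (Phi Psi : kfun) : Prop := {
  de_u : forall t r u rho s, in_dom D t r u rho s ->
    d_u Psi t r u rho s = rho * d_rho Phi t r u rho s - Phi t r u rho s;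
  de_rho : forall t r u rho s, in_dom D t r u rho s ->
    d_rho Psi t r u rho s = d_rho (state_fun p) t r u rho s / rho * d_u Phi t r u rho s;
  de_s : forall t r u rho s, in_dom D t r u rho s ->
    d_s Psi t r u rho s = d_s (state_fun p) t r u rho s / rho * d_u Phi t r u rho s;
  de_0 : forall t r u rho s, in_dom D t r u rho s ->
    d_t Phi t r u rho s + u * d_r Phi t r u rho s + d_r Psi t r u rho s
    + N / r * (Psi t r u rho s - u * d_u Psi t r u rho s) = 0
}.

Lemma INR_pred n : (1 < n)%nat -> INR (n - 1) = INR n - 1.
Proof. intros; rewrite minus_INR by lia; reflexivity. Qed.

(** [U_r] and [(n - 1) U / r] enter the continuity equation only through their sum, so this sum is
    factored out. What remains is the evolution equation with [rho Phi_rho - Phi] already replaced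
    by [Psi_U]. *)
Lemma conserved_expand n D p Phi Psi t r u rho s ur rhor sr : (1 < n)%nat ->
  smooth D Phi -> smooth D Psi -> in_dom D t r u rho s ->
  Dt_euler n p (radial_weight n Phi) t r u rho s ur rhor sr
    + Dr (radial_weight n (fun t r u rho s => Psi t r u rho s + u * Phi t r u rho s)) t r u rho s ur rhor sr
  = r ^ (n - 1) *
    ((d_u Psi t r u rho s - (rho * d_rho Phi t r u rho s - Phi t r u rho s))
       * (ur + (INR n - 1) / r * u)
     + (d_rho Psi t r u rho s - d_rho (state_fun p) t r u rho s / rho * d_u Phi t r u rho s) * rhor
     + (d_s Psi t r u rho s - d_s (state_fun p) t r u rho s / rho * d_u Phi t r u rho s) * sr
     + (d_t Phi t r u rho s + u * d_r Phi t r u rho s + d_r Psi t r u rho s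
        + (INR n - 1) / r * (Psi t r u rho s - u * d_u Psi t r u rho s))).
Proof.
  intros hn sF sG Hd.
  coords_neq0 Hd.
  change (d_rho (state_fun p) t r u rho s) with (p_rho p rho s).
  change (d_s (state_fun p) t r u rho s) with (p_s p rho s).
  unfold Dt_euler, Dr, euler_ut, euler_rhot, euler_st, radial_weight.
  unfold d_t at 1, d_u at 1, d_rho at 1, d_s at 1, d_r at 1.
  unfold d_u at 1, d_rho at 1, d_s at 1.
  erewrite (is_derive_unique (fun x => r ^ (n - 1) * Phi x r u rho s)) by der Hd.
  erewrite (is_derive_unique (fun x => r ^ (n - 1) * Phi t r x rho s)) by der Hd.
  erewrite (is_derive_unique (fun x => r ^ (n - 1) * Phi t r u x s)) by der Hd.
  erewrite (is_derive_unique (fun x => r ^ (n - 1) * Phi t r u rho x)) by der Hd.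
  erewrite (is_derive_unique (fun x => x ^ (n - 1) * (Psi t x u rho s + u * Phi t x u rho s))) by der Hd.
  erewrite (is_derive_unique (fun x => r ^ (n - 1) * (Psi t r x rho s + x * Phi t r x rho s))) by der Hd.
  erewrite (is_derive_unique (fun x => r ^ (n - 1) * (Psi t r u x s + u * Phi t r u x s))) by der Hd.
  erewrite (is_derive_unique (fun x => r ^ (n - 1) * (Psi t r u rho x + u * Phi t r u rho x))) by der Hd.
  rewrite (INR_pred n hn).
  field; auto.
Qed.

Lemma conserved_iff n D p A : (1 < n)%nat ->
  conserved n D p A <->
  smooth D (density A) /\ smooth D (moving_flux A) /\
  determining_equations (INR n - 1) D p (density A) (moving_flux A).
Proof.
  intros hn; destruct A as [Phi Psi]; unfold conserved, flux; simpl.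
  split; intros (sF & sG & H); (split; [exact sF | split; [exact sG |]]).
  - assert (E : forall t r u rho s ur rhor sr, in_dom D t r u rho s ->
      (d_u Psi t r u rho s - (rho * d_rho Phi t r u rho s - Phi t r u rho s))
       * (ur + (INR n - 1) / r * u)
     + (d_rho Psi t r u rho s - d_rho (state_fun p) t r u rho s / rho * d_u Phi t r u rho s) * rhor
     + (d_s Psi t r u rho s - d_s (state_fun p) t r u rho s / rho * d_u Phi t r u rho s) * sr
     + (d_t Phi t r u rho s + u * d_r Phi t r u rho s + d_r Psi t r u rho s
        + (INR n - 1) / r * (Psi t r u rho s - u * d_u Psi t r u rho s)) = 0).
    { intros t r u rho s ur rhor sr Hd.
      pose proof (H t r u rho s ur rhor sr Hd) as E.
      rewrite (conserved_expand n D p Phi Psi) in E by assumption.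
      apply Rmult_integral in E; destruct E as [E|E]; [| exact E].
      exfalso; revert E; apply pow_nonzero, (in_dom_r_neq0 Hd). }
    (* Jets with entries [0] and [1] isolate the coefficients of the affine expression. *)
    assert (E0 : forall t r u rho s, in_dom D t r u rho s ->
      d_u Psi t r u rho s = rho * d_rho Phi t r u rho s - Phi t r u rho s).
    { intros t r u rho s Hd.
      pose proof (E _ _ _ _ _ 0 0 0 Hd); pose proof (E _ _ _ _ _ 1 0 0 Hd); lra. }
    split; [exact E0 | ..]; intros t r u rho s Hd;
      pose proof (E _ _ _ _ _ 0 0 0 Hd) as X; pose proof (E _ _ _ _ _ 0 1 0 Hd) as Y;
      pose proof (E _ _ _ _ _ 0 0 1 Hd) as Z;
      rewrite (E0 $ Hd) in *; lra.
  - intros t r u rho s ur rhor sr Hd.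
    rewrite (conserved_expand n D p Phi Psi) by assumption.
    destruct H as [H1 H2 H3 H4].
    rewrite (H4 $ Hd), (H1 $ Hd), (H2 $ Hd), (H3 $ Hd); ring.
Qed.

(** * The determining equations in terms of [V] *)

Section Multiplier.
Variables (N : R) (D : box) (p : R -> R -> R) (Phi Psi V : kfun).
Hypothesis hN : 0 < N.
Hypothesis sp : smooth D (state_fun p).
Hypothesis sF : smooth D Phi.
Hypothesis sG : smooth D Psi.
Hypothesis sV : smooth D V.
Hypothesis HV : forall t r u rho s, in_dom D t r u rho s ->
  d_u Phi t r u rho s = rho * V t r u rho s.
Hypothesis DE : determining_equations N D p Phi Psi.

Let E1 := de_u _ _ _ _ _ DE.
Let E4 := de_0 _ _ _ _ _ DE.

Lemma de_rho_V t r u rho s : in_dom D t r u rho s ->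
  d_rho Psi t r u rho s = d_rho (state_fun p) t r u rho s * V t r u rho s.
Proof.
  intros Hd; rewrite (de_rho _ _ _ _ _ DE), (HV $ Hd) by exact Hd.
  field; apply (in_dom_rho_neq0 Hd).
Qed.

Lemma de_s_V t r u rho s : in_dom D t r u rho s ->
  d_s Psi t r u rho s = d_s (state_fun p) t r u rho s * V t r u rho s.
Proof.
  intros Hd; rewrite (de_s _ _ _ _ _ DE), (HV $ Hd) by exact Hd.
  field; apply (in_dom_rho_neq0 Hd).
Qed.

Lemma state_fun_t t r u rho s : d_t (state_fun p) t r u rho s = 0.
Proof. unfold d_t, d_r, d_u, state_fun; apply Derive_const. Qed.
Lemma state_fun_r t r u rho s : d_r (state_fun p) t r u rho s = 0.
Proof. unfold d_t, d_r, d_u, state_fun; apply Derive_const. Qed.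
Lemma state_fun_u t r u rho s : d_u (state_fun p) t r u rho s = 0.
Proof. unfold d_t, d_r, d_u, state_fun; apply Derive_const. Qed.

Lemma state_only_state_fun : state_only D (state_fun p).
Proof. split; [exact sp | intros; apply state_fun_t | intros; apply state_fun_r | intros; apply state_fun_u]. Qed.

Lemma state_only_p_rho : state_only D (d_rho (state_fun p)).
Proof. apply state_only_d_rho, state_only_state_fun. Qed.

Lemma state_only_p_s : state_only D (d_s (state_fun p)).
Proof. split; [smooth_tac | intros; unfold d_t, d_r, d_u, d_s, state_fun; apply Derive_const ..]. Qed.

Lemma density_multiplier_system :
  multiplier_system D N (d_rho (state_fun p)) V (d_rho Phi).
Proof.
  pose proof state_only_p_rho as SP.
  split; try smooth_tac; try (apply SP); intros t r u rho s Hd;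
    coords_neq0 Hd.
  - cdiff DU E4 Hd as E4u; cdiff DR E1 Hd as E1r; diff DU E1 Hd as E1u.
    cdiff DT HV Hd as HVt; cdiff DR HV Hd as HVr.
    pose proof (HV $ Hd) as HV'.
    rewrite (comm_rrho D Phi) by assumption.
    apply Rmult_eq_reg_l with rho; [| exact hrho].
    lincomb (E4u + (-1) * E1r + (N / r * u) * E1u + (-1) * HVt + (- u) * HVr + (- (N / r * u)) * HV')%eqn.
    field; auto.
  - cdiff DRho E4 Hd as E4rho; diff DR de_rho_V Hd as E2r; diff DU de_rho_V Hd as E2u.
    rewrite (comm_rrho D Psi) in E2r by assumption; rewrite (comm_urho D Psi) in E2u by assumption.
    pose proof (de_rho_V $ Hd) as E2.
    rewrite (so_r SP) in E2r by exact Hd; rewrite (so_u SP) in E2u by exact Hd.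
    rewrite (comm_trho D Phi), (comm_rrho D Phi) by assumption.
    lincomb (E4rho + (-1) * E2r + (- (N / r)) * E2 + (N / r * u) * E2u)%eqn.
    field; auto.
  - cdiff DRho HV Hd as HVrho.
    rewrite (comm_urho D Phi) by assumption; lincomb ((-1) * HVrho)%eqn; ring.
  - cdiff DRho E1 Hd as E1rho; diff DU de_rho_V Hd as E2u.
    rewrite (comm_urho D Psi) in E2u by assumption.
    rewrite (so_u SP) in E2u by exact Hd.
    lincomb (E2u + (-1) * E1rho)%eqn; ring.
Qed.

(** The mixed derivatives of [Psi] in [rho] and [S] agree, and the terms with [p_{rho S}] cancel. *)
Lemma multiplier_state_compat t r u rho s : in_dom D t r u rho s ->
  d_rho (state_fun p) t r u rho s * d_s V t r u rho s
  = d_s (state_fun p) t r u rho s * d_rho V t r u rho s.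
Proof.
  intros Hd; diff DS de_rho_V Hd as X; diff DRho de_s_V Hd as Y.
  rewrite (comm_rhos D Psi), (comm_rhos D (state_fun p)) in Y by assumption.
  lincomb (Y + (-1) * X)%eqn; ring.
Qed.

End Multiplier.

(** By [ms_3], [Q] is [rho^2 V_rho], so it measures how the multiplier depends on the density. It
    comes out as a function of [r] and [S] proportional to [r^(-N)], the signature of the enthalpy
    flux; the last equation ties [V_r] to [V_{Ut}]. *)
Lemma linear_multiplier_structure D N P V H Q : 0 < N -> multiplier_system D N P V H ->
  (forall g, smooth D g ->
    (forall t r u rho s, in_dom D t r u rho s -> P t r u rho s * g t r u rho s = 0) ->
    forall t r u rho s, in_dom D t r u rho s -> g t r u rho s = 0) ->
  (forall t r u rho s, in_dom D t r u rho s -> d_u (d_u V) t r u rho s = 0) ->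
  smooth D Q ->
  (forall t r u rho s, in_dom D t r u rho s ->
    Q t r u rho s = rho * (d_u H t r u rho s - V t r u rho s)) ->
  forall t r u rho s, in_dom D t r u rho s ->
    d_t Q t r u rho s = 0 /\ d_r Q t r u rho s = - (N / r * Q t r u rho s) /\
    d_u Q t r u rho s = 0 /\ d_rho Q t r u rho s = 0 /\
    d_u (d_r V) t r u rho s = 0 /\
    d_u (d_t V) t r u rho s + 2 * d_r V t r u rho s - 2 * N / r * Q t r u rho s / rho = 0.
Proof.
  intros hN MS gen Vuu sQ HQ.
  destruct MS as [sP sV sH Pt Pr Pu E1 E2 E3 E4].
  assert (Qrho : forall t r u rho s, in_dom D t r u rho s -> d_rho Q t r u rho s = 0).
  { intros t r u rho s Hd.
    cdiff DRho HQ Hd as E; cdiff DU E4 Hd as E4u.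
    pose proof (E3 $ Hd) as E3'.
    rewrite (Vuu $ Hd), (Pu $ Hd) in E4u.
    lincomb (E + E4u + (-1) * E3')%eqn; ring. }
  assert (Quu : forall t r u rho s, in_dom D t r u rho s -> d_u (d_u Q) t r u rho s = 0).
  { assert (Qu : forall t r u rho s, in_dom D t r u rho s ->
      d_u Q t r u rho s = rho * rho * d_rho (d_u V) t r u rho s).
    { intros t r u rho s Hd.
      cdiff DU HQ Hd as E; cdiff DU E3 Hd as E3u.
      lincomb (E + (- rho) * E3u)%eqn; ring. }
    intros t r u rho s Hd; diff DU Qu Hd as E; rewrite E.
    rewrite (comm_urho D (d_u V)) by (assumption || smooth_tac).
    diff DRho Vuu Hd as E'; rewrite E'; ring. }
  (* In the names below, B and G stand for V_U and Q_U, which do not depend on U. *)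
  assert (Vrho : forall t r u rho s, in_dom D t r u rho s ->
    d_rho V t r u rho s = Q t r u rho s / (rho * rho)).
  { intros t r u rho s Hd; coords_neq0 Hd.
    rewrite (HQ $ Hd); lincomb (/ rho * E3 $ Hd)%eqn; field; auto. }
  assert (Hu : forall t r u rho s, in_dom D t r u rho s ->
    d_u H t r u rho s = V t r u rho s + Q t r u rho s / rho).
  { intros t r u rho s Hd; coords_neq0 Hd.
    rewrite (HQ $ Hd); field; auto. }
  (* The [rho]-derivative of [ms_1], with [V_rho] and [H_rho] eliminated. *)
  assert (I12 : forall t r u rho s, in_dom D t r u rho s ->
    d_t Q t r u rho s + u * d_r Q t r u rho s + N / r * u * Q t r u rho s
    + rho * P t r u rho s * d_u (d_r V) t r u rho s = 0).
  { intros t r u rho s Hd; coords_neq0 Hd.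
    cdiff DRho E1 Hd as E; cdiff DT Vrho Hd as Vt; cdiff DR Vrho Hd as Vr.
    cdiff DR E4 Hd as E4r; cdiff DU E4 Hd as E4u.
    rewrite (Pr $ Hd) in E4r; rewrite (Pu $ Hd), (Vuu $ Hd) in E4u.
    rewrite Vt, Vr, (Vrho $ Hd) in E.
    lincomb ((rho * rho) * E + (- rho) * E4r + (rho * u * N / r) * E4u)%eqn.
    field; auto. }
  assert (I9 : forall t r u rho s, in_dom D t r u rho s ->
    d_t (d_u V) t r u rho s + u * d_r (d_u V) t r u rho s + 2 * d_r V t r u rho s
    + (d_r Q t r u rho s - N / r * (Q t r u rho s + u * d_u Q t r u rho s)) / rho = 0).
  { intros t r u rho s Hd; coords_neq0 Hd.
    cdiff DU E1 Hd as E; cdiff DR Hu Hd as Hur; cdiff DU Hu Hd as Huu.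
    rewrite Hur, Huu, (Hu $ Hd) in E.
    rewrite (comm_tu D V), (comm_ru D V) by assumption.
    lincomb E; field; auto. }
  assert (I9u : forall t r u rho s, in_dom D t r u rho s ->
    3 * rho * d_r (d_u V) t r u rho s + d_r (d_u Q) t r u rho s - 2 * N / r * d_u Q t r u rho s = 0).
  { intros t r u rho s Hd; coords_neq0 Hd.
    diff DU I9 Hd as E; diff DT Vuu Hd as Vt; diff DR Vuu Hd as Vr.
    rewrite <- (comm_tu D (d_u V)), <- (comm_ru D (d_u V)), Vt, Vr, (Quu $ Hd) in E by smooth_tac.
    rewrite <- (comm_ru D Q), <- (comm_ru D V) in E by assumption.
    lincomb (rho * E)%eqn; field; auto. }
  (* [Q_U] is independent of [rho], while [V_{U rho} = Q_U / rho^2]. Hence the [rho]-derivative of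
     [I9u] is a second equation for the same two unknowns. *)
  assert (Gr : forall t r u rho s, in_dom D t r u rho s ->
    d_r (d_u Q) t r u rho s = - (N / r) * d_u Q t r u rho s /\
    rho * d_r (d_u V) t r u rho s = N / r * d_u Q t r u rho s).
  { intros t r u rho s Hd; coords_neq0 Hd.
    assert (Grho : forall t r u rho s, in_dom D t r u rho s -> d_rho (d_u Q) t r u rho s = 0).
    { intros t1 r1 u1 rho1 s1 Hd1; diff DU Qrho Hd1 as E.
      rewrite <- (comm_urho D Q) by assumption; exact E. }
    assert (Brho : forall t r u rho s, in_dom D t r u rho s ->
      d_rho (d_u V) t r u rho s = d_u Q t r u rho s / (rho * rho)).
    { intros t1 r1 u1 rho1 s1 Hd1.
      pose proof (in_dom_rho_neq0 Hd1).
      cdiff DU Vrho Hd1 as E; rewrite E; field; auto. }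
    diff DRho I9u Hd as E; diff DR Grho Hd as Gr; diff DR Brho Hd as Br.
    rewrite (comm_rrho D (d_u V)) in Br by smooth_tac.
    rewrite (comm_rrho D (d_u Q)) in Gr by smooth_tac.
    rewrite Gr, Br, (Grho $ Hd) in E.
    pose proof (I9u $ Hd) as E'.
    assert (X : rho * d_r (d_u V) t r u rho s = - d_r (d_u Q) t r u rho s).
    { lincomb ((rho / 3) * E)%eqn; field; auto. }
    split; [| rewrite X].
    - lincomb ((- / 2) * E' + (3 / 2) * X)%eqn; field; auto.
    - lincomb ((/ 2) * E' + (- 3 / 2) * X)%eqn; field; auto. }
  assert (c1 : forall t r u rho s, in_dom D t r u rho s ->
    d_t (d_u Q) t r u rho s + d_r Q t r u rho s + N / r * Q t r u rho s = 0).
  { intros t r u rho s Hd; coords_neq0 Hd.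
    destruct (Gr $ Hd) as [g1 _].
    diff DU I12 Hd as E; diff DR Vuu Hd as Vr.
    rewrite <- (comm_ru D V) in E by assumption.
    assert (X : d_u (d_u (d_r V)) t r u rho s = 0).
    { transitivity (d_u (d_r (d_u V)) t r u rho s).
      - apply (partial_eq_on D _ _ DU); [| exact Hd].
        intros t1 r1 u1 rho1 s1 Hd1; symmetry; apply (comm_ru D V); assumption.
      - rewrite <- (comm_ru D (d_u V)); [exact Vr | smooth_tac | exact Hd]. }
    rewrite X, (Pu $ Hd), <- (comm_tu D Q), <- (comm_ru D Q), g1 in E by assumption.
    lincomb E; field; auto. }
  assert (c2 : forall t r u rho s, in_dom D t r u rho s ->
    d_t Q t r u rho s - u * d_t (d_u Q) t r u rho s + P t r u rho s * (N / r) * d_u Q t r u rho s = 0).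
  { intros t r u rho s Hd.
    coords_neq0 Hd.
    destruct (Gr $ Hd) as [_ g2].
    pose proof (I12 $ Hd) as E; pose proof (c1 $ Hd) as E'.
    rewrite <- (comm_ru D V) in E by assumption.
    lincomb (E + (- u) * E' + (- P t r u rho s) * g2)%eqn; field; auto. }
  assert (Grt : forall t r u rho s, in_dom D t r u rho s ->
    d_r (d_t (d_u Q)) t r u rho s = - (N / r) * d_t (d_u Q) t r u rho s).
  { intros t r u rho s Hd.
    coords_neq0 Hd.
    rewrite <- (comm_tr D (d_u Q)) by (assumption || smooth_tac).
    assert (g1 : forall t r u rho s, in_dom D t r u rho s ->
      d_r (d_u Q) t r u rho s = - (N / r) * d_u Q t r u rho s) by (intros; apply Gr; assumption).
    diff DT g1 Hd as E; rewrite E; field; auto. }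
  assert (c3 : forall t r u rho s, in_dom D t r u rho s ->
    r * r * d_t (d_t (d_u Q)) t r u rho s = - P t r u rho s * N * d_u Q t r u rho s).
  { intros t r u rho s Hd.
    coords_neq0 Hd.
    destruct (Gr $ Hd) as [g1 _].
    diff DR c2 Hd as E; diff DT c1 Hd as E'.
    rewrite (Grt $ Hd), g1, (Pr $ Hd) in E.
    rewrite (comm_tr D Q) in E' by assumption.
    pose proof (c2 $ Hd) as E2'.
    lincomb ((r * r) * E' + (- r * r) * E + (- r * N) * E2')%eqn; field; auto. }
  (* [Q_U] scales as [r^(-N)], so the two sides of [c3] scale as [r^(2 - N)] and [r^(-N)]. Both must
     vanish, whence [p_rho Q_U = 0]. *)
  assert (G0 : forall t r u rho s, in_dom D t r u rho s -> d_u Q t r u rho s = 0).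
  { apply gen; [smooth_tac |].
    intros t r u rho s Hd.
    coords_neq0 Hd.
    destruct (Gr $ Hd) as [g1 _].
    diff DR c3 Hd as E; diff DT Grt Hd as E'.
    rewrite <- (comm_tr D (d_t (d_u Q))), E', g1, (Pr $ Hd) in E by smooth_tac.
    pose proof (c3 $ Hd) as E3'.
    apply Rmult_eq_reg_l with (2 * N); [| lra].
    lincomb ((- r) * E + (2 - N) * E3')%eqn; field; auto. }
  intros t r u rho s Hd.
  coords_neq0 Hd.
  destruct (Gr $ Hd) as [_ g2].
  assert (Gt : d_t (d_u Q) t r u rho s = 0) by (diff DT G0 Hd as E; exact E).
  pose proof (c1 $ Hd) as e1; pose proof (c2 $ Hd) as e2.
  pose proof (I9 $ Hd) as e9.
  rewrite Gt in e1, e2; rewrite (G0 $ Hd) in e2, g2, e9.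
  assert (Vur : d_r (d_u V) t r u rho s = 0).
  { apply Rmult_eq_reg_l with rho; [lra | exact hrho]. }
  assert (Qr : d_r Q t r u rho s = - (N / r * Q t r u rho s)) by lra.
  rewrite Vur, Qr in e9.
  repeat split; try assumption.
  - lra.
  - apply G0, Hd.
  - apply Qrho, Hd.
  - rewrite <- (comm_ru D V) by assumption; exact Vur.
  - rewrite <- (comm_tu D V) by assumption; lincomb e9; field; auto.
Qed.

(** The derivative is returned together with [B] because the multiplier also contains [B_t], as the
    coefficient of [- r / 2]. *)
Lemma quadratic_in_t D B : smooth D B ->
  (forall i t r u rho s, i <> DT -> in_dom D t r u rho s -> partial i B t r u rho s = 0) ->
  (forall t r u rho s, in_dom D t r u rho s -> d_t (d_t (d_t B)) t r u rho s = 0) ->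
  exists b0 b1 b2, forall t r u rho s, in_dom D t r u rho s ->
    B t r u rho s = b0 + b1 * t + b2 * t ^ 2 /\ d_t B t r u rho s = b1 + 2 * b2 * t.
Proof.
  intros sB H H3.
  assert (Ht : forall f, smooth D f ->
    (forall i t r u rho s, i <> DT -> in_dom D t r u rho s -> partial i f t r u rho s = 0) ->
    forall i t r u rho s, i <> DT -> in_dom D t r u rho s -> partial i (d_t f) t r u rho s = 0).
  { intros f sf Hf i t r u rho s hi Hd.
    assert (Hi : forall t r u rho s, in_dom D t r u rho s -> partial i f t r u rho s = 0) by auto.
    destruct i; simpl in *; try congruence; cdiff DT Hi Hd as E; exact E. }
  destruct (box_inhabited D) as (t0 & r0 & u0 & rho0 & s0 & Hd0).
  assert (C : forall f, smooth D f ->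
    (forall i t r u rho s, i <> DT -> in_dom D t r u rho s -> partial i f t r u rho s = 0) ->
    (forall t r u rho s, in_dom D t r u rho s -> d_t f t r u rho s = 0) ->
    forall t r u rho s, in_dom D t r u rho s -> f t r u rho s = f t0 r0 u0 rho0 s0).
  { intros f sf Hf Hft t r u rho s Hd; apply (const_of_partials_zero D); try assumption.
    intros [] ? ? ? ? ? Hd1; [apply Hft; assumption | apply Hf; [discriminate | assumption] ..]. }
  pose proof (C (d_t (d_t B)) ltac:(smooth_tac) (Ht (d_t B) (smooth_d_t D B sB) (Ht B sB H)) H3) as C2.
  set (b2 := d_t (d_t B) t0 r0 u0 rho0 s0 / 2).
  assert (S : forall (f : kfun) (g dg : R -> R), smooth D f -> smooth D (fun t _ _ _ _ => g t) ->
    (forall x, is_derive g x (dg x)) ->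
    (forall i t r u rho s, i <> DT -> in_dom D t r u rho s -> partial i f t r u rho s = 0) ->
    (forall t r u rho s, in_dom D t r u rho s -> d_t f t r u rho s = dg t) ->
    forall t r u rho s, in_dom D t r u rho s ->
    f t r u rho s - g t = f t0 r0 u0 rho0 s0 - g t0).
  { intros f g dg sf sg Hg Hf Hft t r u rho s Hd.
    apply (C (fun t r u rho s => f t r u rho s - g t)); try exact Hd.
    - apply (smooth_minus D f (fun t _ _ _ _ => g t)); assumption.
    - intros i t1 r1 u1 rho1 s1 hi Hd1; pose proof (Hf i _ _ _ _ _ hi Hd1) as E.
      rewrite partialE; apply is_derive_unique.
      destruct i; try congruence; simpl in *;
        (eapply is_derive_eq; [der Hd1 | req; rewrite E; ring]).
    - intros t1 r1 u1 rho1 s1 Hd1; apply is_derive_unique.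
      eapply is_derive_eq; [apply (is_derive_Rminus (fun x => f x r1 u1 rho1 s1) g); [der Hd1 | apply Hg] |].
      req; rewrite (Hft $ Hd1); ring. }
  assert (S1 := S (d_t B) (fun t => 2 * b2 * t) (fun _ => 2 * b2) ltac:(smooth_tac) ltac:(cbv beta; smooth_tac)
    ltac:(intros; auto_derive; [exact I | ring]) (Ht _ sB H)
    ltac:(intros t r u rho s Hd; rewrite (C2 $ Hd); unfold b2; field)).
  cbv beta in S1.
  set (b1 := d_t B t0 r0 u0 rho0 s0 - 2 * b2 * t0) in *.
  assert (S0 := S B (fun t => b1 * t + b2 * t ^ 2) (fun t => b1 + 2 * b2 * t) sB ltac:(cbv beta; smooth_tac)
    ltac:(intros; auto_derive; [exact I | ring]) H
    ltac:(intros t r u rho s Hd; pose proof (S1 $ Hd); lra)).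
  cbv beta in S0.
  exists (B t0 r0 u0 rho0 s0 - (b1 * t0 + b2 * t0 ^ 2)), b1, b2.
  intros t r u rho s Hd; pose proof (S0 $ Hd); pose proof (S1 $ Hd); split; lra.
Qed.

Lemma linear_multiplier D N P V H : 0 < N -> multiplier_system D N P V H ->
  (forall g, smooth D g ->
    (forall t r u rho s, in_dom D t r u rho s -> P t r u rho s * g t r u rho s = 0) ->
    forall t r u rho s, in_dom D t r u rho s -> g t r u rho s = 0) ->
  (forall t r u rho s, in_dom D t r u rho s -> d_u (d_u V) t r u rho s = 0) ->
  (forall t r u rho s, in_dom D t r u rho s -> d_u H t r u rho s = V t r u rho s) ->
  (forall t r u rho s, in_dom D t r u rho s -> d_s V t r u rho s = 0) ->
  exists b0 b1 b2, forall t r u rho s, in_dom D t r u rho s ->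
    V t r u rho s = (b0 + b1 * t + b2 * t ^ 2) * u - (b1 + 2 * b2 * t) * r / 2.
Proof.
  intros hN MS gen Vuu HV Vs.
  assert (St := linear_multiplier_structure D N P V H (fun _ _ _ _ _ => 0) hN MS gen Vuu (smooth_const D 0)
    ltac:(intros t r u rho s Hd; rewrite (HV $ Hd); ring)).
  destruct MS as [sP sV sH Pt Pr Pu E1 E2 E3 E4].
  assert (sB : smooth D (d_u V)) by smooth_tac.
  assert (Br : forall t r u rho s, in_dom D t r u rho s -> d_r (d_u V) t r u rho s = 0).
  { intros t r u rho s Hd; rewrite (comm_ru D V) by assumption; apply (St $ Hd). }
  assert (Vr : forall t r u rho s, in_dom D t r u rho s ->
    d_r V t r u rho s = - (d_t (d_u V) t r u rho s / 2)).
  { intros t r u rho s Hd; destruct (St $ Hd) as (_ & _ & _ & _ & _ & X).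
    rewrite (comm_tu D V) by assumption.
    coords_neq0 Hd.
    lincomb (/ 2 * X)%eqn; field; auto. }
  assert (Vrho : forall t r u rho s, in_dom D t r u rho s -> d_rho V t r u rho s = 0).
  { intros t r u rho s Hd; pose proof (E3 $ Hd) as X; rewrite (HV $ Hd) in X.
    apply Rmult_eq_reg_l with rho; [lra | apply (in_dom_rho_neq0 Hd)]. }
  assert (Btr : forall t r u rho s, in_dom D t r u rho s -> d_r (d_t (d_u V)) t r u rho s = 0).
  { intros t r u rho s Hd; diff DT Br Hd as E.
    rewrite <- (comm_tr D (d_u V)) by assumption; exact E. }
  (* In the [t]-derivative of [ms_1] minus the [r]-derivative of [ms_2], [H_{tr}] cancels; adding
     [U] times the [r]-derivative of [ms_1] removes [H_{rr}]. *)
  assert (Wave : forall t r u rho s, in_dom D t r u rho s ->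
    r * r * (d_t (d_t V) t r u rho s - u * d_t (d_t (d_u V)) t r u rho s)
    = N * P t r u rho s * (r * d_r V t r u rho s - V t r u rho s + u * d_u V t r u rho s)).
  { intros t r u rho s Hd.
    coords_neq0 Hd.
    cdiff DT E1 Hd as E1t; cdiff DR E1 Hd as E1r; cdiff DR E2 Hd as E2r.
    cdiff DT Vr Hd as Vrt; diff DR Vr Hd as Vrr.
    rewrite Btr in Vrr by exact Hd.
    assert (Bt : d_r (d_u V) t r u rho s = 0) by (apply Br, Hd).
    rewrite (comm_ru D V) in Bt by assumption.
    assert (HVt : d_u (d_t H) t r u rho s = d_t V t r u rho s).
    { rewrite <- (comm_tu D H) by assumption; diff DT HV Hd as X; exact X. }
    assert (HVr : d_u (d_r H) t r u rho s = d_r V t r u rho s).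
    { rewrite <- (comm_ru D H) by assumption; diff DR HV Hd as X; exact X. }
    rewrite ?HVt, ?HVr, ?Vrr, ?Vrt, ?Bt, ?(Pr $ Hd), ?(HV $ Hd) in *.
    lincomb ((r * r) * E1t + (- (r * r)) * E2r + (r * r * u) * E1r)%eqn.
    field; auto. }
  assert (Vttr : forall t r u rho s, in_dom D t r u rho s ->
    d_r (d_t (d_t V)) t r u rho s = - (d_t (d_t (d_t (d_u V))) t r u rho s / 2)).
  { assert (Vtr : forall t r u rho s, in_dom D t r u rho s ->
      d_r (d_t V) t r u rho s = - (d_t (d_t (d_u V)) t r u rho s / 2)).
    { intros t r u rho s Hd; cdiff DT Vr Hd as E; rewrite E; field. }
    intros t r u rho s Hd; diff DT Vtr Hd as E.
    rewrite <- (comm_tr D (d_t V)) by (assumption || smooth_tac); rewrite E; field. }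
  assert (Bttr : forall t r u rho s, in_dom D t r u rho s -> d_r (d_t (d_t (d_u V))) t r u rho s = 0).
  { intros t r u rho s Hd; diff DT Btr Hd as E.
    rewrite <- (comm_tr D (d_t (d_u V))) by (assumption || smooth_tac); exact E. }
  assert (Btttr : forall t r u rho s, in_dom D t r u rho s -> d_r (d_t (d_t (d_t (d_u V)))) t r u rho s = 0).
  { intros t r u rho s Hd; diff DT Bttr Hd as E.
    rewrite <- (comm_tr D (d_t (d_t (d_u V)))) by (assumption || smooth_tac); exact E. }
  (* The bracket on the right of [Wave] does not depend on [r], since [V_r = - V_{Ut} / 2] and [V_U]
     is free of [r]. So the left-hand side has zero [r]-derivative. *)
  assert (X1 : forall t r u rho s, in_dom D t r u rho s ->
    4 * (d_t (d_t V) t r u rho s - u * d_t (d_t (d_u V)) t r u rho s)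
    = r * d_t (d_t (d_t (d_u V))) t r u rho s).
  { intros t r u rho s Hd.
    coords_neq0 Hd.
    diff DR Wave Hd as E; diff DR Vr Hd as Vrr.
    rewrite Btr in Vrr by exact Hd.
    rewrite Vttr, Bttr, Vrr, (Pr $ Hd), (Br $ Hd) in E by exact Hd.
    lincomb (2 / r * E)%eqn; field; auto. }
  (* The [r]-derivative of [X1] reads [- 2 V_{Uttt} = V_{Uttt}]. *)
  assert (X3 : forall t r u rho s, in_dom D t r u rho s -> d_t (d_t (d_t (d_u V))) t r u rho s = 0).
  { intros t r u rho s Hd; diff DR X1 Hd as E.
    rewrite Vttr, Bttr, Btttr in E by exact Hd; lra. }
  assert (X0 : forall t r u rho s, in_dom D t r u rho s ->
    V t r u rho s = u * d_u V t r u rho s - r * d_t (d_u V) t r u rho s / 2).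
  { intros t r u rho s Hd.
    assert (Y : r * d_r V t r u rho s - V t r u rho s + u * d_u V t r u rho s = 0).
    { apply (gen (fun t r u rho s => r * d_r V t r u rho s - V t r u rho s + u * d_u V t r u rho s));
        [smooth_tac | | exact Hd].
      intros t1 r1 u1 rho1 s1 Hd1; pose proof (Wave $ Hd1) as W.
      pose proof (X1 $ Hd1) as X; rewrite X3 in X by exact Hd1.
      assert (Z : d_t (d_t V) t1 r1 u1 rho1 s1 - u1 * d_t (d_t (d_u V)) t1 r1 u1 rho1 s1 = 0) by lra.
      rewrite Z in W; apply Rmult_eq_reg_l with N; lra. }
    rewrite Vr in Y by exact Hd; lra. }
  destruct (quadratic_in_t D (d_u V) sB) as (b0 & b1 & b2 & Hb).
  - intros i t r u rho s hi Hd; destruct i; try congruence; simpl.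
    + apply Br, Hd.
    + apply Vuu, Hd.
    + diff DU Vrho Hd as E; rewrite <- (comm_urho D V) by assumption; exact E.
    + diff DU Vs Hd as E; rewrite <- (comm_us D V) by assumption; exact E.
  - exact X3.
  - exists b0, b1, b2; intros t r u rho s Hd; destruct (Hb $ Hd) as [e1 e2].
    rewrite X0, e2, e1 by exact Hd; field.
Qed.

(** * Multipliers for generic, polytropic, barotropic and entropic pressure *)

Section Special.
Variables (N : R) (D : box) (p : R -> R -> R) (Phi Psi V : kfun).
Hypothesis hN : 0 < N.
Hypothesis sp : smooth D (state_fun p).
Hypothesis sF : smooth D Phi.
Hypothesis sG : smooth D Psi.
Hypothesis sV : smooth D V.
Hypothesis HV : forall t r u rho s, in_dom D t r u rho s ->
  d_u Phi t r u rho s = rho * V t r u rho s.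
Hypothesis DE : determining_equations N D p Phi Psi.

Let E1 := de_u _ _ _ _ _ DE.
Let E4 := de_0 _ _ _ _ _ DE.
Let Erho := de_rho_V _ _ _ _ _ _ HV DE.
Let Es := de_s_V _ _ _ _ _ _ HV DE.
Let Ps := state_only_p_s D p sp.

(* The S-derivative of [de_0], and the compatibility of [de_u] with [de_s]. *)
Lemma density_s_equations t r u rho s : in_dom D t r u rho s ->
  d_t (d_s Phi) t r u rho s + u * d_r (d_s Phi) t r u rho s
    + d_s (state_fun p) t r u rho s * (d_r V t r u rho s
        + N / r * (V t r u rho s - u * d_u V t r u rho s)) = 0 /\
  rho * d_rho (d_s Phi) t r u rho s - d_s Phi t r u rho s
    = d_s (state_fun p) t r u rho s * d_u V t r u rho s.
Proof.
  intros Hd.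
  coords_neq0 Hd.
  diff DS E4 Hd as A; diff DS E1 Hd as B; diff DR Es Hd as C; diff DU Es Hd as F.
  rewrite (so_r Ps) in C by exact Hd; rewrite (so_u Ps) in F by exact Hd.
  rewrite (comm_ts D Phi), (comm_rs D Phi), (comm_rhos D Phi) by assumption.
  rewrite (comm_rs D Psi) in C by assumption; rewrite (comm_us D Psi) in F by assumption.
  split.
  - pose proof (Es $ Hd) as X.
    lincomb (A + (-1) * C + (- (N / r)) * X + (N / r * u) * F)%eqn; field; auto.
  - lincomb ((-1) * B + F)%eqn; ring.
Qed.

Lemma generic_p_rho_cancel : generic D (p_rho p) ->
  forall g, smooth D g ->
    (forall t r u rho s, in_dom D t r u rho s -> d_rho (state_fun p) t r u rho s * g t r u rho s = 0) ->
    forall t r u rho s, in_dom D t r u rho s -> g t r u rho s = 0.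
Proof. intros Gp g sg H; apply (generic_cancel D (p_rho p) g Gp sg); exact H. Qed.

Lemma generic_p_s_cancel : generic D (p_s p) ->
  forall g, smooth D g ->
    (forall t r u rho s, in_dom D t r u rho s -> d_s (state_fun p) t r u rho s * g t r u rho s = 0) ->
    forall t r u rho s, in_dom D t r u rho s -> g t r u rho s = 0.
Proof. intros Gp g sg H; apply (generic_cancel D (p_s p) g Gp sg); exact H. Qed.

(** Compatibility gives [p_rho V_S = p_S Q / rho^2]. Here [V_S] turns out to be free of [r], whereas
    [Q] is proportional to [r^(-N)]; the [r]-derivative leaves [p_S Q = 0], so a generic [p_S]
    excludes the enthalpy term. *)
Lemma multiplier_no_enthalpy : generic D (p_rho p) -> generic D (p_s p) ->
  forall t r u rho s, in_dom D t r u rho s -> d_u (d_rho Phi) t r u rho s = V t r u rho s.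
Proof.
  intros Gr Gs.
  pose proof (generic_p_rho_cancel Gr) as gr; pose proof (generic_p_s_cancel Gs) as gs.
  pose proof (density_multiplier_system N D p Phi Psi V sp sF sG sV HV DE) as MS.
  pose proof (multiplier_linear _ _ _ _ _ hN MS gr) as Vuu.
  pose (Q := fun t r u rho s => rho * (d_u (d_rho Phi) t r u rho s - V t r u rho s)).
  assert (sQ : smooth D Q) by (unfold Q; smooth_tac).
  pose proof (linear_multiplier_structure D N _ V _ Q hN MS gr Vuu sQ ltac:(reflexivity)) as St.
  assert (HQ : forall t r u rho s, Q t r u rho s = rho * (d_u (d_rho Phi) t r u rho s - V t r u rho s)) by reflexivity.
  clearbody Q.
  assert (Vrho : forall t r u rho s, in_dom D t r u rho s ->
    d_rho V t r u rho s = Q t r u rho s / (rho * rho)).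
  { intros t r u rho s Hd; coords_neq0 Hd.
    rewrite HQ; lincomb (/ rho * (ms_3 MS) $ Hd)%eqn; field; auto. }
  assert (Qs : forall t r u rho s, in_dom D t r u rho s -> d_s Q t r u rho s = 0).
  { intros t r u rho s Hd.
    assert (X : forall t r u rho s, in_dom D t r u rho s ->
      rho * d_rho (d_s Phi) t r u rho s - d_s Phi t r u rho s
      = d_s (state_fun p) t r u rho s * d_u V t r u rho s) by (intros; apply density_s_equations; assumption).
    diff DU X Hd as Y; rewrite (so_u Ps), (Vuu $ Hd) in Y by exact Hd.
    assert (HQ' : forall t r u rho s, in_dom D t r u rho s ->
      Q t r u rho s = rho * d_u (d_rho Phi) t r u rho s - d_u Phi t r u rho s).
    { intros t1 r1 u1 rho1 s1 Hd1; rewrite HQ, (HV $ Hd1); ring. }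
    diff DS HQ' Hd as Z; rewrite Z.
    rewrite <- (comm_us D Phi) by assumption.
    rewrite <- (comm_us D (d_rho Phi)) by smooth_tac.
    assert (W : d_u (d_s (d_rho Phi)) t r u rho s = d_u (d_rho (d_s Phi)) t r u rho s).
    { apply (partial_eq_on D _ _ DU); [| exact Hd].
      intros t1 r1 u1 rho1 s1 Hd1; symmetry; apply (comm_rhos D Phi); assumption. }
    rewrite W; lincomb Y; ring. }
  assert (Cs : forall t r u rho s, in_dom D t r u rho s ->
    d_rho (state_fun p) t r u rho s * d_s V t r u rho s
    = d_s (state_fun p) t r u rho s * (Q t r u rho s / (rho * rho))).
  { intros t r u rho s Hd; rewrite <- (Vrho $ Hd).
    apply (multiplier_state_compat N D p Phi Psi V sp sG sV HV DE); exact Hd. }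
  assert (Vsu : forall t r u rho s, in_dom D t r u rho s -> d_u (d_s V) t r u rho s = 0).
  { apply gr; [smooth_tac |]; intros t r u rho s Hd.
    diff DU Cs Hd as E.
    rewrite (so_u Ps), (so_u (state_only_p_rho D p sp)) in E by exact Hd.
    destruct (St $ Hd) as (_ & _ & Qu & _); rewrite Qu in E.
    coords_neq0 Hd.
    lincomb E; field; auto. }
  assert (Vsr : forall t r u rho s, in_dom D t r u rho s -> d_r (d_s V) t r u rho s = 0).
  { intros t r u rho s Hd.
    assert (X : forall t r u rho s, in_dom D t r u rho s ->
      d_u (d_t V) t r u rho s + 2 * d_r V t r u rho s - 2 * N / r * Q t r u rho s / rho = 0)
      by (intros; apply St; assumption).
    diff DS X Hd as Y; rewrite (Qs $ Hd) in Y.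
    diff DT Vsu Hd as Z.
    assert (W : d_s (d_u (d_t V)) t r u rho s = d_t (d_u (d_s V)) t r u rho s).
    { transitivity (d_u (d_s (d_t V)) t r u rho s).
      { symmetry; apply (comm_us D (d_t V)); smooth_tac || assumption. }
      rewrite (comm_tu D (d_s V)) by (smooth_tac || assumption).
      apply (partial_eq_on D _ _ DU); [| exact Hd].
      intros t1 r1 u1 rho1 s1 Hd1; symmetry; apply (comm_ts D V); assumption. }
    rewrite W, Z in Y; rewrite (comm_rs D V) by assumption.
    coords_neq0 Hd.
    lincomb (/ 2 * Y)%eqn; field; auto. }
  assert (Q0 : forall t r u rho s, in_dom D t r u rho s -> Q t r u rho s = 0).
  { apply gs; [exact sQ |]; intros t r u rho s Hd.
    diff DR Cs Hd as E.
    rewrite (so_r Ps), (so_r (state_only_p_rho D p sp)), (Vsr $ Hd) in E by exact Hd.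
    destruct (St $ Hd) as (_ & Qr & _); rewrite Qr in E.
    coords_neq0 Hd.
    lincomb ((rho * rho * r / N) * E)%eqn; field; repeat split; auto; lra. }
  intros t r u rho s Hd; pose proof (Q0 $ Hd) as E; rewrite HQ in E.
  apply Rmult_integral in E; destruct E as [E|E]; [| lra].
  exfalso; exact (in_dom_rho_neq0 Hd E).
Qed.

Lemma special_multiplier : generic D (p_rho p) ->
  (forall t r u rho s, in_dom D t r u rho s -> d_u (d_rho Phi) t r u rho s = V t r u rho s) ->
  exists b0 b1 b2, forall t r u rho s, in_dom D t r u rho s ->
    V t r u rho s = (b0 + b1 * t + b2 * t ^ 2) * u - (b1 + 2 * b2 * t) * r / 2.
Proof.
  intros Gr HQ.
  pose proof (generic_p_rho_cancel Gr) as gr.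
  pose proof (density_multiplier_system N D p Phi Psi V sp sF sG sV HV DE) as MS.
  apply (linear_multiplier D N _ V _ hN MS gr (multiplier_linear _ _ _ _ _ hN MS gr) HQ).
  (* [ms_3] and [HQ] give [V_rho = 0], so the compatibility in [rho] and [S] reduces to
     [p_rho V_S = 0]. *)
  apply gr; [smooth_tac |]; intros t r u rho s Hd.
  rewrite (multiplier_state_compat N D p Phi Psi V sp sG sV HV DE) by exact Hd.
  pose proof (ms_3 MS $ Hd) as E; rewrite (HQ $ Hd) in E.
  coords_neq0 Hd.
  lincomb ((d_s (state_fun p) t r u rho s / rho) * E)%eqn; field; auto.
Qed.

(** When [p_S = 0], a generic [p_rho] forces [V_S = 0], and then [Q = rho^2 V_rho] is free of [S] as
    well. So [Q] is a constant times [r^(-N)]. *)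
Lemma enthalpy_coefficient : generic D (p_rho p) ->
  (forall t r u rho s, in_dom D t r u rho s -> d_s (state_fun p) t r u rho s = 0) ->
  forall t r u rho s, in_dom D t r u rho s ->
  let Q := fun t r u rho s => rho * (d_u (d_rho Phi) t r u rho s - V t r u rho s) in
  d_t Q t r u rho s = 0 /\ d_r Q t r u rho s = - (N / r * Q t r u rho s) /\
  d_u Q t r u rho s = 0 /\ d_rho Q t r u rho s = 0 /\ d_s Q t r u rho s = 0.
Proof.
  intros Gr p0 t r u rho s Hd Q.
  pose proof (generic_p_rho_cancel Gr) as gr.
  pose proof (density_multiplier_system N D p Phi Psi V sp sF sG sV HV DE) as MS.
  pose proof (multiplier_linear _ _ _ _ _ hN MS gr) as Vuu.
  assert (sQ : smooth D Q) by (unfold Q; smooth_tac).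
  destruct (linear_multiplier_structure D N _ V _ Q hN MS gr Vuu sQ ltac:(reflexivity) $ Hd)
    as (q1 & q2 & q3 & q4 & _).
  repeat split; try assumption.
  assert (Vs : forall t r u rho s, in_dom D t r u rho s -> d_s V t r u rho s = 0).
  { apply gr; [smooth_tac |]; intros t1 r1 u1 rho1 s1 Hd1.
    rewrite (multiplier_state_compat N D p Phi Psi V sp sG sV HV DE), (p0 $ Hd1) by exact Hd1; ring. }
  assert (HQ : forall t r u rho s, in_dom D t r u rho s -> Q t r u rho s = rho * rho * d_rho V t r u rho s).
  { intros t1 r1 u1 rho1 s1 Hd1; unfold Q.
    lincomb ((- rho1) * ms_3 MS $ Hd1)%eqn; ring. }
  clearbody Q.
  diff DS HQ Hd as E; rewrite E, <- (comm_rhos D V) by assumption.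
  diff DRho Vs Hd as E'; rewrite E'; ring.
Qed.

(** With [b' = b1 + 2 b2 t] one has [V_r = - b' / 2] and [V - U V_U = - b' r / 2]. The first
    condition is then [multiplier_constraint]. The second is the equality of the mixed [t] and [rho]
    derivatives of [Phi_S], where the [t]-derivative [b'] of [V_U] raises [N + 1] to [N + 3]. *)
Lemma polytropic_conditions b0 b1 b2 :
  (forall t r u rho s, in_dom D t r u rho s ->
    V t r u rho s = (b0 + b1 * t + b2 * t ^ 2) * u - (b1 + 2 * b2 * t) * r / 2) ->
  forall t r u rho s, in_dom D t r u rho s ->
  (b1 + 2 * b2 * t) * ((N + 1) * rho * d_rho (d_rho (state_fun p)) t r u rho s
     - 2 * d_rho (state_fun p) t r u rho s) = 0 /\
  (b1 + 2 * b2 * t) * ((N + 1) * rho * d_rho (d_s (state_fun p)) t r u rho s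
     - (N + 3) * d_s (state_fun p) t r u rho s) = 0.
Proof.
  intros Hb t r u rho s Hd.
  pose proof (density_multiplier_system N D p Phi Psi V sp sF sG sV HV DE) as MS.
  assert (Vu : forall t r u rho s, in_dom D t r u rho s -> d_u V t r u rho s = b0 + b1 * t + b2 * t ^ 2).
  { intros t1 r1 u1 rho1 s1 Hd1; diff DU Hb Hd1 as E; rewrite E; field. }
  assert (Vr : forall t r u rho s, in_dom D t r u rho s -> d_r V t r u rho s = - (b1 + 2 * b2 * t) / 2).
  { intros t1 r1 u1 rho1 s1 Hd1; diff DR Hb Hd1 as E; rewrite E; field. }
  assert (Vs : forall t r u rho s, in_dom D t r u rho s -> d_s V t r u rho s = 0).
  { intros t1 r1 u1 rho1 s1 Hd1; diff DS Hb Hd1 as E; rewrite E; field. }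
  assert (Vrho : d_rho V t r u rho s = 0).
  { diff DRho Hb Hd as E; rewrite E; field. }
  coords_neq0 Hd.
  split.
  - pose proof (multiplier_constraint _ _ _ _ _ MS $ Hd) as C.
    pose proof (ms_3 MS $ Hd) as C3.
    rewrite Vrho in C3.
    assert (Hu : d_u (d_rho Phi) t r u rho s = V t r u rho s) by lra.
    rewrite Hu, (Vu $ Hd), (Vr $ Hd), (Hb $ Hd) in C.
    lincomb ((-2) * C)%eqn; field; auto.
  - pose (Z := d_s Phi).
    assert (sZ : smooth D Z) by (unfold Z; smooth_tac).
    assert (Zu : forall t r u rho s, in_dom D t r u rho s -> d_u Z t r u rho s = 0).
    { intros t1 r1 u1 rho1 s1 Hd1; unfold Z; rewrite (comm_us D Phi) by assumption.
      diff DS HV Hd1 as E; rewrite E, (Vs $ Hd1); ring. }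
    assert (S1 : forall t r u rho s, in_dom D t r u rho s ->
      d_t Z t r u rho s + u * d_r Z t r u rho s
      - d_s (state_fun p) t r u rho s * ((N + 1) * (b1 + 2 * b2 * t) / 2) = 0).
    { intros t1 r1 u1 rho1 s1 Hd1.
      pose proof (in_dom_r_neq0 Hd1) as hr1.
      destruct (density_s_equations $ Hd1) as [X _].
      rewrite (Vu $ Hd1), (Vr $ Hd1), (Hb $ Hd1) in X.
      unfold Z; lincomb X; field; auto. }
    assert (S2 : forall t r u rho s, in_dom D t r u rho s ->
      rho * d_rho Z t r u rho s - Z t r u rho s
      = d_s (state_fun p) t r u rho s * (b0 + b1 * t + b2 * t ^ 2)).
    { intros t1 r1 u1 rho1 s1 Hd1.
      destruct (density_s_equations $ Hd1) as [_ X].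
      rewrite (Vu $ Hd1) in X; exact X. }
    clearbody Z.
    assert (Zr : forall t r u rho s, in_dom D t r u rho s -> d_r Z t r u rho s = 0).
    { intros t1 r1 u1 rho1 s1 Hd1; diff DU S1 Hd1 as E.
      diff DT Zu Hd1 as E1'; diff DR Zu Hd1 as E2'.
      rewrite (comm_tu D Z) in E1' by assumption; rewrite (comm_ru D Z) in E2' by assumption.
      rewrite E1', E2', (so_u Ps) in E by exact Hd1; lra. }
    assert (S3 : forall t r u rho s, in_dom D t r u rho s ->
      d_t Z t r u rho s = d_s (state_fun p) t r u rho s * ((N + 1) * (b1 + 2 * b2 * t) / 2)).
    { intros t1 r1 u1 rho1 s1 Hd1; pose proof (S1 $ Hd1) as E; rewrite (Zr $ Hd1) in E; lra. }
    diff DT S2 Hd as X; diff DRho S3 Hd as Y.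
    rewrite (comm_trho D Z), Y, (S3 $ Hd), (so_t Ps) in X by assumption.
    lincomb (2 * X)%eqn; field.
Qed.

(** For [p_rho = 0] the compatibility condition [multiplier_constraint] is empty. The equations for
    [Phi_S] take its place. *)
Lemma entropic_multiplier :
  (forall t r u rho s, in_dom D t r u rho s -> d_rho (state_fun p) t r u rho s = 0) ->
  generic D (p_s p) ->
  (forall t r u rho s, in_dom D t r u rho s -> V t r u rho s = u * d_u V t r u rho s) /\
  (forall i t r u rho s, i <> DS -> in_dom D t r u rho s -> partial i (d_u V) t r u rho s = 0).
Proof.
  intros P0 Gs.
  pose proof (generic_p_s_cancel Gs) as gs.
  pose proof (density_multiplier_system N D p Phi Psi V sp sF sG sV HV DE) as MS.
  assert (Vrho : forall t r u rho s, in_dom D t r u rho s -> d_rho V t r u rho s = 0).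
  { apply gs; [smooth_tac |]; intros t r u rho s Hd.
    rewrite <- (multiplier_state_compat N D p Phi Psi V sp sG sV HV DE), (P0 $ Hd) by exact Hd; ring. }
  assert (Hu : forall t r u rho s, in_dom D t r u rho s -> d_u (d_rho Phi) t r u rho s = V t r u rho s).
  { intros t r u rho s Hd; pose proof (ms_3 MS $ Hd) as X.
    rewrite (Vrho $ Hd) in X; lra. }
  assert (Guu : forall t r u rho s, in_dom D t r u rho s -> d_u (d_u Psi) t r u rho s = 0).
  { intros t r u rho s Hd; diff DU E1 Hd as X.
    rewrite X, (Hu $ Hd), (HV $ Hd); ring. }
  (* [Psi] is affine in [U] and [Psi_S = p_S V], hence [p_S V_UU = 0]. *)
  assert (Vuu : forall t r u rho s, in_dom D t r u rho s -> d_u (d_u V) t r u rho s = 0).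
  { apply gs; [smooth_tac |].
    assert (Gsu : forall t r u rho s, in_dom D t r u rho s ->
      d_s (d_u Psi) t r u rho s = d_s (state_fun p) t r u rho s * d_u V t r u rho s).
    { intros t r u rho s Hd; rewrite <- (comm_us D Psi) by assumption.
      diff DU Es Hd as X; rewrite X, (so_u Ps) by exact Hd; ring. }
    intros t r u rho s Hd; diff DU Gsu Hd as X; rewrite (so_u Ps) in X by exact Hd.
    diff DS Guu Hd as Y; rewrite <- (comm_us D (d_u Psi)), X in Y by smooth_tac.
    lincomb Y; ring. }
  assert (I9 : forall t r u rho s, in_dom D t r u rho s ->
    d_t (d_u V) t r u rho s + u * d_r (d_u V) t r u rho s + 2 * d_r V t r u rho s = 0).
  { intros t r u rho s Hd; pose proof (ms_1 MS) as X.
    assert (X' : forall t r u rho s, in_dom D t r u rho s ->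
      d_t V t r u rho s + u * d_r V t r u rho s + d_r (d_rho Phi) t r u rho s = 0).
    { intros t1 r1 u1 rho1 s1 Hd1; pose proof (X $ Hd1) as Y; rewrite (Hu $ Hd1) in Y; lra. }
    diff DU X' Hd as Y; diff DR Hu Hd as Z.
    rewrite <- (comm_ru D (d_rho Phi)), Z, <- (comm_tu D V), <- (comm_ru D V) in Y by smooth_tac.
    lincomb Y; ring. }
  assert (Br : forall t r u rho s, in_dom D t r u rho s -> d_r (d_u V) t r u rho s = 0).
  { intros t r u rho s Hd; diff DU I9 Hd as X; diff DT Vuu Hd as Y; diff DR Vuu Hd as Z.
    rewrite <- (comm_tu D (d_u V)), <- (comm_ru D (d_u V)), <- (comm_ru D V), Y, Z in X by smooth_tac; lra. }
  assert (Vr : forall t r u rho s, in_dom D t r u rho s -> d_r V t r u rho s = - (d_t (d_u V) t r u rho s / 2)).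
  { intros t r u rho s Hd; pose proof (I9 $ Hd) as X; rewrite (Br $ Hd) in X; lra. }
  assert (Brho : forall t r u rho s, in_dom D t r u rho s -> d_rho (d_u V) t r u rho s = 0).
  { intros t r u rho s Hd; diff DU Vrho Hd as X; rewrite <- (comm_urho D V) by assumption; exact X. }
  assert (Psrho : forall t r u rho s, in_dom D t r u rho s -> d_rho (d_s (state_fun p)) t r u rho s = 0).
  { intros t r u rho s Hd; diff DS P0 Hd as X; rewrite (comm_rhos D (state_fun p)) by assumption; exact X. }
  (* Cross-differentiating the two equations for [Phi_S] gives [p_S] times this expression, since
     [p_S] does not depend on [rho]. *)
  assert (Bt : forall t r u rho s, in_dom D t r u rho s ->
    d_t (d_u V) t r u rho s - (d_r V t r u rho s + N / r * (V t r u rho s - u * d_u V t r u rho s)) = 0).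
  { apply gs; [smooth_tac |]; intros t r u rho s Hd.
    pose (Z := d_s Phi).
    assert (sZ : smooth D Z) by (unfold Z; smooth_tac).
    assert (S1 : forall t r u rho s, in_dom D t r u rho s ->
      d_t Z t r u rho s + u * d_r Z t r u rho s
      + d_s (state_fun p) t r u rho s * (d_r V t r u rho s
        + N / r * (V t r u rho s - u * d_u V t r u rho s)) = 0)
      by (intros; apply density_s_equations; assumption).
    assert (S2 : forall t r u rho s, in_dom D t r u rho s ->
      rho * d_rho Z t r u rho s - Z t r u rho s
      = d_s (state_fun p) t r u rho s * d_u V t r u rho s)
      by (intros; apply density_s_equations; assumption).
    clearbody Z.
    diff DRho S1 Hd as X; diff DT S2 Hd as Y; diff DR S2 Hd as W; diff DR Vrho Hd as Vrr.
    rewrite (comm_rrho D V) in Vrr by assumption.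
    rewrite (comm_trho D Z), (so_t Ps) in Y by assumption.
    rewrite (comm_rrho D Z), (so_r Ps), (Br $ Hd) in W by assumption.
    rewrite Vrr, (Psrho $ Hd), (Vrho $ Hd), (Brho $ Hd) in X.
    pose proof (S1 $ Hd) as X0.
    coords_neq0 Hd.
    lincomb (rho * X + (-1) * Y + (- u) * W + (-1) * X0)%eqn; field; auto. }
  assert (X3 : forall t r u rho s, in_dom D t r u rho s ->
    3 * d_r V t r u rho s + N / r * (V t r u rho s - u * d_u V t r u rho s) = 0).
  { intros t r u rho s Hd; pose proof (Bt $ Hd) as X; pose proof (Vr $ Hd); lra. }
  (* Since [V_rr = 0], the [r]-derivative of [X3] gives [r V_r = V - U V_U], and [X3] then becomes
     [(3 + N) V_r = 0]. *)
  assert (VB : forall t r u rho s, in_dom D t r u rho s -> V t r u rho s = u * d_u V t r u rho s).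
  { intros t r u rho s Hd; coords_neq0 Hd.
    diff DR X3 Hd as X; diff DR Vr Hd as Vrr; diff DT Br Hd as Btr.
    rewrite (comm_tr D (d_u V)) in Btr by smooth_tac.
    rewrite Btr in Vrr; rewrite Vrr, (Br $ Hd) in X.
    pose proof (X3 $ Hd) as Y.
    apply Rmult_eq_reg_l with (N * (3 + N)); [| nra].
    lincomb ((- 3 * r * r) * X + (N * r) * Y)%eqn; field; auto. }
  split; [exact VB |].
  assert (Vr0 : forall t r u rho s, in_dom D t r u rho s -> d_r V t r u rho s = 0).
  { intros t r u rho s Hd; pose proof (X3 $ Hd) as X.
    rewrite <- (VB $ Hd) in X; lra. }
  intros i t r u rho s hi Hd; destruct i; try congruence; simpl.
  - pose proof (Vr $ Hd) as X; rewrite (Vr0 $ Hd) in X; lra.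
  - apply Br, Hd.
  - apply Vuu, Hd.
  - apply Brho, Hd.
Qed.

End Special.

(** * Equivalence of conserved integrals *)

(** Poincare lemma for the closed form [G dt + F dr] on a rectangle. Local triviality asks for an
    explicit [Theta], which is built from [M]. *)
Lemma potential_exists D (F G : kfun) : smooth D F -> smooth D G ->
  (forall t r u rho s, in_dom D t r u rho s ->
     d_t F t r u rho s = d_r G t r u rho s) ->
  (forall i t r u rho s, i <> DT -> i <> DR -> in_dom D t r u rho s ->
     partial i F t r u rho s = 0 /\ partial i G t r u rho s = 0) ->
  exists M, smooth D M /\
    forall t r u rho s, in_dom D t r u rho s ->
      d_t M t r u rho s = G t r u rho s /\ d_r M t r u rho s = F t r u rho s /\
      d_u M t r u rho s = 0 /\ d_rho M t r u rho s = 0 /\ d_s M t r u rho s = 0.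
Proof.
  intros sF sG Hc H0.
  destruct (box_inhabited D) as (t0 & r0 & u0 & rho0 & s0 & Hd0).
  assert (Hd0' := Hd0); destruct Hd0' as (ht0 & hr0 & hu0 & hrho0 & hs0).
  assert (dom : forall t r, dom_t D t -> dom_r D r -> in_dom D t r u0 rho0 s0).
  { intros; unfold in_dom; tauto. }
  assert (C : forall f : kfun, smooth D f ->
    (forall i t r u rho s, i <> DT -> i <> DR -> in_dom D t r u rho s -> partial i f t r u rho s = 0) ->
    forall t r u rho s, in_dom D t r u rho s -> f t r u rho s = f t r u0 rho0 s0).
  { intros f sf Hf t r u rho s (h1 & h2 & h3 & h4 & h5).
    transitivity (f t r u0 rho s).
    { apply (const_of_derive_zero (dom_u D) (fun x => f t r x rho s)); try assumption.
      - apply dom_u_open.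
      - intros x Hx; assert (Hd : in_dom D t r x rho s) by (unfold in_dom; tauto).
        rewrite <- (Hf DU _ _ _ _ _ ltac:(discriminate) ltac:(discriminate) Hd).
        exact (smooth_is_derive D f DU _ _ _ _ _ sf Hd). }
    transitivity (f t r u0 rho0 s).
    { apply (const_of_derive_zero (dom_rho D) (fun x => f t r u0 x s)); try assumption.
      - apply dom_rho_open.
      - intros x Hx; assert (Hd : in_dom D t r u0 x s) by (unfold in_dom; tauto).
        rewrite <- (Hf DRho _ _ _ _ _ ltac:(discriminate) ltac:(discriminate) Hd).
        exact (smooth_is_derive D f DRho _ _ _ _ _ sf Hd). }
    apply (const_of_derive_zero (dom_s D) (fun x => f t r u0 rho0 x)); try assumption.
    - apply dom_s_open.
    - intros x Hx; assert (Hd : in_dom D t r u0 rho0 x) by (unfold in_dom; tauto).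
      rewrite <- (Hf DS _ _ _ _ _ ltac:(discriminate) ltac:(discriminate) Hd).
      exact (smooth_is_derive D f DS _ _ _ _ _ sf Hd). }
  assert (between : forall I a b x, Defs.open_interval I -> I a -> I b ->
    Rmin a b <= x <= Rmax a b -> I x).
  { intros I a b x HI Ha Hb Hx; apply (open_interval_convex I (Rmin a b) (Rmax a b)); try assumption.
    - unfold Rmin; destruct Rle_dec; assumption.
    - unfold Rmax; destruct Rle_dec; assumption. }
  (* Integration along [t] at fixed [r0], then along [r]. The [r]-derivative is immediate; the
     [t]-derivative uses closedness under the integral sign. *)
  pose (m := fun t r => RInt (fun x => G x r0 u0 rho0 s0) t0 t + RInt (fun y => F t y u0 rho0 s0) r0 r).
  assert (mr : forall t r, dom_t D t -> dom_r D r -> is_derive (fun y => m t y) r (F t r u0 rho0 s0)).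
  { intros t r ht hr; unfold m.
    eapply is_derive_eq.
    - apply is_derive_Rplus; [apply is_derive_Rconst |].
      apply (is_derive_RInt (fun y => F t y u0 rho0 s0) (RInt (fun y => F t y u0 rho0 s0) r0) r0).
      + generalize (open_interval_locally _ _ (dom_r_open D) hr); apply filter_imp; intros x hx.
        apply (@RInt_correct R_CompleteNormedModule), (@ex_RInt_continuous R_CompleteNormedModule); intros z hz.
        apply (smooth_cont_slice D F DR t); [exact sF | apply dom; [exact ht |]].
        apply (between _ r0 x); auto using dom_r_open.
      + apply (smooth_cont_slice D F DR t); auto.
    - req; cbv beta; ring. }
  assert (mt : forall t r, dom_t D t -> dom_r D r -> is_derive (fun x => m x r) t (G t r u0 rho0 s0)).
  { intros t r ht hr; unfold m.
    eapply is_derive_eq.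
    - apply is_derive_Rplus.
      + apply (is_derive_RInt (fun x => G x r0 u0 rho0 s0) (RInt (fun x => G x r0 u0 rho0 s0) t0) t0).
        * generalize (open_interval_locally _ _ (dom_t_open D) ht); apply filter_imp; intros x hx.
          apply (@RInt_correct R_CompleteNormedModule), (@ex_RInt_continuous R_CompleteNormedModule); intros z hz.
          apply (smooth_cont_slice D G DT z); [exact sG | apply dom; [| exact hr0]].
          apply (between _ t0 x); auto using dom_t_open.
        * apply (smooth_cont_slice D G DT t); auto.
      + apply (is_derive_RInt_param (fun x y => F x y u0 rho0 s0) r0 r t).
        * generalize (open_interval_locally _ _ (dom_t_open D) ht); apply filter_imp; intros x hx y hy.
          eexists; apply (is_derive_d_t D F); [exact sF | apply dom; [exact hx |]].
          apply (between _ r0 r); auto using dom_r_open.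
        * intros y hy; apply continuity_2d_pt_filterlim.
          assert (hy' : dom_r D y) by (apply (between _ r0 r); auto using dom_r_open).
          refine (continuous_comp_app5 D (d_t F) _ _ _ _ _ (t, y) (smooth_cont _ _ (smooth_d_t _ _ sF)) _ _ _ _ _ _);
            [apply dom; assumption | ..];
            solve [apply continuous_fst | apply continuous_snd | apply continuous_const].
        * generalize (open_interval_locally _ _ (dom_t_open D) ht); apply filter_imp; intros x hx.
          apply (@ex_RInt_continuous R_CompleteNormedModule); intros z hz.
          apply (smooth_cont_slice D F DR x); [exact sF | apply dom; [exact hx |]].
          apply (between _ r0 r); auto using dom_r_open.
    - cbv beta.
      assert (E : is_RInt (fun y => d_t F t y u0 rho0 s0) r0 r (G t r u0 rho0 s0 - G t r0 u0 rho0 s0)).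
      { apply is_RInt_ext with (fun y => d_r G t y u0 rho0 s0).
        - intros y hy; symmetry; apply Hc, dom; [exact ht |].
          apply (between _ r0 r); auto using dom_r_open; lra.
        - apply (is_RInt_derive (fun y => G t y u0 rho0 s0) (fun y => d_r G t y u0 rho0 s0)).
          + intros y hy; apply (is_derive_d_r D G); [exact sG | apply dom; [exact ht |]].
            apply (between _ r0 r); auto using dom_r_open.
          + intros y hy; apply (smooth_cont_slice D (d_r G) DR t); [smooth_tac | apply dom; [exact ht |]].
            apply (between _ r0 r); auto using dom_r_open. }
      apply (@is_RInt_unique R_CompleteNormedModule) in E; unfold d_t in E; req; rewrite E; ring. }
  assert (mc : forall t r, dom_t D t -> dom_r D r -> continuous (fun z : R * R => m (fst z) (snd z)) (t, r)).
  { intros t r ht hr.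
    apply (@filterdiff_continuous R_AbsRing (prod_NormedModule R_AbsRing R_NormedModule R_NormedModule)
      R_NormedModule (fun z : R * R => m (fst z) (snd z)) (t, r)).
    eexists; apply (is_derive_filterdiff m t r (fun x y => G x y u0 rho0 s0) (F t r u0 rho0 s0)).
    - generalize (locally_2d_of_intervals _ _ _ _ (dom_t_open D) (dom_r_open D) ht hr).
      intros L; apply locally_2d_locally in L; revert L; apply filter_imp.
      intros [x y] [hx hy]; apply mt; assumption.
    - apply mr; assumption.
    - refine (continuous_comp_app5 D G _ _ _ _ _ (t, r) (smooth_cont _ _ sG) _ _ _ _ _ _);
        [apply dom; assumption | ..];
        solve [apply continuous_fst | apply continuous_snd | apply continuous_const]. }
  assert (FC : forall t r u rho s, in_dom D t r u rho s -> F t r u rho s = F t r u0 rho0 s0).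
  { apply C; [exact sF |]; intros; apply H0; assumption. }
  assert (GC : forall t r u rho s, in_dom D t r u rho s -> G t r u rho s = G t r u0 rho0 s0).
  { apply C; [exact sG |]; intros; apply H0; assumption. }
  clearbody m.
  pose (g := fun i => match i with DT => G | DR => F | _ => fun _ _ _ _ _ => 0 end).
  assert (Hg : forall i t r u rho s, in_dom D t r u rho s ->
    is_derive (slice i (fun t r _ _ _ => m t r) t r u rho s) (coord i t r u rho s) (g i t r u rho s)).
  { intros i t r u rho s Hd; destruct i; simpl; try apply is_derive_Rconst.
    - rewrite (GC $ Hd); apply mt; apply Hd.
    - rewrite (FC $ Hd); apply mr; apply Hd. }
  exists (fun t r _ _ _ => m t r); split.
  - apply smooth_of_partials with g; [| exact Hg |].
    + intros t r u rho s Hd.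
      apply continuous_ext with (fun x : R * R * R * R * R => m (fst (fst (fst (fst x)))) (snd (fst (fst (fst x))))).
      { intros [[[[? ?] ?] ?] ?]; reflexivity. }
      apply (continuous_comp (fun x : R * R * R * R * R => fst (fst (fst x))) (fun z : R * R => m (fst z) (snd z))).
      * repeat apply continuous_fst_comp; apply continuous_id.
      * apply mc; apply Hd.
    + intros []; simpl; try assumption; apply smooth_const.
  - intros t r u rho s Hd; repeat split.
    + apply is_derive_unique, (Hg DT $ Hd).
    + apply is_derive_unique, (Hg DR $ Hd).
    + apply is_derive_unique, (Hg DU $ Hd).
    + apply is_derive_unique, (Hg DRho $ Hd).
    + apply is_derive_unique, (Hg DS $ Hd).
Qed.

Lemma determining_equations_lin N D p F1 G1 F2 G2 a b :
  smooth D F1 -> smooth D G1 -> smooth D F2 -> smooth D G2 ->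
  determining_equations N D p F1 G1 -> determining_equations N D p F2 G2 ->
  determining_equations N D p
    (fun t r u rho s => a * F1 t r u rho s + b * F2 t r u rho s)
    (fun t r u rho s => a * G1 t r u rho s + b * G2 t r u rho s).
Proof.
  intros sF1 sG1 sF2 sG2 [A1 B1 C1 D1] [A2 B2 C2 D2].
  assert (L : forall i f g, smooth D f -> smooth D g -> forall t r u rho s, in_dom D t r u rho s ->
    partial i (fun t r u rho s => a * f t r u rho s + b * g t r u rho s) t r u rho s
    = a * partial i f t r u rho s + b * partial i g t r u rho s).
  { intros i f g sf sg t r u rho s Hd; rewrite partialE; apply is_derive_unique.
    destruct i; simpl; (eapply is_derive_eq; [der Hd | req; ring]). }
  split; intros t r u rho s Hd;
    pose proof (fun i => L i _ _ sF1 sF2 $ Hd) as LF;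
    pose proof (fun i => L i _ _ sG1 sG2 $ Hd) as LG.
  - rewrite (LF DRho : d_rho _ _ _ _ _ _ = _), (LG DU : d_u _ _ _ _ _ _ = _); simpl; rewrite A1, A2 by exact Hd; ring.
  - rewrite (LF DU : d_u _ _ _ _ _ _ = _), (LG DRho : d_rho _ _ _ _ _ _ = _); simpl; rewrite B1, B2 by exact Hd; ring.
  - rewrite (LF DU : d_u _ _ _ _ _ _ = _), (LG DS : d_s _ _ _ _ _ _ = _); simpl; rewrite C1, C2 by exact Hd; ring.
  - rewrite (LF DT : d_t _ _ _ _ _ _ = _), (LF DR : d_r _ _ _ _ _ _ = _), (LG DR : d_r _ _ _ _ _ _ = _), (LG DU : d_u _ _ _ _ _ _ = _); simpl.
    lincomb (a * D1 $ Hd + b * D2 $ Hd)%eqn; ring.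
Qed.

Lemma determining_equations_ext N D p F1 G1 F2 G2 : eq_on D F1 F2 -> eq_on D G1 G2 ->
  determining_equations N D p F1 G1 -> determining_equations N D p F2 G2.
Proof.
  intros HF HG [A B C E].
  split; intros t r u rho s Hd;
    rewrite <- ?(partial_eq_on _ _ _ DT HF $ Hd : d_t _ _ _ _ _ _ = d_t _ _ _ _ _ _), <- ?(partial_eq_on _ _ _ DR HF $ Hd : d_r _ _ _ _ _ _ = d_r _ _ _ _ _ _),
      <- ?(partial_eq_on _ _ _ DU HF $ Hd : d_u _ _ _ _ _ _ = d_u _ _ _ _ _ _), <- ?(partial_eq_on _ _ _ DRho HF $ Hd : d_rho _ _ _ _ _ _ = d_rho _ _ _ _ _ _),
      <- ?(partial_eq_on _ _ _ DR HG $ Hd : d_r _ _ _ _ _ _ = d_r _ _ _ _ _ _), <- ?(partial_eq_on _ _ _ DU HG $ Hd : d_u _ _ _ _ _ _ = d_u _ _ _ _ _ _),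
      <- ?(partial_eq_on _ _ _ DRho HG $ Hd : d_rho _ _ _ _ _ _ = d_rho _ _ _ _ _ _), <- ?(partial_eq_on _ _ _ DS HG $ Hd : d_s _ _ _ _ _ _ = d_s _ _ _ _ _ _),
      <- ?(HF $ Hd), <- ?(HG $ Hd).
  - apply A, Hd.
  - apply B, Hd.
  - apply C, Hd.
  - apply E, Hd.
Qed.

Lemma conserved_lin n D p A B a b : (1 < n)%nat -> conserved n D p A -> conserved n D p B ->
  conserved n D p (iadd (iscale a A) (iscale b B)).
Proof.
  intros hn; rewrite !conserved_iff by exact hn.
  intros (sF1 & sG1 & H1) (sF2 & sG2 & H2); simpl; split; [smooth_tac | split; [smooth_tac |]].
  apply determining_equations_lin; assumption.
Qed.

Lemma conserved_ext n D p A B : (1 < n)%nat ->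
  eq_on D (density A) (density B) -> eq_on D (moving_flux A) (moving_flux B) ->
  conserved n D p A -> conserved n D p B.
Proof.
  intros hn HF HG; rewrite !conserved_iff by exact hn.
  intros (sF1 & sG1 & H1); split; [| split].
  - apply (smooth_ext D _ _ HF sF1).
  - apply (smooth_ext D _ _ HG sG1).
  - apply (determining_equations_ext _ _ _ _ _ _ _ HF HG H1).
Qed.

Lemma conserved_izero n D p : (1 < n)%nat -> conserved n D p izero.
Proof.
  intros hn; rewrite conserved_iff by exact hn; simpl.
  split; [smooth_tac | split; [smooth_tac |]].
  assert (Z : forall i t r u rho s, partial i (fun _ _ _ _ _ => 0) t r u rho s = 0).
  { intros i t r u rho s; rewrite partialE; destruct i; exact (Derive_const 0 _). }
  split; intros t r u rho s Hd.
  - pose proof (Z DU t r u rho s) as e1; pose proof (Z DRho t r u rho s) as e2; simpl in *; rewrite e1, e2; ring.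
  - pose proof (Z DU t r u rho s) as e1; pose proof (Z DRho t r u rho s) as e2; simpl in *; rewrite e1, e2; ring.
  - pose proof (Z DU t r u rho s) as e1; pose proof (Z DS t r u rho s) as e2; simpl in *; rewrite e1, e2; ring.
  - pose proof (Z DT t r u rho s) as e1; pose proof (Z DR t r u rho s) as e2;
      pose proof (Z DU t r u rho s) as e3; simpl in *; rewrite e1, e2, e3; ring.
Qed.

Lemma conserved_lin_comb n D p cs As : (1 < n)%nat ->
  (forall A, In A As -> conserved n D p A) -> conserved n D p (lin_comb cs As).
Proof.
  intros hn; revert cs; induction As as [|A As IH]; intros [|c cs] H;
    try apply (conserved_izero n D p hn).
  apply (conserved_ext n D p (iadd (iscale c A) (iscale 1 (lin_comb cs As)))); try exact hn.
  - intros t r u rho s _; unfold lin_comb; simpl; ring.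
  - intros t r u rho s _; unfold lin_comb; simpl; ring.
  - apply conserved_lin; [exact hn | apply H; left; reflexivity |].
    apply IH; intros B HB; apply H; right; exact HB.
Qed.

(* If the density does not depend on U, then [c = Psi_U] and [d = Psi - U c] depend
   on (t, r) only; adding [c] to the density leaves an integral invariant, and
   [(- c, c U + d)] has a potential. *)
Lemma equivalent_izero n D p A : (1 < n)%nat -> smooth D (state_fun p) -> conserved n D p A ->
  (forall t r u rho s, in_dom D t r u rho s -> d_u (density A) t r u rho s = 0) ->
  equivalent n D p A izero.
Proof.
  intros hn sp HA Fu; pose proof HA as HA'.
  rewrite conserved_iff in HA' by exact hn; destruct HA' as (sF & sG & [E1 E2 E3 E4]).
  set (Phi := density A) in *; set (Psi := moving_flux A) in *.
  set (N := INR n - 1) in *.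
  assert (E2' : forall t r u rho s, in_dom D t r u rho s -> d_rho Psi t r u rho s = 0).
  { intros t r u rho s Hd; rewrite (E2 $ Hd), (Fu $ Hd); ring. }
  assert (E3' : forall t r u rho s, in_dom D t r u rho s -> d_s Psi t r u rho s = 0).
  { intros t r u rho s Hd; rewrite (E3 $ Hd), (Fu $ Hd); ring. }
  pose (c := d_u Psi); assert (sc : smooth D c) by (unfold c; smooth_tac).
  pose (d := fun t r u rho s => Psi t r u rho s - u * c t r u rho s).
  assert (sd : smooth D d) by (unfold d; smooth_tac).
  assert (Hc : forall t r u rho s, in_dom D t r u rho s -> d_u Psi t r u rho s = c t r u rho s) by reflexivity.
  assert (HG : forall t r u rho s, in_dom D t r u rho s ->
    Psi t r u rho s = d t r u rho s + u * c t r u rho s) by (intros; unfold d; ring).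
  clearbody c d.
  assert (cu : forall t r u rho s, in_dom D t r u rho s -> d_u c t r u rho s = 0).
  { assert (X : forall t r u rho s, in_dom D t r u rho s ->
      c t r u rho s = rho * d_rho Phi t r u rho s - Phi t r u rho s).
    { intros; rewrite <- Hc, E1 by assumption; reflexivity. }
    intros t r u rho s Hd; diff DU X Hd as Y; diff DRho Fu Hd as Z.
    rewrite (comm_urho D Phi), Z, (Fu $ Hd) in Y by assumption; lra. }
  assert (crho : forall t r u rho s, in_dom D t r u rho s -> d_rho c t r u rho s = 0).
  { intros t r u rho s Hd; diff DU E2' Hd as X; diff DRho Hc Hd as Y.
    rewrite <- Y, <- (comm_urho D Psi) by assumption; exact X. }
  assert (cs : forall t r u rho s, in_dom D t r u rho s -> d_s c t r u rho s = 0).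
  { intros t r u rho s Hd; diff DU E3' Hd as X; diff DS Hc Hd as Y.
    rewrite <- Y, <- (comm_us D Psi) by assumption; exact X. }
  assert (du : forall t r u rho s, in_dom D t r u rho s -> d_u d t r u rho s = 0).
  { intros t r u rho s Hd; diff DU HG Hd as X; rewrite (Hc $ Hd), (cu $ Hd) in X; lra. }
  assert (drho : forall t r u rho s, in_dom D t r u rho s -> d_rho d t r u rho s = 0).
  { intros t r u rho s Hd; diff DRho HG Hd as X; rewrite (E2' _ _ _ _ _ Hd), (crho $ Hd) in X; lra. }
  assert (ds : forall t r u rho s, in_dom D t r u rho s -> d_s d t r u rho s = 0).
  { intros t r u rho s Hd; diff DS HG Hd as X; rewrite (E3' _ _ _ _ _ Hd), (cs $ Hd) in X; lra. }
  pose (G := fun t r u rho s => Phi t r u rho s + c t r u rho s).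
  assert (sGG : smooth D G) by (unfold G; smooth_tac).
  assert (HGG : forall t r u rho s, in_dom D t r u rho s ->
    Phi t r u rho s = G t r u rho s - c t r u rho s) by (intros; unfold G; ring).
  assert (Gu : forall t r u rho s, in_dom D t r u rho s -> d_u G t r u rho s = 0).
  { intros t r u rho s Hd; diff DU HGG Hd as X; rewrite (Fu $ Hd), (cu $ Hd) in X; lra. }
  assert (Grho : forall t r u rho s, in_dom D t r u rho s -> rho * d_rho G t r u rho s = G t r u rho s).
  { intros t r u rho s Hd; diff DRho HGG Hd as X.
    pose proof (E1 $ Hd) as Y; rewrite (Hc $ Hd), X, (crho $ Hd), (HGG $ Hd) in Y.
    lincomb ((-1) * Y)%eqn; ring. }
  (* The left-hand side is affine in [U] with slope [G_r], the right-hand side is free of [U] and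
     [rho]. So [G_r = 0], and [G_t], being both proportional to [rho] and free of [rho],
     vanishes. *)
  assert (Z : forall t r u rho s, in_dom D t r u rho s ->
    d_t G t r u rho s + u * d_r G t r u rho s
    = d_t c t r u rho s - d_r d t r u rho s - N / r * d t r u rho s).
  { intros t r u rho s Hd; pose proof (E4 $ Hd) as X.
    diff DT HGG Hd as e1; diff DR HGG Hd as e2; diff DR HG Hd as e3.
    rewrite e1, e2, e3, (Hc $ Hd), (HG $ Hd) in X.
    coords_neq0 Hd.
    lincomb X; field; auto. }
  assert (Gr : forall t r u rho s, in_dom D t r u rho s -> d_r G t r u rho s = 0).
  { intros t r u rho s Hd; diff DU Z Hd as X; canon Hd X.
    diff DT Gu Hd as e1; diff DR Gu Hd as e2; diff DT cu Hd as e3; diff DR du Hd as e4.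
    rewrite (comm_tu D G) in e1 by assumption; rewrite (comm_ru D G) in e2 by assumption.
    rewrite (comm_tu D c) in e3 by assumption; rewrite (comm_ru D d) in e4 by assumption.
    rewrite e1, e2, e3, e4, (du $ Hd) in X.
    coords_neq0 Hd.
    lincomb X; field; auto. }
  assert (Gt : forall t r u rho s, in_dom D t r u rho s -> d_t G t r u rho s = 0).
  { intros t r u rho s Hd.
    assert (Z' : forall t r u rho s, in_dom D t r u rho s ->
      d_t G t r u rho s = d_t c t r u rho s - d_r d t r u rho s - N / r * d t r u rho s).
    { intros t1 r1 u1 rho1 s1 Hd1; pose proof (Z $ Hd1) as X; rewrite (Gr $ Hd1) in X; lra. }
    diff DRho Z' Hd as X; diff DT Grho Hd as Y.
    diff DT crho Hd as e3; diff DR drho Hd as e4.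
    rewrite (comm_trho D c) in e3 by assumption; rewrite (comm_rrho D d) in e4 by assumption.
    rewrite e3, e4, (drho $ Hd) in X.
    rewrite (comm_trho D G), X in Y by assumption.
    coords_neq0 Hd.
    rewrite <- Y; field; auto. }
  assert (cd : forall t r u rho s, in_dom D t r u rho s ->
    d_t c t r u rho s = d_r d t r u rho s + N / r * d t r u rho s).
  { intros t r u rho s Hd; pose proof (Z $ Hd) as X.
    rewrite (Gr $ Hd), (Gt $ Hd) in X; lra. }
  (* Closedness is [cd] multiplied by [- r^(n-1)]: the [r]-derivative of [r^(n-1) d] is
     [r^(n-1) (d_r + N d / r)]. *)
  destruct (potential_exists D (fun t r u rho s => - (r ^ (n - 1) * c t r u rho s))
     (fun t r u rho s => - (r ^ (n - 1) * d t r u rho s))) as (M & sM & HM).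
  - smooth_tac.
  - smooth_tac.
  - intros t r u rho s Hd; coords_neq0 Hd.
    transitivity (- (r ^ (n - 1) * d_t c t r u rho s)).
    + apply is_derive_unique; eapply is_derive_eq; [der Hd | req; ring].
    + symmetry; apply is_derive_unique; eapply is_derive_eq; [der Hd | req].
      rewrite (cd $ Hd), (INR_pred n hn); fold N; field; exact hr.
  - intros i t r u rho s h1 h2 Hd; rewrite !partialE.
    split; apply is_derive_unique; destruct i; try congruence; simpl;
      (eapply is_derive_eq; [der Hd | req]);
      rewrite ?(cu $ Hd), ?(crho $ Hd), ?(cs $ Hd),
              ?(du $ Hd), ?(drho $ Hd), ?(ds $ Hd); ring.
  - exists (Integral G (fun _ _ _ _ _ => 0)), (Integral (fun t r u rho s => - c t r u rho s) Psi).
    split; [| split].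
    + split; [| intros t r u rho s Hd; reflexivity].
      rewrite conserved_iff by exact hn; simpl; split; [exact sGG | split; [smooth_tac |]].
      split; intros t r u rho s Hd.
      * transitivity 0; [exact (Derive_const 0 _) | rewrite (Grho $ Hd); ring].
      * transitivity 0; [exact (Derive_const 0 _) | rewrite (Gu $ Hd); ring].
      * transitivity 0; [exact (Derive_const 0 _) | rewrite (Gu $ Hd); ring].
      * rewrite (Gr $ Hd), (Gt $ Hd).
        unfold d_r, d_u; rewrite !Derive_const; ring.
    (* The definition of local triviality weights the density and its [Theta] by [r^(n-1)] but the
       flux not at all, so the potential is divided by the weight. *)
    + exists (fun t r u rho s => M t r u rho s / r ^ (n - 1)); split; [smooth_tac |].
      intros t r u rho s ur rhor sr Hd; coords_neq0 Hd.
      destruct (HM $ Hd) as (m1 & m2 & m3 & m4 & m5).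
      assert (hrn : r ^ (n - 1) <> 0) by (apply pow_nonzero, hr).
      split.
      * assert (W : eq_on D (radial_weight n (fun t r u rho s => M t r u rho s / r ^ (n - 1))) M).
        { intros t1 r1 u1 rho1 s1 Hd1; unfold radial_weight; field.
          apply pow_nonzero, (in_dom_r_neq0 Hd1). }
        unfold Dr.
        rewrite (partial_eq_on D _ _ DR W $ Hd : d_r _ t r u rho s = _),
          (partial_eq_on D _ _ DU W $ Hd : d_u _ t r u rho s = _),
          (partial_eq_on D _ _ DRho W $ Hd : d_rho _ t r u rho s = _),
          (partial_eq_on D _ _ DS W $ Hd : d_s _ t r u rho s = _); simpl.
        rewrite m2, m3, m4, m5; ring.
      * unfold flux, Dt_euler; simpl.
        assert (T1 : d_t (fun t r u rho s => M t r u rho s / r ^ (n - 1)) t r u rho s = - d t r u rho s).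
        { apply is_derive_unique; eapply is_derive_eq; [der Hd | req; rewrite m1; field; exact hrn]. }
        assert (T2 : d_u (fun t r u rho s => M t r u rho s / r ^ (n - 1)) t r u rho s = 0).
        { apply is_derive_unique; eapply is_derive_eq; [der Hd | req; rewrite m3; field; exact hrn]. }
        assert (T3 : d_rho (fun t r u rho s => M t r u rho s / r ^ (n - 1)) t r u rho s = 0).
        { apply is_derive_unique; eapply is_derive_eq; [der Hd | req; rewrite m4; field; exact hrn]. }
        assert (T4 : d_s (fun t r u rho s => M t r u rho s / r ^ (n - 1)) t r u rho s = 0).
        { apply is_derive_unique; eapply is_derive_eq; [der Hd | req; rewrite m5; field; exact hrn]. }
        rewrite T1, T2, T3, T4, (HG $ Hd); ring.
    + intros t r u rho s Hd; simpl; fold Phi Psi; split; [rewrite (HGG $ Hd) |]; ring.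
Qed.

(** The density of [A - B] is free of [U], so this difference is equivalent to zero. *)
Lemma equivalent_of_density_u n D p A B : (1 < n)%nat -> smooth D (state_fun p) ->
  conserved n D p A -> conserved n D p B ->
  (forall t r u rho s, in_dom D t r u rho s ->
    d_u (density A) t r u rho s = d_u (density B) t r u rho s) ->
  equivalent n D p A B.
Proof.
  intros hn sp HA HB Hu.
  destruct (equivalent_izero n D p (iadd (iscale 1 A) (iscale (-1) B))) as (I & T & HI & HT & H).
  - exact hn.
  - exact sp.
  - apply conserved_lin; assumption.
  - intros t r u rho s Hd; simpl.
    pose proof (proj1 HA) as sA; pose proof (proj1 HB) as sB.
    apply is_derive_unique; eapply is_derive_eq; [der Hd | req; rewrite (Hu $ Hd); ring].
  - exists I, T; split; [exact HI | split; [exact HT |]].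
    intros t r u rho s Hd; destruct (H $ Hd) as [e1 e2]; simpl in e1, e2; split; lra.
Qed.

(** An integral invariant satisfies [p_rho Phi_U = p_S Phi_U = 0], and genericity of one factor
    gives [Phi_U = 0]. For a locally trivial integral the density does not contain [U_r], which
    forces [Theta_U = 0]. *)
Lemma density_u_of_equivalent n D p A B : (1 < n)%nat -> smooth D (state_fun p) ->
  generic D (p_rho p) \/ generic D (p_s p) ->
  smooth D (density B) -> equivalent n D p A B ->
  forall t r u rho s, in_dom D t r u rho s ->
    d_u (density A) t r u rho s = d_u (density B) t r u rho s.
Proof.
  intros hn sp Gp sB (I & T & (HI & HI0) & (Th & sTh & HT) & H).
  rewrite conserved_iff in HI by exact hn; destruct HI as (sI & _ & [_ I2 I3 _]).
  assert (Iu : forall t r u rho s, in_dom D t r u rho s -> d_u (density I) t r u rho s = 0).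
  { destruct Gp as [Gp|Gp].
    - apply (generic_cancel D _ _ Gp); [smooth_tac |]; intros t r u rho s Hd.
      coords_neq0 Hd.
      assert (X : d_rho (moving_flux I) t r u rho s = 0).
      { rewrite (partial_eq_on D _ (fun _ _ _ _ _ => 0) DRho HI0 $ Hd
          : d_rho _ t r u rho s = _); exact (Derive_const 0 _). }
      rewrite (I2 $ Hd) in X; unfold d_rho at 1, state_fun in X; fold (p_rho p rho s) in X.
      lincomb (rho * X)%eqn; field; exact hrho.
    - apply (generic_cancel D _ _ Gp); [smooth_tac |]; intros t r u rho s Hd.
      coords_neq0 Hd.
      assert (X : d_s (moving_flux I) t r u rho s = 0).
      { rewrite (partial_eq_on D _ (fun _ _ _ _ _ => 0) DS HI0 $ Hd
          : d_s _ t r u rho s = _); exact (Derive_const 0 _). }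
      rewrite (I3 $ Hd) in X; unfold d_s at 1, state_fun in X; fold (p_s p rho s) in X.
      lincomb (rho * X)%eqn; field; exact hrho. }
  pose (W := radial_weight n Th).
  assert (sW : smooth D W) by (unfold W, radial_weight; smooth_tac).
  assert (Wu : forall t r u rho s, in_dom D t r u rho s -> d_u W t r u rho s = 0).
  { intros t r u rho s Hd.
    destruct (HT _ _ _ _ _ 1 0 0 Hd) as [e1 _]; destruct (HT _ _ _ _ _ 0 0 0 Hd) as [e2 _].
    fold W in e1, e2; unfold Dr in e1, e2; lra. }
  assert (HW : forall t r u rho s, in_dom D t r u rho s ->
    density A t r u rho s = density B t r u rho s + density I t r u rho s + d_r W t r u rho s / r ^ (n - 1)).
  { intros t r u rho s Hd; coords_neq0 Hd.
    destruct (H $ Hd) as [e _]; rewrite e.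
    destruct (HT _ _ _ _ _ 0 0 0 Hd) as [e2 _]; fold W in e2; unfold Dr in e2.
    apply Rmult_eq_reg_l with (r ^ (n - 1)); [| apply pow_nonzero, hr].
    lincomb e2; field; apply pow_nonzero, hr. }
  clearbody W.
  intros t r u rho s Hd.
  rewrite (partial_eq_on D _ _ DU HW $ Hd : d_u _ t r u rho s = _); simpl.
  diff DR Wu Hd as X; rewrite (comm_ru D W) in X by assumption.
  coords_neq0 Hd.
  apply is_derive_unique; eapply is_derive_eq; [der Hd | req].
  rewrite X, (Iu $ Hd); field; apply pow_nonzero, hr.
Qed.

(** * The special conserved integrals *)

(** [eb] and [K] are only given as antiderivatives; their smoothness is inherited from the
    integrand. The integrand is a [kfun] because that is the form in which its smoothness is
    known. *)
Lemma smooth_primitive D i (g : R -> R) (dg : kfun) :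
  (forall t r u rho s, in_dom D t r u rho s ->
    is_derive g (coord i t r u rho s) (dg t r u rho s)) ->
  smooth D dg -> smooth D (fun t r u rho s => g (coord i t r u rho s)).
Proof.
  intros Hg sdg.
  apply smooth_of_partials with
    (fun j => match i, j with
       | DT, DT | DR, DR | DU, DU | DRho, DRho | DS, DS => dg | _, _ => fun _ _ _ _ _ => 0 end).
  - intros t r u rho s Hd.
    apply continuous_ext with (fun x => g (app5 (coord i) x)); [intros [[[[? ?] ?] ?] ?]; reflexivity |].
    apply continuous_comp; [apply (cont_coord D i), Hd |].
    apply (@ex_derive_continuous R_AbsRing R_NormedModule); eexists; apply (Hg $ Hd).
  - intros j t r u rho s Hd; pose proof (Hg $ Hd) as X.
    destruct i, j; simpl in *; first [exact X | apply is_derive_Rconst].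
  - intros j; destruct i, j; try exact sdg; apply smooth_const.
Qed.

Ltac compute_partial Hd lhs g x :=
  let E := fresh in let l := fresh in
  evar (l : R);
  assert (E : lhs = l) by (subst l; apply (is_derive_unique g x); der Hd);
  rewrite E; subst l; clear E.

Ltac compute_partials Hd :=
  repeat match goal with
  | |- context [d_t ?f ?t ?r ?u ?rho ?s] =>
      lazymatch f with (fun _ => _) => compute_partial Hd (d_t f t r u rho s) (fun x => f x r u rho s) t end
  | |- context [d_r ?f ?t ?r ?u ?rho ?s] =>
      lazymatch f with (fun _ => _) => compute_partial Hd (d_r f t r u rho s) (fun x => f t x u rho s) r end
  | |- context [d_u ?f ?t ?r ?u ?rho ?s] =>
      lazymatch f with (fun _ => _) => compute_partial Hd (d_u f t r u rho s) (fun x => f t r x rho s) u end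
  | |- context [d_rho ?f ?t ?r ?u ?rho ?s] =>
      lazymatch f with (fun _ => _) => compute_partial Hd (d_rho f t r u rho s) (fun x => f t r u x s) rho end
  | |- context [d_s ?f ?t ?r ?u ?rho ?s] =>
      lazymatch f with (fun _ => _) => compute_partial Hd (d_s f t r u rho s) (fun x => f t r u rho x) s end
  end.

Section Integrals.
Variables (n : nat) (D : box) (p : R -> R -> R).
Hypothesis hn : (1 < n)%nat.
Hypothesis sp : smooth D (state_fun p).

Let N_pos : 0 < INR n - 1.
Proof. apply lt_INR in hn; simpl in hn; lra. Qed.

Lemma energy_conserved e : internal_energy D p e -> conserved n D p (energy p e).
Proof.
  intros [se He].
  assert (Erho : forall t r u rho s, in_dom D t r u rho s ->
    d_rho (state_fun e) t r u rho s = state_fun p t r u rho s / rho ^ 2).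
  { intros t r u rho s Hd; apply is_derive_unique, He; apply Hd. }
  apply conserved_iff; [exact hn | unfold energy; simpl].
  change (smooth D (fun t r u rho s => rho * (u ^ 2 / 2 + state_fun e t r u rho s)) /\
    smooth D (fun t r u rho s => state_fun p t r u rho s * u) /\
    determining_equations (INR n - 1) D p
      (fun t r u rho s => rho * (u ^ 2 / 2 + state_fun e t r u rho s))
      (fun t r u rho s => state_fun p t r u rho s * u)).
  split; [smooth_tac | split; [smooth_tac |]].
  pose proof (state_only_state_fun D p sp) as Sp; pose proof (state_only_state_fun D e se) as Se.
  split; intros t r u rho s Hd;
    coords_neq0 Hd;
    compute_partials Hd;
    rewrite ?(so_t Sp $ Hd), ?(so_r Sp $ Hd), ?(so_u Sp $ Hd),
      ?(so_t Se $ Hd), ?(so_r Se $ Hd), ?(so_u Se $ Hd),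
      ?(Erho $ Hd); field; auto.
Qed.

Lemma energy_density_u e t r u rho s : d_u (density (energy p e)) t r u rho s = rho * u.
Proof.
  apply is_derive_unique; simpl; auto_derive; [exact I | field].
Qed.

Lemma energy_flux_nonzero e : ~ eos_constant D p -> ~ vanishes D (moving_flux (energy p e)).
Proof.
  intros hc H; apply hc; exists 0; intros rho s h1 h2.
  destruct (box_inhabited D) as (t & r & u & _ & _ & h3 & h4 & h5 & _ & _).
  assert (Hd : in_dom D t r u rho s) by (unfold in_dom; tauto).
  assert (H' : forall t r u rho s, in_dom D t r u rho s -> state_fun p t r u rho s * u = 0) by exact H.
  diff DU H' Hd as E; rewrite (so_u (state_only_state_fun D p sp)) in E by exact Hd.
  unfold state_fun in E; lra.
Qed.

(** Together with the next two identities this removes the real powers of [rho], so that the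
    conservation laws become rational identities in [p - p0]. *)
Lemma polytropic_p_rho kappa p0 : polytropic_with n D p kappa p0 ->
  forall t r u rho s, in_dom D t r u rho s ->
  rho * d_rho (state_fun p) t r u rho s = (1 + 2 / INR n) * (state_fun p t r u rho s - p0).
Proof.
  intros Hp t r u rho s Hd.
  pose proof Hd as (_ & _ & _ & hrho & hs).
  pose proof (dom_rho_pos D rho hrho) as hpos.
  set (g := 1 + 2 / INR n) in *.
  assert (E : d_rho (state_fun p) t r u rho s = kappa s * (g * Rpower rho (g - 1))).
  { apply is_derive_unique.
    apply is_derive_ext_loc with (fun x => kappa s * Rpower x g + p0).
    - generalize (open_interval_locally _ _ (dom_rho_open D) hrho); apply filter_imp.
      intros x hx; symmetry; apply Hp; assumption.
    - eapply is_derive_eq.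
      + apply is_derive_Rplus; [| apply is_derive_Rconst].
        apply is_derive_Rmult; [apply is_derive_Rconst |].
        apply is_derive_Reals, derivable_pt_lim_power, hpos.
      + req; cbv beta; ring. }
  rewrite E; unfold state_fun; rewrite (Hp rho s hrho hs); fold g.
  replace (Rpower rho g) with (rho * Rpower rho (g - 1)); [ring |].
  rewrite <- (Rpower_1 rho) at 1 by exact hpos; rewrite <- Rpower_plus; f_equal; ring.
Qed.

Lemma polytropic_p_eq kappa p0 : polytropic_with n D p kappa p0 ->
  forall t r u rho s, in_dom D t r u rho s ->
  polytropic_p n kappa rho s = state_fun p t r u rho s - p0.
Proof.
  intros Hp t r u rho s (_ & _ & _ & hrho & hs).
  unfold polytropic_p, state_fun; rewrite (Hp rho s hrho hs); ring.
Qed.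

Lemma polytropic_e_eq kappa p0 : polytropic_with n D p kappa p0 ->
  forall t r u rho s, in_dom D t r u rho s ->
  polytropic_e n kappa rho s = INR n / 2 * (state_fun p t r u rho s - p0) / rho.
Proof.
  intros Hp t r u rho s Hd.
  rewrite <- (polytropic_p_eq kappa p0 Hp $ Hd).
  pose proof Hd as (_ & _ & _ & hrho & hs).
  pose proof (dom_rho_pos D rho hrho) as hpos.
  unfold polytropic_p, polytropic_e.
  rewrite Rpower_plus, Rpower_1 by exact hpos; field; lra.
Qed.

(* The energy, dilational energy and similarity energy of the gas with pressure
   [p - p0] are the cases (1, 0, 0), (0, 1, 0), (0, 0, 1). *)
Definition special_density (p0 b0 b1 b2 : R) : kfun := fun t r u rho s =>
  (b0 + b1 * t + b2 * t ^ 2) * (rho * (u ^ 2 / 2) + INR n / 2 * (state_fun p t r u rho s - p0))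
  - (b1 + 2 * b2 * t) * r * rho * u / 2 + b2 * r ^ 2 * rho / 2.
Definition special_flux (p0 b0 b1 b2 : R) : kfun := fun t r u rho s =>
  ((b0 + b1 * t + b2 * t ^ 2) * u - (b1 + 2 * b2 * t) * r / 2) * (state_fun p t r u rho s - p0).

Lemma special_flux_vanishes p0 b0 b1 b2 : ~ eos_constant D p ->
  vanishes D (special_flux p0 b0 b1 b2) -> b1 = 0 /\ b2 = 0.
Proof.
  intros hc H0; unfold vanishes, special_flux in H0.
  pose proof (state_only_state_fun D p sp) as Sp.
  assert (H1 : forall t r u rho s, in_dom D t r u rho s ->
    (b0 + b1 * t + b2 * t ^ 2) * (state_fun p t r u rho s - p0) = 0).
  { intros t r u rho s Hd; diff DU H0 Hd as E; rewrite (so_u Sp) in E by exact Hd.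
    rewrite <- E; field. }
  assert (H2 : forall t r u rho s, in_dom D t r u rho s ->
    (b1 + 2 * b2 * t) * (state_fun p t r u rho s - p0) = 0).
  { intros t r u rho s Hd; diff DT H1 Hd as E; rewrite (so_t Sp) in E by exact Hd.
    rewrite <- E; ring. }
  apply NNPP; intros hb; apply hc; exists p0; intros rho s h1 h2.
  destruct (box_inhabited D) as (t & r & u & _ & _ & h3 & h4 & h5 & _ & _).
  assert (Hd : in_dom D t r u rho s) by (unfold in_dom; tauto).
  diff DT H2 Hd as E; rewrite (so_t Sp) in E by exact Hd.
  pose proof (H2 $ Hd) as E2; unfold state_fun in *.
  apply NNPP; intros hn0; apply hb.
  assert (b2 = 0) by (apply Rmult_eq_reg_r with (p rho s - p0); lra).
  subst b2; split; [apply Rmult_eq_reg_r with (p rho s - p0); lra | reflexivity].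
Qed.

Section Polytropic.
Variables (kappa : R -> R) (p0 : R).
Hypothesis Hp : polytropic_with n D p kappa p0.

Lemma special_conserved b0 b1 b2 :
  conserved n D p (Integral (special_density p0 b0 b1 b2) (special_flux p0 b0 b1 b2)).
Proof.
  apply conserved_iff; [exact hn | simpl; unfold special_density, special_flux].
  split; [smooth_tac | split; [smooth_tac |]].
  pose proof (state_only_state_fun D p sp) as Sp.
  assert (Prho : forall t r u rho s, in_dom D t r u rho s ->
    d_rho (state_fun p) t r u rho s = (1 + 2 / INR n) * (state_fun p t r u rho s - p0) / rho).
  { intros t r u rho s Hd; rewrite <- (polytropic_p_rho kappa p0 Hp $ Hd).
    field; apply (in_dom_rho_neq0 Hd). }
  split; intros t r u rho s Hd; coords_neq0 Hd; compute_partials Hd;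
    rewrite ?(so_t Sp $ Hd), ?(so_r Sp $ Hd), ?(so_u Sp $ Hd), ?(Prho $ Hd);
    field; repeat split; auto; lra.
Qed.

Lemma dilational_eq :
  eq_on D (special_density p0 0 1 0) (density (dilational_energy n kappa)) /\
  eq_on D (special_flux p0 0 1 0) (moving_flux (dilational_energy n kappa)).
Proof.
  split; intros t r u rho s Hd; unfold special_density, special_flux; simpl.
  - rewrite (polytropic_e_eq kappa p0 Hp $ Hd); field; apply (in_dom_rho_neq0 Hd).
  - rewrite (polytropic_p_eq kappa p0 Hp $ Hd); field.
Qed.

Lemma similarity_eq :
  eq_on D (special_density p0 0 0 1) (density (similarity_energy n kappa)) /\
  eq_on D (special_flux p0 0 0 1) (moving_flux (similarity_energy n kappa)).
Proof.
  split; intros t r u rho s Hd; unfold special_density, special_flux; simpl.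
  - rewrite (polytropic_e_eq kappa p0 Hp $ Hd); field; apply (in_dom_rho_neq0 Hd).
  - rewrite (polytropic_p_eq kappa p0 Hp $ Hd); field.
Qed.

Lemma dilational_conserved : conserved n D p (dilational_energy n kappa).
Proof.
  exact (conserved_ext n D p (Integral (special_density p0 0 1 0) (special_flux p0 0 1 0)) (dilational_energy n kappa)
    hn (proj1 dilational_eq) (proj2 dilational_eq) (special_conserved 0 1 0)).
Qed.

Lemma similarity_conserved : conserved n D p (similarity_energy n kappa).
Proof.
  exact (conserved_ext n D p (Integral (special_density p0 0 0 1) (special_flux p0 0 0 1)) (similarity_energy n kappa)
    hn (proj1 similarity_eq) (proj2 similarity_eq) (special_conserved 0 0 1)).
Qed.

Lemma dilational_density_u t r u rho s :
  d_u (density (dilational_energy n kappa)) t r u rho s = t * rho * u - r * rho / 2.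
Proof. apply is_derive_unique; simpl; auto_derive; [exact I | field]. Qed.

Lemma similarity_density_u t r u rho s :
  d_u (density (similarity_energy n kappa)) t r u rho s = t ^ 2 * rho * u - t * r * rho.
Proof. apply is_derive_unique; simpl; auto_derive; [exact I | field]. Qed.

Lemma dilational_flux_nonzero : ~ eos_constant D p ->
  ~ vanishes D (moving_flux (dilational_energy n kappa)).
Proof.
  intros hc H; destruct (special_flux_vanishes p0 0 1 0 hc) as [h _]; [| lra].
  intros t r u rho s Hd; rewrite (proj2 dilational_eq $ Hd); apply H, Hd.
Qed.

Lemma similarity_flux_nonzero : ~ eos_constant D p ->
  ~ vanishes D (moving_flux (similarity_energy n kappa)).
Proof.
  intros hc H; destruct (special_flux_vanishes p0 0 0 1 hc) as [_ h]; [| lra].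
  intros t r u rho s Hd; rewrite (proj2 similarity_eq $ Hd); apply H, Hd.
Qed.

End Polytropic.

Section Barotropic.
Variables (P eb : R -> R).
Hypothesis Hp : barotropic_with D p P.
Hypothesis He : forall rho, dom_rho D rho -> is_derive eb rho (P rho / rho ^ 2).

Lemma barotropic_p_s t r u rho s : in_dom D t r u rho s -> d_s (state_fun p) t r u rho s = 0.
Proof.
  intros (_ & _ & _ & hrho & hs); apply is_derive_unique.
  apply is_derive_ext_loc with (fun _ => P rho); [| apply is_derive_Rconst].
  generalize (open_interval_locally _ _ (dom_s_open D) hs); apply filter_imp.
  intros x hx; symmetry; apply Hp; assumption.
Qed.

Let ebk : kfun := fun t r u rho s => eb (coord DRho t r u rho s).

Let ebk_smooth : smooth D ebk.
Proof.
  apply (smooth_primitive D DRho eb (fun t r u rho s => state_fun p t r u rho s / rho ^ 2)).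
  - intros t r u rho s (_ & _ & _ & hrho & hs); simpl; unfold state_fun.
    rewrite (Hp rho s hrho hs); apply He, hrho.
  - smooth_tac; intros ? ? ? ? ? Hd; apply pow_nonzero, (in_dom_rho_neq0 Hd).
Qed.

Lemma enthalpy_conserved : conserved n D p (enthalpy_flux n P eb).
Proof.
  apply (conserved_ext n D p (Integral (fun t r u rho s => u / r ^ (n - 1))
    (fun t r u rho s => (ebk t r u rho s + state_fun p t r u rho s / rho - u ^ 2 / 2) / r ^ (n - 1))) _ hn).
  - intros t r u rho s _; reflexivity.
  - intros t r u rho s (_ & _ & _ & hrho & hs); unfold ebk, state_fun; simpl; rewrite (Hp rho s hrho hs); reflexivity.
  - apply conserved_iff; [exact hn | simpl].
    split; [smooth_tac | split; [smooth_tac |]].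
    pose proof (state_only_state_fun D p sp) as Sp.
    assert (e1 : forall t r u rho s, in_dom D t r u rho s -> d_rho ebk t r u rho s = state_fun p t r u rho s / rho ^ 2).
    { intros t r u rho s (_ & _ & _ & hrho & hs); apply is_derive_unique; unfold state_fun.
      rewrite (Hp rho s hrho hs); apply He, hrho. }
    assert (e2 : forall t r u rho s, d_t ebk t r u rho s = 0) by (intros; apply (Derive_const (eb rho))).
    assert (e3 : forall t r u rho s, d_r ebk t r u rho s = 0) by (intros; apply (Derive_const (eb rho))).
    assert (e4 : forall t r u rho s, d_u ebk t r u rho s = 0) by (intros; apply (Derive_const (eb rho))).
    assert (e5 : forall t r u rho s, d_s ebk t r u rho s = 0) by (intros; apply (Derive_const (eb rho))).
    split; intros t r u rho s Hd;
      coords_neq0 Hd;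
      assert (hrn : r ^ (n - 1) <> 0) by (apply pow_nonzero, hr);
      compute_partials Hd;
      rewrite ?(so_t Sp $ Hd), ?(so_r Sp $ Hd), ?(so_u Sp $ Hd),
        ?(barotropic_p_s $ Hd), ?(e1 $ Hd), ?e2, ?e3, ?e4, ?e5, ?(INR_pred n hn);
      field; repeat split; auto; lra.
Qed.

Lemma enthalpy_density_u t r u rho s :
  d_u (density (enthalpy_flux n P eb)) t r u rho s = / r ^ (n - 1).
Proof.
  apply is_derive_unique; simpl.
  apply is_derive_ext with (fun x => / r ^ (n - 1) * x); [intros; unfold Rdiv; apply Rmult_comm |].
  eapply is_derive_eq; [apply is_derive_Rmult; [apply is_derive_Rconst | apply is_derive_Rid] | req; ring].
Qed.

(** The term [- U^2 / 2] survives two [U]-derivatives whatever the pressure is. *)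
Lemma enthalpy_flux_nonzero : ~ vanishes D (moving_flux (enthalpy_flux n P eb)).
Proof.
  intros H; destruct (box_inhabited D) as (t & r & u & rho & s & Hd).
  assert (H1 : forall t r u rho s, in_dom D t r u rho s ->
    ebk t r u rho s + state_fun p t r u rho s / rho - u * u / 2 = 0).
  { intros t1 r1 u1 rho1 s1 Hd1; pose proof (H $ Hd1) as E; simpl in E.
    pose proof (in_dom_r_neq0 Hd1) as hr.
    assert (hrn : r1 ^ (n - 1) <> 0) by (apply pow_nonzero, hr).
    destruct Hd1 as (_ & _ & _ & hrho & hs); unfold ebk, state_fun; simpl; rewrite (Hp rho1 s1 hrho hs).
    lincomb (r1 ^ (n - 1) * E)%eqn; field; split; [apply Rgt_not_eq, (dom_rho_pos D), hrho | exact hrn]. }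
  pose proof (state_only_state_fun D p sp) as Sp.
  assert (H2 : forall t r u rho s, in_dom D t r u rho s -> - u = 0).
  { intros t1 r1 u1 rho1 s1 Hd1.
    diff DU H1 Hd1 as E; rewrite (so_u Sp) in E by exact Hd1.
    assert (e4 : d_u ebk t1 r1 u1 rho1 s1 = 0) by (apply (Derive_const (eb rho1))).
    rewrite e4 in E; pose proof (in_dom_rho_neq0 Hd1).
    rewrite <- E; field; auto. }
  diff DU H2 Hd as E; lra.
Qed.

End Barotropic.

Section Entropic.
Variables (kappa F K : R -> R).
Hypothesis Hp : entropic_with D p kappa.
Hypothesis HF : entropy_weight D kappa F K.

Lemma entropic_p_s t r u rho s : in_dom D t r u rho s -> d_s (state_fun p) t r u rho s = Derive kappa s.
Proof.
  intros (_ & _ & _ & hrho & hs); apply Derive_ext_loc.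
  generalize (open_interval_locally _ _ (dom_s_open D) hs); apply filter_imp.
  intros x hx; apply Hp; assumption.
Qed.

Lemma entropic_p_rho t r u rho s : in_dom D t r u rho s -> d_rho (state_fun p) t r u rho s = 0.
Proof.
  intros (_ & _ & _ & hrho & hs); apply is_derive_unique.
  apply is_derive_ext_loc with (fun _ => kappa s); [| apply is_derive_Rconst].
  generalize (open_interval_locally _ _ (dom_rho_open D) hrho); apply filter_imp.
  intros x hx; symmetry; apply Hp; assumption.
Qed.

Let Fk : kfun := state_fun (fun _ s => F s).
Let Kk : kfun := fun t r u rho s => K (coord DS t r u rho s).
Let sFk : smooth D Fk := proj1 HF.

Let HK t r u rho s : in_dom D t r u rho s ->
  is_derive K s (Fk t r u rho s * d_s (state_fun p) t r u rho s).
Proof.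
  intros Hd; rewrite (entropic_p_s $ Hd); apply (proj2 HF), Hd.
Qed.

Let sKk : smooth D Kk.
Proof.
  apply (smooth_primitive D DS K (fun t r u rho s => Fk t r u rho s * d_s (state_fun p) t r u rho s)).
  - intros; apply HK; assumption.
  - smooth_tac.
Qed.

Lemma weighted_conserved : conserved n D p (weighted_energy F K).
Proof.
  apply conserved_iff; [exact hn |].
  change (smooth D (fun t r u rho s => rho * u ^ 2 * Fk t r u rho s / 2 - Kk t r u rho s) /\
    smooth D (fun t r u rho s => u * Kk t r u rho s) /\
    determining_equations (INR n - 1) D p
      (fun t r u rho s => rho * u ^ 2 * Fk t r u rho s / 2 - Kk t r u rho s)
      (fun t r u rho s => u * Kk t r u rho s)).
  split; [smooth_tac | split; [smooth_tac |]].
  assert (e1 : forall t r u rho s, in_dom D t r u rho s ->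
    d_s Kk t r u rho s = Fk t r u rho s * d_s (state_fun p) t r u rho s).
  { intros; apply is_derive_unique, HK; assumption. }
  assert (e2 : forall t r u rho s, d_t Kk t r u rho s = 0) by (intros; apply (Derive_const (K s))).
  assert (e3 : forall t r u rho s, d_r Kk t r u rho s = 0) by (intros; apply (Derive_const (K s))).
  assert (e4 : forall t r u rho s, d_u Kk t r u rho s = 0) by (intros; apply (Derive_const (K s))).
  assert (e5 : forall t r u rho s, d_rho Kk t r u rho s = 0) by (intros; apply (Derive_const (K s))).
  assert (f2 : forall t r u rho s, d_t Fk t r u rho s = 0) by (intros; apply (Derive_const (F s))).
  assert (f3 : forall t r u rho s, d_r Fk t r u rho s = 0) by (intros; apply (Derive_const (F s))).
  assert (f4 : forall t r u rho s, d_u Fk t r u rho s = 0) by (intros; apply (Derive_const (F s))).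
  assert (f5 : forall t r u rho s, d_rho Fk t r u rho s = 0) by (intros; apply (Derive_const (F s))).
  split; intros t r u rho s Hd;
    coords_neq0 Hd;
    compute_partials Hd;
    rewrite ?(entropic_p_rho $ Hd), ?(e1 $ Hd), ?e2, ?e3, ?e4, ?e5, ?f2, ?f3, ?f4, ?f5;
    field; repeat split; auto; lra.
Qed.

Lemma weighted_density_u t r u rho s :
  d_u (density (weighted_energy F K)) t r u rho s = rho * u * F s.
Proof. apply is_derive_unique; simpl; auto_derive; [exact I | field]. Qed.

(** [K = 0] would give [F kappa' = 0] and then [F = 0] by genericity, against [F] being
    non-constant. *)
Lemma weighted_flux_nonzero : generic D (p_s p) -> nonconstant_on (dom_s D) F ->
  ~ vanishes D (moving_flux (weighted_energy F K)).
Proof.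
  intros Gs (x & y & hx & hy & hxy) H.
  assert (K0 : forall t r u rho s, in_dom D t r u rho s -> Kk t r u rho s = 0).
  { assert (H1 : forall t r u rho s, in_dom D t r u rho s -> u * Kk t r u rho s = 0) by exact H.
    intros t r u rho s Hd; diff DU H1 Hd as E.
    assert (e4 : d_u Kk t r u rho s = 0) by (apply (Derive_const (K s))).
    rewrite e4 in E; lra. }
  assert (F0 : forall t r u rho s, in_dom D t r u rho s -> Fk t r u rho s = 0).
  { apply (generic_cancel D _ _ Gs sFk); intros t r u rho s Hd.
    diff DS K0 Hd as E.
    rewrite (is_derive_unique _ _ _ (HK $ Hd) : d_s Kk t r u rho s = _) in E.
    rewrite Rmult_comm; exact E. }
  destruct (box_inhabited D) as (t & r & u & rho & s & h1 & h2 & h3 & h4 & _).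
  apply hxy; transitivity 0.
  - apply (F0 t r u rho x); unfold in_dom; tauto.
  - symmetry; apply (F0 t r u rho y); unfold in_dom; tauto.
Qed.

End Entropic.

End Integrals.

(** * Classification *)

Lemma smooth_lin_comb D cs As : (forall A, In A As -> smooth D (density A)) ->
  smooth D (density (lin_comb cs As)).
Proof.
  revert cs; induction As as [|A As IH]; intros [|c cs] H;
    try (unfold lin_comb; simpl; apply smooth_const).
  change (smooth D (fun t r u rho s => c * density A t r u rho s + density (lin_comb cs As) t r u rho s)).
  assert (smooth D (density A)) by (apply H; left; reflexivity).
  assert (smooth D (density (lin_comb cs As))) by (apply IH; intros B HB; apply H; right; exact HB).
  smooth_tac.
Qed.

Lemma density_u_lin_comb_cons D c cs A As t r u rho s :
  (forall B, In B (A :: As) -> smooth D (density B)) -> in_dom D t r u rho s ->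
  d_u (density (lin_comb (c :: cs) (A :: As))) t r u rho s
  = c * d_u (density A) t r u rho s + d_u (density (lin_comb cs As)) t r u rho s.
Proof.
  intros H Hd.
  assert (smooth D (density A)) by (apply H; left; reflexivity).
  assert (smooth D (density (lin_comb cs As))).
  { apply smooth_lin_comb; intros B HB; apply H; right; exact HB. }
  change (d_u (fun t r u rho s => c * density A t r u rho s + density (lin_comb cs As) t r u rho s) t r u rho s
    = c * d_u (density A) t r u rho s + d_u (density (lin_comb cs As)) t r u rho s).
  compute_partials Hd; ring.
Qed.

(** Among conserved integrals equivalence amounts to equality of [Phi_U], so spanning and
    independence become linear algebra with the functions [Phi_U] on the box. *)
Lemma classified_intro n D p As : (1 < n)%nat -> smooth D (state_fun p) ->
  generic D (p_rho p) \/ generic D (p_s p) ->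
  (forall A, In A As -> conserved n D p A /\ ~ vanishes D (moving_flux A)) ->
  (forall A, conserved n D p A -> exists cs, length cs = length As /\
     forall t r u rho s, in_dom D t r u rho s ->
       d_u (density A) t r u rho s = d_u (density (lin_comb cs As)) t r u rho s) ->
  (forall cs, length cs = length As ->
     (forall t r u rho s, in_dom D t r u rho s -> d_u (density (lin_comb cs As)) t r u rho s = 0) ->
     forall c, In c cs -> c = 0) ->
  classified_by n D p As.
Proof.
  intros hn sp Gp H1 H2 H3; split; [exact H1 | split].
  - intros A HA; destruct (H2 A HA) as (cs & hl & Hcs); exists cs; split; [exact hl |].
    apply equivalent_of_density_u; try assumption.
    apply conserved_lin_comb; [exact hn |]; intros B HB; apply H1, HB.
  - intros cs hl He; apply (H3 cs hl); intros t r u rho s Hd.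
    rewrite (density_u_of_equivalent n D p _ izero hn sp Gp (smooth_const D 0) He $ Hd).
    exact (Derive_const 0 _).
Qed.

(* Both conditions together say that [p - rho p_rho / gamma] is a constant, with
   [gamma = 1 + 2 / n]; that constant is [p0]. *)
Lemma polytropic_of_conditions n D p : (1 < n)%nat -> smooth D (state_fun p) ->
  (forall t r u rho s, in_dom D t r u rho s ->
     INR n * rho * d_rho (d_rho (state_fun p)) t r u rho s - 2 * d_rho (state_fun p) t r u rho s = 0 /\
     INR n * rho * d_rho (d_s (state_fun p)) t r u rho s - (INR n + 2) * d_s (state_fun p) t r u rho s = 0) ->
  polytropic n D p.
Proof.
  intros hn sp H.
  assert (hN : 1 < INR n) by (apply lt_INR in hn; simpl in hn; lra).
  pose (q := state_fun p).
  assert (sq : smooth D q) by exact sp.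
  pose proof (state_only_state_fun D p sp) as Sq; fold q in Sq, H.
  pose (f := fun t r u rho s => q t r u rho s - INR n / (INR n + 2) * (rho * d_rho q t r u rho s)).
  assert (sf : smooth D f).
  { unfold f; smooth_tac; intros ? ? ? ? ? _; lra. }
  assert (Sf : state_only D f).
  { unfold f; so_tac; intros ? ? ? ? ? _; lra. }
  assert (f0 : forall t r u rho s t' r' u' rho' s', in_dom D t r u rho s -> in_dom D t' r' u' rho' s' ->
    f t r u rho s = f t' r' u' rho' s').
  { apply const_of_partials_zero; [exact sf |].
    intros [] t r u rho s Hd; simpl.
    - apply (so_t Sf), Hd.
    - apply (so_r Sf), Hd.
    - apply (so_u Sf), Hd.
    - destruct (H $ Hd) as [X _]; unfold f; compute_partials Hd.
      lincomb ((- / (INR n + 2)) * X)%eqn; field; lra.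
    - destruct (H $ Hd) as [_ X]; unfold f; compute_partials Hd.
      rewrite (comm_rhos D q) in X by assumption.
      lincomb ((- / (INR n + 2)) * X)%eqn; field; lra. }
  destruct (box_inhabited D) as (t0 & r0 & u0 & rho0 & s0 & Hd0).
  pose (p0 := f t0 r0 u0 rho0 s0).
  (* The coefficient is read off at [rho0]: once [p - p0 = rho p_rho / gamma], the product of
     [p - p0] with [rho^(- gamma)] does not depend on [rho]. *)
  exists (fun s => (p rho0 s - p0) * Rpower rho0 (- (1 + 2 / INR n))), p0.
  intros rho s hrho hs.
  assert (dom : forall x, dom_rho D x -> in_dom D t0 r0 u0 x s) by (intros; unfold in_dom in *; tauto).
  assert (E : (p rho s - p0) * Rpower rho (- (1 + 2 / INR n)) = (p rho0 s - p0) * Rpower rho0 (- (1 + 2 / INR n))).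
  { apply (const_of_derive_zero (dom_rho D) (fun x => (p x s - p0) * Rpower x (- (1 + 2 / INR n))));
      [apply dom_rho_open | | exact hrho | apply Hd0].
    intros x hx; pose proof (dom_rho_pos D x hx) as hpos.
    eapply is_derive_eq.
    - apply is_derive_Rmult.
      + apply is_derive_Rminus; [apply (is_derive_d_rho D q t0 r0 u0 x s sq (dom x hx)) | apply is_derive_Rconst].
      + apply is_derive_Reals, derivable_pt_lim_power, hpos.
    - req.
      assert (X : f t0 r0 u0 x s = p0) by (apply f0; [apply dom, hx | exact Hd0]).
      assert (Y : p x s - p0 = INR n / (INR n + 2) * (x * d_rho q t0 r0 u0 x s)).
      { rewrite <- X; unfold f, q, state_fun; ring. }
      rewrite Y.
      replace (Rpower x (- (1 + 2 / INR n))) with (x * Rpower x (- (1 + 2 / INR n) - 1)).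
      + field; lra.
      + rewrite <- (Rpower_1 x) at 1 by exact hpos; rewrite <- Rpower_plus; f_equal; ring. }
  rewrite <- E, Rmult_assoc, <- Rpower_plus, Rplus_opp_l, Rpower_O by (apply (dom_rho_pos D), hrho).
  ring.
Qed.

(** * The form of [Phi_U] for each type of pressure *)

Section Classification.
Variables (n : nat) (D : box) (p : R -> R -> R).
Hypothesis hn : (1 < n)%nat.
Hypothesis sp : smooth D (state_fun p).

Let N_pos : 0 < INR n - 1.
Proof. apply lt_INR in hn; simpl in hn; lra. Qed.

Lemma quotient_by_rho A : smooth D (density A) ->
  smooth D (fun t r u rho s => d_u (density A) t r u rho s / rho) /\
  (forall t r u rho s, in_dom D t r u rho s ->
    d_u (density A) t r u rho s = rho * (d_u (density A) t r u rho s / rho)).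
Proof.
  intros sA; split; [smooth_tac |].
  intros t r u rho s Hd; field; apply (in_dom_rho_neq0 Hd).
Qed.

Lemma special_coefficients A : conserved n D p A -> generic D (p_rho p) ->
  (forall t r u rho s, in_dom D t r u rho s ->
    rho * d_u (d_rho (density A)) t r u rho s = d_u (density A) t r u rho s) ->
  exists b0 b1 b2,
    (forall t r u rho s, in_dom D t r u rho s ->
      d_u (density A) t r u rho s
      = rho * ((b0 + b1 * t + b2 * t ^ 2) * u - (b1 + 2 * b2 * t) * r / 2)) /\
    (polytropic n D p \/ b1 = 0 /\ b2 = 0).
Proof.
  intros HA Gr HQ; rewrite conserved_iff in HA by exact hn; destruct HA as (sF & sG & DE).
  destruct (quotient_by_rho A sF) as [sV HV].
  destruct (special_multiplier (INR n - 1) D p (density A) (moving_flux A) _ N_pos sp sF sG sV HV DE Gr)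
    as (b0 & b1 & b2 & Hb).
  { intros t r u rho s Hd; coords_neq0 Hd.
    rewrite <- (HQ $ Hd); field; assumption. }
  exists b0, b1, b2; split.
  { intros t r u rho s Hd; rewrite (HV $ Hd), (Hb $ Hd); ring. }
  pose proof (polytropic_conditions (INR n - 1) D p (density A) (moving_flux A) _ sp sF sG sV HV DE b0 b1 b2 Hb) as C.
  (* One time with [b1 + 2 b2 t <> 0] suffices, as the conditions on the pressure do not involve
     [t]. If this affine function vanishes on the whole interval, so do both of its coefficients. *)
  destruct (classic (exists t, dom_t D t /\ b1 + 2 * b2 * t <> 0)) as [(t0 & ht0 & hb) | hb].
  - left; apply polytropic_of_conditions; try assumption.
    intros t r u rho s (_ & h2 & h3 & h4 & h5).
    assert (Hd : in_dom D t0 r u rho s) by (unfold in_dom; tauto).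
    destruct (C $ Hd) as [c1 c2].
    apply Rmult_integral in c1; destruct c1 as [c1|c1]; [tauto |].
    apply Rmult_integral in c2; destruct c2 as [c2|c2]; [tauto |].
    split.
    + transitivity ((INR n - 1 + 1) * rho * d_rho (d_rho (state_fun p)) t0 r u rho s
        - 2 * d_rho (state_fun p) t0 r u rho s); [| exact c1].
      change (d_rho (d_rho (state_fun p)) t r u rho s) with (d_rho (d_rho (state_fun p)) t0 r u rho s).
      change (d_rho (state_fun p) t r u rho s) with (d_rho (state_fun p) t0 r u rho s); ring.
    + transitivity ((INR n - 1 + 1) * rho * d_rho (d_s (state_fun p)) t0 r u rho s
        - (INR n - 1 + 3) * d_s (state_fun p) t0 r u rho s); [| exact c2].
      change (d_rho (d_s (state_fun p)) t r u rho s) with (d_rho (d_s (state_fun p)) t0 r u rho s).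
      change (d_s (state_fun p) t r u rho s) with (d_s (state_fun p) t0 r u rho s); ring.
  - right.
    assert (Z : forall t r u rho s, in_dom D t r u rho s -> b1 + 2 * b2 * t = 0).
    { intros t r u rho s Hd; apply NNPP; intros hz; apply hb; exists t; split; [apply Hd | exact hz]. }
    destruct (box_inhabited D) as (t & r & u & rho & s & Hd).
    diff DT Z Hd as E; pose proof (Z $ Hd) as E'.
    assert (b2 = 0) by lra; subst b2; split; lra.
Qed.

Lemma span_generic A : conserved n D p A -> generic D (p_rho p) -> generic D (p_s p) ->
  exists b0 b1 b2,
    (forall t r u rho s, in_dom D t r u rho s ->
      d_u (density A) t r u rho s
      = rho * ((b0 + b1 * t + b2 * t ^ 2) * u - (b1 + 2 * b2 * t) * r / 2)) /\
    (polytropic n D p \/ b1 = 0 /\ b2 = 0).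
Proof.
  intros HA Gr Gs; apply special_coefficients; try assumption.
  rewrite conserved_iff in HA by exact hn; destruct HA as (sF & sG & DE).
  destruct (quotient_by_rho A sF) as [sV HV].
  intros t r u rho s Hd.
  rewrite (multiplier_no_enthalpy (INR n - 1) D p _ _ _ N_pos sp sF sG sV HV DE Gr Gs $ Hd).
  symmetry; apply HV, Hd.
Qed.

Lemma span_barotropic A P eb : conserved n D p A -> generic D (p_rho p) ->
  barotropic_with D p P ->
  (forall rho, dom_rho D rho -> is_derive eb rho (P rho / rho ^ 2)) ->
  exists b0 b1 b2 c,
    (forall t r u rho s, in_dom D t r u rho s ->
      d_u (density A) t r u rho s
      = rho * ((b0 + b1 * t + b2 * t ^ 2) * u - (b1 + 2 * b2 * t) * r / 2) + c / r ^ (n - 1)) /\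
    (polytropic n D p \/ b1 = 0 /\ b2 = 0).
Proof.
  intros HA Gr HP Heb; pose proof HA as HA'.
  rewrite conserved_iff in HA by exact hn; destruct HA as (sF & sG & DE).
  destruct (quotient_by_rho A sF) as [sV HV].
  pose proof (enthalpy_coefficient (INR n - 1) D p _ _ _ N_pos sp sF sG sV HV DE Gr
    (barotropic_p_s D p P HP)) as HQ; cbv zeta in HQ.
  set (Q := fun t r u rho s => rho * (d_u (d_rho (density A)) t r u rho s
    - d_u (density A) t r u rho s / rho)) in HQ.
  assert (sQ : smooth D Q) by (unfold Q; smooth_tac).
  pose (f := fun t r u rho s => r ^ (n - 1) * Q t r u rho s).
  assert (sf : smooth D f) by (unfold f; smooth_tac).
  assert (f0 : forall t r u rho s t' r' u' rho' s', in_dom D t r u rho s -> in_dom D t' r' u' rho' s' ->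
    f t r u rho s = f t' r' u' rho' s').
  { apply const_of_partials_zero; [exact sf |].
    clearbody Q.
    intros i t r u rho s Hd; destruct (HQ $ Hd) as (q1 & q2 & q3 & q4 & q5).
    coords_neq0 Hd.
    destruct i; simpl; unfold f; compute_partials Hd; rewrite ?q1, ?q2, ?q3, ?q4, ?q5, ?(INR_pred n hn);
      field; exact hr. }
  destruct (box_inhabited D) as (t0 & r0 & u0 & rho0 & s0 & Hd0).
  pose (c := f t0 r0 u0 rho0 s0).
  assert (HQc : forall t r u rho s, in_dom D t r u rho s ->
    rho * d_u (d_rho (density A)) t r u rho s - d_u (density A) t r u rho s = c / r ^ (n - 1)).
  { intros t r u rho s Hd; coords_neq0 Hd.
    assert (hrn : r ^ (n - 1) <> 0) by (apply pow_nonzero, hr).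
    unfold c; rewrite <- (f0 _ _ _ _ _ _ _ _ _ _ Hd Hd0); unfold f, Q; field; auto. }
  (* For the enthalpy flux [rho Phi_{U rho} - Phi_U] equals [- 1 / r^(n-1)], so adding it [c] times
     removes the enthalpy part of [A]. *)
  pose (B := iadd (iscale 1 A) (iscale c (enthalpy_flux n P eb))).
  assert (HB : conserved n D p B).
  { apply conserved_lin; try assumption; apply enthalpy_conserved; assumption. }
  assert (Bu : forall t r u rho s, in_dom D t r u rho s ->
    d_u (density B) t r u rho s = d_u (density A) t r u rho s + c / r ^ (n - 1)).
  { intros t r u rho s Hd; unfold B; simpl; compute_partials Hd.
    field; apply pow_nonzero, (in_dom_r_neq0 Hd). }
  destruct (special_coefficients B HB Gr) as (b0 & b1 & b2 & Hb & Hpol).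
  - intros t r u rho s Hd.
    assert (Brho : forall t r u rho s, in_dom D t r u rho s ->
      d_rho (density B) t r u rho s = d_rho (density A) t r u rho s).
    { intros t1 r1 u1 rho1 s1 Hd1; unfold B; simpl; compute_partials Hd1.
      field; apply pow_nonzero, (in_dom_r_neq0 Hd1). }
    rewrite (partial_eq_on D _ _ DU Brho $ Hd : d_u _ t r u rho s = _); cbn [partial].
    rewrite (Bu $ Hd), <- (HQc $ Hd); ring.
  - exists b0, b1, b2, (- c); split; [| exact Hpol].
    intros t r u rho s Hd.
    pose proof (Hb $ Hd) as E; rewrite (Bu $ Hd) in E.
    lincomb E; field; apply pow_nonzero, (in_dom_r_neq0 Hd).
Qed.

Lemma span_entropic A kappa : conserved n D p A -> generic D (p_s p) -> entropic_with D p kappa ->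
  exists F K, entropy_weight D kappa F K /\
    forall t r u rho s, in_dom D t r u rho s ->
      d_u (density A) t r u rho s = rho * u * F s.
Proof.
  intros HA Gs Hk.
  rewrite conserved_iff in HA by exact hn; destruct HA as (sF & sG & DE).
  destruct (quotient_by_rho A sF) as [sV HV].
  set (V := fun t r u rho s => d_u (density A) t r u rho s / rho) in *.
  destruct (entropic_multiplier (INR n - 1) D p _ _ _ N_pos sp sF sG sV HV DE (entropic_p_rho D p kappa Hk) Gs)
    as [VB HB].
  change (forall t r u rho s, in_dom D t r u rho s ->
    d_u (density A) t r u rho s = rho * V t r u rho s) in HV.
  clearbody V.
  destruct (box_inhabited D) as (t0 & r0 & u0 & rho0 & s0 & h1 & h2 & h3 & h4 & h5).
  assert (dom : forall s, dom_s D s -> in_dom D t0 r0 u0 rho0 s) by (intros; unfold in_dom; tauto).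
  assert (sB : smooth D (d_u V)) by smooth_tac.
  assert (HF : forall t r u rho s, in_dom D t r u rho s -> d_u V t r u rho s = d_u V t0 r0 u0 rho0 s).
  { intros t r u rho s Hd; apply (function_of_entropy D); try assumption; apply dom, Hd. }
  (* [K] is [rho Phi_rho - Phi], which is [Psi_U], at a base point. Its [S]-derivative is
     [p_S V_U = kappa' F] by the second equation for [Phi_S]. *)
  exists (fun s => d_u V t0 r0 u0 rho0 s),
    (fun s => - (density A t0 r0 u0 rho0 s - rho0 * d_rho (density A) t0 r0 u0 rho0 s)).
  split; [split |].
  - apply smooth_ext with (d_u V); [intros t r u rho s Hd; apply HF, Hd | exact sB].
  - intros s hs.
    assert (Hd : in_dom D t0 r0 u0 rho0 s) by (apply dom, hs).
    destruct (density_s_equations (INR n - 1) D p _ _ _ sp sF sG sV HV DE $ Hd) as [_ X].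
    rewrite (entropic_p_s D p kappa Hk $ Hd) in X.
    eapply is_derive_eq; [der Hd | req].
    rewrite <- (comm_rhos D (density A)) by assumption; lincomb X; ring.
  - intros t r u rho s Hd; rewrite (HV $ Hd), (VB $ Hd), (HF $ Hd); ring.
Qed.

End Classification.

(** * Transported domains *)

(** Continuity of the first partial derivative and existence of the second give differentiability of
    [G]. The chain rule can thus split off one argument at a time: [l] is again the derivative of a
    composition, with one moving argument less. *)
Lemma is_derive_chain_step (G g : R -> R -> R) (c : R -> R) x0 dc l :
  is_derive c x0 dc ->
  locally (c x0, x0) (fun q => is_derive (fun z => G z (snd q)) (fst q) (g (fst q) (snd q))) ->
  continuous (fun q : R * R => g (fst q) (snd q)) (c x0, x0) ->
  is_derive (fun y => G (c x0) y) x0 l ->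
  is_derive (fun x => G (c x) x) x0 (dc * g (c x0) x0 + l).
Proof.
  intros Hc Hl Hg Hy.
  pose proof (is_derive_filterdiff G (c x0) x0 g l Hl Hy Hg) as FD.
  pose proof (@filterdiff_comp'_2 R_AbsRing R_NormedModule R_NormedModule R_NormedModule R_NormedModule
    c (fun x => x) G x0 (fun y => scal y dc) (fun y => y)
    (fun a b => plus (scal a (g (c x0) x0)) (scal b l)) Hc (filterdiff_id _) FD) as X.
  eapply filterdiff_ext_lin; [exact X |].
  intros y; simpl; unfold plus, scal, mult; simpl; unfold mult; simpl; ring.
Qed.

Lemma is_derive_comp_app5 D F (c1 c2 c3 c4 c5 : R -> R) x l1 l2 l3 l4 l5 :
  smooth D F -> in_dom D (c1 x) (c2 x) (c3 x) (c4 x) (c5 x) ->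
  is_derive c1 x l1 -> is_derive c2 x l2 -> is_derive c3 x l3 -> is_derive c4 x l4 -> is_derive c5 x l5 ->
  is_derive (fun y => F (c1 y) (c2 y) (c3 y) (c4 y) (c5 y)) x
    (l1 * d_t F (c1 x) (c2 x) (c3 x) (c4 x) (c5 x)
     + (l2 * d_r F (c1 x) (c2 x) (c3 x) (c4 x) (c5 x)
     + (l3 * d_u F (c1 x) (c2 x) (c3 x) (c4 x) (c5 x)
     + (l4 * d_rho F (c1 x) (c2 x) (c3 x) (c4 x) (c5 x)
     + l5 * d_s F (c1 x) (c2 x) (c3 x) (c4 x) (c5 x))))).
Proof.
  intros sF Hd H1 H2 H3 H4 H5.
  assert (C : forall (c : R -> R) (l : R), is_derive c x l -> continuous c x).
  { intros c l H; apply (@ex_derive_continuous R_AbsRing R_NormedModule); eexists; exact H. }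
  pose proof (C _ _ H2) as C2; pose proof (C _ _ H3) as C3;
    pose proof (C _ _ H4) as C4; pose proof (C _ _ H5) as C5.
  pose proof Hd as (h1 & h2 & h3 & h4 & h5).
  assert (L2 : locally x (fun y => dom_r D (c2 y))) by (apply C2, open_interval_locally; [apply dom_r_open | exact h2]).
  assert (L3 : locally x (fun y => dom_u D (c3 y))) by (apply C3, open_interval_locally; [apply dom_u_open | exact h3]).
  assert (L4 : locally x (fun y => dom_rho D (c4 y))) by (apply C4, open_interval_locally; [apply dom_rho_open | exact h4]).
  assert (L5 : locally x (fun y => dom_s D (c5 y))) by (apply C5, open_interval_locally; [apply dom_s_open | exact h5]).
  assert (K : forall (c : R -> R) (z : R), continuous c x -> continuous (fun q : R * R => c (snd q)) (z, x)).
  { intros c z Hc; apply (continuous_comp snd c); [apply continuous_snd | exact Hc]. }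
  apply (is_derive_chain_step (fun z y => F z (c2 y) (c3 y) (c4 y) (c5 y))
    (fun z y => d_t F z (c2 y) (c3 y) (c4 y) (c5 y))); [exact H1 | | |].
  { pose proof (locally_pair _ _ _ _ (open_interval_locally _ _ (dom_t_open D) h1)
      (filter_and _ _ L2 (filter_and _ _ L3 (filter_and _ _ L4 L5)))) as L.
    revert L; apply filter_imp; intros [z y] (? & ? & ? & ? & ?).
    apply (is_derive_d_t D); [exact sF | unfold in_dom; simpl in *; tauto]. }
  { refine (continuous_comp_app5 D (d_t F) _ _ _ _ _ _ (smooth_cont _ _ (smooth_d_t _ _ sF)) Hd _ _ _ _ _);
      solve [apply continuous_fst | apply K; assumption]. }
  apply (is_derive_chain_step (fun z y => F (c1 x) z (c3 y) (c4 y) (c5 y))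
    (fun z y => d_r F (c1 x) z (c3 y) (c4 y) (c5 y))); [exact H2 | | |].
  { pose proof (locally_pair _ _ _ _ (open_interval_locally _ _ (dom_r_open D) h2)
      (filter_and _ _ L3 (filter_and _ _ L4 L5))) as L.
    revert L; apply filter_imp; intros [z y] (? & ? & ? & ?).
    apply (is_derive_d_r D); [exact sF | unfold in_dom; simpl in *; tauto]. }
  { refine (continuous_comp_app5 D (d_r F) _ _ _ _ _ _ (smooth_cont _ _ (smooth_d_r _ _ sF)) Hd _ _ _ _ _);
      solve [apply continuous_fst | apply continuous_const | apply K; assumption]. }
  apply (is_derive_chain_step (fun z y => F (c1 x) (c2 x) z (c4 y) (c5 y))
    (fun z y => d_u F (c1 x) (c2 x) z (c4 y) (c5 y))); [exact H3 | | |].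
  { pose proof (locally_pair _ _ _ _ (open_interval_locally _ _ (dom_u_open D) h3) (filter_and _ _ L4 L5)) as L.
    revert L; apply filter_imp; intros [z y] (? & ? & ?).
    apply (is_derive_d_u D); [exact sF | unfold in_dom; simpl in *; tauto]. }
  { refine (continuous_comp_app5 D (d_u F) _ _ _ _ _ _ (smooth_cont _ _ (smooth_d_u _ _ sF)) Hd _ _ _ _ _);
      solve [apply continuous_fst | apply continuous_const | apply K; assumption]. }
  apply (is_derive_chain_step (fun z y => F (c1 x) (c2 x) (c3 x) z (c5 y))
    (fun z y => d_rho F (c1 x) (c2 x) (c3 x) z (c5 y))); [exact H4 | | |].
  { pose proof (locally_pair _ _ _ _ (open_interval_locally _ _ (dom_rho_open D) h4) L5) as L.
    revert L; apply filter_imp; intros [z y] (? & ?).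
    apply (is_derive_d_rho D); [exact sF | unfold in_dom; simpl in *; tauto]. }
  { refine (continuous_comp_app5 D (d_rho F) _ _ _ _ _ _ (smooth_cont _ _ (smooth_d_rho _ _ sF)) Hd _ _ _ _ _);
      solve [apply continuous_fst | apply continuous_const | apply K; assumption]. }
  apply (is_derive_comp (fun z => F (c1 x) (c2 x) (c3 x) (c4 x) z) c5); [| exact H5].
  apply (is_derive_d_s D); assumption.
Qed.

Lemma C1_on_continuous W f r t : open W -> C1_on W f -> W (r, t) ->
  continuous (fun z : R * R => f (fst z) (snd z)) (r, t).
Proof.
  intros HW Hf Hrt.
  apply (@filterdiff_continuous R_AbsRing (prod_NormedModule R_AbsRing R_NormedModule R_NormedModule)
    R_NormedModule (fun z : R * R => f (fst z) (snd z)) (r, t)).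
  destruct (Hf r t Hrt) as (_ & e2 & c1 & _).
  eexists; apply (is_derive_filterdiff f r t (fun x y => Derive (fun x => f x y) x) (Derive (fun y => f r y) t)).
  - generalize (HW _ Hrt); apply filter_imp; intros [x y] Hxy.
    apply Derive_correct, (Hf x y Hxy).
  - apply Derive_correct, e2.
  - exact c1.
Qed.

Lemma continuous_swap (f : R * R -> R) r t :
  continuous f (r, t) -> continuous (fun z : R * R => f (snd z, fst z)) (t, r).
Proof.
  intros Hf; apply (continuous_comp (fun z : R * R => (snd z, fst z)) f); [| exact Hf].
  apply continuous_pair; [apply continuous_snd | apply continuous_fst].
Qed.

(** The Leibniz rule with moving endpoints needs the solution on a neighbourhood of the segment at
    all nearby times. Compactness of the segment provides a uniform width. *)
Lemma open_tube (W : R * R -> Prop) a b t : open W -> a <= b ->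
  (forall r, a <= r <= b -> W (r, t)) ->
  exists eps : posreal, forall r tau, a - eps <= r <= b + eps -> Rabs (tau - t) < eps -> W (r, tau).
Proof.
  intros HW Hab H.
  assert (X : forall x, exists d : posreal, a <= x <= b ->
    forall r tau, Rabs (r - x) < 2 * d -> Rabs (tau - t) < 2 * d -> W (r, tau)).
  { intros x; destruct (classic (a <= x <= b)) as [hx|hx].
    - destruct (HW _ (H x hx)) as [d Hd].
      exists (pos_div_2 d); intros _ r tau h1 h2; apply Hd; simpl in *; split; simpl.
      + unfold ball; simpl; unfold AbsRing_ball, abs, minus, plus, opp; simpl; unfold Rminus in h1; lra.
      + unfold ball; simpl; unfold AbsRing_ball, abs, minus, plus, opp; simpl; unfold Rminus in h2; lra.
    - exists (mkposreal 1 Rlt_0_1); tauto. }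
  pose (delta := fun x => proj1_sig (constructive_indefinite_description _ (X x))).
  assert (Hdelta : forall x, a <= x <= b ->
    forall r tau, Rabs (r - x) < 2 * delta x -> Rabs (tau - t) < 2 * delta x -> W (r, tau)).
  { intros x; unfold delta; destruct (constructive_indefinite_description _ (X x)) as [d Hd]; exact Hd. }
  (* For each [x] this gives, under a double negation, a point [y] with [x] within [delta y] of it
     and [d <= delta y]. The factor [2] in [Hdelta] absorbs both displacements. *)
  destruct (compactness_value 1 (a, tt) (b, tt) (fun x => delta (fst x))) as [d Hd].
  exists d; intros r tau Hr Htau.
  (* The projection of [r] onto the segment, at distance at most [d] from [r]. *)
  pose (x := Rmax a (Rmin r b)).
  assert (hx : a <= x <= b).
  { unfold x, Rmax, Rmin; repeat destruct Rle_dec; lra. }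
  assert (hrx : Rabs (r - x) <= d).
  { pose proof (cond_pos d); unfold x, Rmax, Rmin; repeat destruct Rle_dec; apply Rabs_le; lra. }
  specialize (Hd (x, tt)); simpl in Hd.
  destruct (NNPP _ (Hd (conj hx I))) as ([y []] & (hy & _) & (hxy & _) & hdy); simpl in *.
  apply (Hdelta y hy).
  - replace (r - y) with ((r - x) + (x - y)) by ring.
    eapply Rle_lt_trans; [apply Rabs_triang |]; lra.
  - pose proof (cond_pos (delta y)); lra.
Qed.

(** * The Leibniz rule along a solution *)

Section Transport.
Variables (D : box) (W : R * R -> Prop) (u rho s : R -> R -> R).
Hypothesis HW : open W.
Hypothesis Hu : C1_on W u.
Hypothesis Hrho : C1_on W rho.
Hypothesis Hs : C1_on W s.
Hypothesis Hdom : forall r t, W (r, t) -> in_dom D t r (u r t) (rho r t) (s r t).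

Definition along (F : kfun) (t r : R) : R := F t r (u r t) (rho r t) (s r t).

Definition along_dt (F : kfun) (t r : R) : R :=
  along (d_t F) t r + along (d_u F) t r * Derive (fun x => u r x) t
  + along (d_rho F) t r * Derive (fun x => rho r x) t + along (d_s F) t r * Derive (fun x => s r x) t.

Definition along_dr (F : kfun) (t r : R) : R :=
  along (d_r F) t r + along (d_u F) t r * Derive (fun x => u x t) r
  + along (d_rho F) t r * Derive (fun x => rho x t) r + along (d_s F) t r * Derive (fun x => s x t) r.

Lemma is_derive_along_t F t r : smooth D F -> W (r, t) ->
  is_derive (fun x => along F x r) t (along_dt F t r).
Proof.
  intros sF H; unfold along.
  destruct (Hu r t H) as (_ & e1 & _); destruct (Hrho r t H) as (_ & e2 & _); destruct (Hs r t H) as (_ & e3 & _).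
  eapply is_derive_eq.
  - apply (is_derive_comp_app5 D F (fun x => x) (fun _ => r) (fun x => u r x) (fun x => rho r x) (fun x => s r x));
      [exact sF | apply Hdom, H | apply is_derive_Rid | apply is_derive_Rconst
      | apply Derive_correct, e1 | apply Derive_correct, e2 | apply Derive_correct, e3].
  - unfold along_dt, along; req; ring.
Qed.

Lemma is_derive_along_r F t r : smooth D F -> W (r, t) ->
  is_derive (fun x => along F t x) r (along_dr F t r).
Proof.
  intros sF H; unfold along.
  destruct (Hu r t H) as (e1 & _); destruct (Hrho r t H) as (e2 & _); destruct (Hs r t H) as (e3 & _).
  eapply is_derive_eq.
  - apply (is_derive_comp_app5 D F (fun _ => t) (fun x => x) (fun x => u x t) (fun x => rho x t) (fun x => s x t));
      [exact sF | apply Hdom, H | apply is_derive_Rconst | apply is_derive_Rid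
      | apply Derive_correct, e1 | apply Derive_correct, e2 | apply Derive_correct, e3].
  - unfold along_dr, along; req; ring.
Qed.

Lemma continuous_along F t r : smooth D F -> W (r, t) ->
  continuous (fun z : R * R => along F (fst z) (snd z)) (t, r).
Proof.
  intros sF H.
  refine (continuous_comp_app5 D F (fun z : R * R => fst z) (fun z => snd z) (fun z => u (snd z) (fst z))
    (fun z => rho (snd z) (fst z)) (fun z => s (snd z) (fst z)) (t, r) (smooth_cont _ _ sF) (Hdom _ _ H) _ _ _ _ _).
  - apply continuous_fst.
  - apply continuous_snd.
  - apply (continuous_swap (fun z => u (fst z) (snd z))), (C1_on_continuous W); assumption.
  - apply (continuous_swap (fun z => rho (fst z) (snd z))), (C1_on_continuous W); assumption.
  - apply (continuous_swap (fun z => s (fst z) (snd z))), (C1_on_continuous W); assumption.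
Qed.

Lemma continuous_along_dt F t r : smooth D F -> W (r, t) ->
  continuous (fun z : R * R => along_dt F (fst z) (snd z)) (t, r).
Proof.
  intros sF H; unfold along_dt.
  destruct (Hu r t H) as (_ & _ & _ & e1); destruct (Hrho r t H) as (_ & _ & _ & e2); destruct (Hs r t H) as (_ & _ & _ & e3).
  apply continuous_swap in e1; apply continuous_swap in e2; apply continuous_swap in e3.
  assert (CP : forall f g : R * R -> R, continuous f (t, r) -> continuous g (t, r) ->
    continuous (fun z => f z + g z) (t, r)).
  { intros f g; apply (@continuous_plus _ R_AbsRing R_NormedModule). }
  assert (CM : forall f g : R * R -> R, continuous f (t, r) -> continuous g (t, r) ->
    continuous (fun z => f z * g z) (t, r)).
  { intros f g; apply (@continuous_mult _ R_AbsRing). }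
  assert (CA : forall G, smooth D G -> continuous (fun z : R * R => along G (fst z) (snd z)) (t, r)).
  { intros G sG; apply continuous_along; assumption. }
  repeat match goal with
  | |- continuous (fun z => @?f z + @?g z) _ => apply (CP f g)
  | |- continuous (fun z => @?f z * @?g z) _ => apply (CM f g)
  end; try (apply CA; smooth_tac); assumption.
Qed.

Lemma continuity_2d_Derive_along F t r : smooth D F -> W (r, t) ->
  continuity_2d_pt (fun x y => Derive (fun z => along F z y) x) t r.
Proof.
  intros sF H; apply continuity_2d_pt_filterlim.
  change (continuous (fun z : R * R => Derive (fun y => along F y (snd z)) (fst z)) (t, r)).
  apply (continuous_ext_loc _ (fun z : R * R => along_dt F (fst z) (snd z))).
  - assert (L : locally (t, r) (fun z : R * R => W (snd z, fst z))).
    { assert (c : continuous (fun z : R * R => (snd z, fst z)) (t, r)).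
      { apply continuous_pair; [apply continuous_snd | apply continuous_fst]. }
      apply c, HW, H. }
    revert L; apply filter_imp; intros [x y] Hxy; simpl in *.
    symmetry; apply is_derive_unique, is_derive_along_t; assumption.
  - apply continuous_along_dt; assumption.
Qed.

Lemma continuous_along_r F t r : smooth D F -> W (r, t) -> continuous (fun y => along F t y) r.
Proof.
  intros sF H; apply (@ex_derive_continuous R_AbsRing R_NormedModule).
  eexists; apply is_derive_along_r; assumption.
Qed.

Lemma is_derive_transported_integral F (a b : R -> R) t da db : smooth D F -> a t <= b t ->
  (forall r, a t <= r <= b t -> W (r, t)) -> is_derive a t da -> is_derive b t db ->
  is_derive (fun t => RInt (fun r => along F t r) (a t) (b t)) t
    (RInt (fun r => along_dt F t r) (a t) (b t) + - along F t (a t) * da + along F t (b t) * db).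
Proof.
  intros sF Hab Hseg Ha Hb.
  destruct (open_tube W (a t) (b t) t HW Hab Hseg) as [eps Heps].
  assert (pe := cond_pos eps).
  assert (L : locally t (fun y => Rabs (y - t) < eps)) by (exists eps; intros y Hy; exact Hy).
  assert (tt' : Rabs (t - t) < eps) by (rewrite Rminus_diag, Rabs_R0; exact pe).
  assert (I1 : forall c d, a t - eps <= c <= b t + eps -> a t - eps <= d <= b t + eps ->
    locally t (fun y => ex_RInt (fun r => along F y r) c d)).
  { intros c d Hc Hd; revert L; apply filter_imp; intros y Hy.
    apply (@ex_RInt_continuous R_CompleteNormedModule); intros z Hz.
    apply continuous_along_r; [exact sF |]; apply Heps; [| exact Hy].
    revert Hz; unfold Rmin, Rmax; destruct Rle_dec; lra. }
  assert (W2 : forall r, a t <= r <= b t ->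
    locally_2d (fun x' t0 => continuity_2d_pt (fun u0 v => Derive (fun z => along F z v) u0) x' t0) t r).
  { intros r Hr; exists eps; intros x y Hx Hy; apply continuity_2d_Derive_along; [exact sF |].
    apply Heps; [apply Rabs_def2 in Hy; lra | exact Hx]. }
  eapply is_derive_eq.
  - apply (is_derive_RInt_param_bound_comp (fun y r => along F y r) a b t da db).
    + apply I1; lra.
    + exists (mkposreal _ (is_pos_div_2 eps)); apply I1; simpl; lra.
    + exists (mkposreal _ (is_pos_div_2 eps)); apply I1; simpl; lra.
    + exact Ha.
    + exact Hb.
    + exists (mkposreal _ (is_pos_div_2 eps)); revert L; apply filter_imp; intros y Hy r Hr.
      eexists; apply is_derive_along_t; [exact sF |]; apply Heps; [| exact Hy].
      revert Hr; simpl; unfold Rmin, Rmax; repeat destruct Rle_dec; lra.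
    + intros r Hr; apply continuity_2d_Derive_along; [exact sF |]; apply Hseg.
      revert Hr; unfold Rmin, Rmax; destruct Rle_dec; lra.
    + apply W2; lra.
    + apply W2; lra.
    + apply continuity_pt_filterlim, continuous_along_r; [exact sF | apply Hseg; lra].
    + apply continuity_pt_filterlim, continuous_along_r; [exact sF | apply Hseg; lra].
  - req; f_equal; f_equal; apply RInt_ext; intros r Hr.
    apply is_derive_unique, is_derive_along_t; [exact sF |]; apply Hseg.
    revert Hr; unfold Rmin, Rmax; destruct Rle_dec; lra.
Qed.

End Transport.

(** The endpoint terms [U Phi^t] of the Leibniz rule cancel the convective part of
    [Phi^r = Psi + U Phi^t], leaving [Psi] at the endpoints. *)
Lemma conserved_transport n D p A : conserved n D p A -> transport_relation n D p A.
Proof.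
  intros (sF & sG & HC) W u rho s a b t1 t2 (HW & Hu & Hrho & Hs & HE) Hab psi t Ht.
  assert (Hdom : forall r t, W (r, t) -> in_dom D t r (u r t) (rho r t) (s r t)) by (intros; apply HE; assumption).
  destruct (Hab t Ht) as (hab & hseg & ha & hb).
  pose (T := radial_weight n (density A)); pose (X := radial_weight n (flux A)).
  assert (sT : smooth D T) by (unfold T, radial_weight; smooth_tac).
  assert (sX : smooth D X) by (unfold X, radial_weight, flux; smooth_tac).
  assert (E : forall r, a t <= r <= b t -> along_dt u rho s T t r = - along_dr u rho s X t r).
  { intros r hr; destruct (HE r t (hseg r hr)) as (Hd & e1 & e2 & e3).
    pose proof (HC _ _ _ _ _ (Derive (fun x => u x t) r) (Derive (fun x => rho x t) r) (Derive (fun x => s x t) r) Hd) as C.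
    fold T X in C; unfold along_dt, along_dr, along; rewrite e1, e2, e3.
    unfold Dt_euler, Dr in C; lra. }
  assert (EI : forall y, RInt (fun r => along u rho s T y r) (a y) (b y)
    = RInt (fun r => density A y r (u r y) (rho r y) (s r y) * r ^ (n - 1)) (a y) (b y)).
  { intros y; apply RInt_ext; intros r _; unfold along, T, radial_weight; apply Rmult_comm. }
  apply (is_derive_ext _ _ t _ EI).
  eapply is_derive_eq.
  { apply (is_derive_transported_integral D W u rho s HW Hu Hrho Hs Hdom T a b t _ _ sT hab hseg ha hb). }
  assert (I : RInt (fun r => along_dt u rho s T t r) (a t) (b t)
    = - along u rho s X t (b t) - - along u rho s X t (a t)).
  { apply (@is_RInt_unique R_CompleteNormedModule).
    apply (is_RInt_derive (fun r => - along u rho s X t r) (fun r => along_dt u rho s T t r)).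
    - intros r hr; assert (hr' : a t <= r <= b t) by (revert hr; unfold Rmin, Rmax; destruct Rle_dec; lra).
      rewrite (E r hr'); apply is_derive_Ropp.
      apply (is_derive_along_r D W u rho s Hu Hrho Hs Hdom X); [exact sX | apply hseg, hr'].
    - intros r hr; assert (hr' : a t <= r <= b t) by (revert hr; unfold Rmin, Rmax; destruct Rle_dec; lra).
      apply (continuous_comp (fun y : R => (t, y)) (fun z : R * R => along_dt u rho s T (fst z) (snd z))).
      + apply continuous_pair; [apply continuous_const | apply continuous_id].
      + apply (continuous_along_dt D W u rho s HW Hu Hrho Hs Hdom T); [exact sT | apply hseg, hr']. }
  rewrite I; unfold psi, along, T, X, radial_weight, flux; req; ring.
Qed.

(** * The theorem *)

Lemma constant_of_zero_partials D p : smooth D (state_fun p) ->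
  (forall rho s, dom_rho D rho -> dom_s D s -> p_rho p rho s = 0) ->
  (forall rho s, dom_rho D rho -> dom_s D s -> p_s p rho s = 0) -> eos_constant D p.
Proof.
  intros sp Hr Hs; pose proof (state_only_state_fun D p sp) as Sp.
  destruct (box_inhabited D) as (t0 & r0 & u0 & rho0 & s0 & Hd0).
  exists (p rho0 s0); intros rho s hrho hs.
  assert (Hd : in_dom D t0 r0 u0 rho s) by (unfold in_dom in *; tauto).
  apply (const_of_partials_zero D (state_fun p) sp) with (2 := Hd) (3 := Hd0).
  intros [] t r u rho1 s1 Hd1; simpl.
  - apply (so_t Sp), Hd1.
  - apply (so_r Sp), Hd1.
  - apply (so_u Sp), Hd1.
  - apply Hr; apply Hd1.
  - apply Hs; apply Hd1.
Qed.

Lemma barotropic_of_p_s_zero D p : smooth D (state_fun p) ->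
  (forall rho s, dom_rho D rho -> dom_s D s -> p_s p rho s = 0) -> barotropic D p.
Proof.
  intros sp Hs; destruct (box_inhabited D) as (t0 & r0 & u0 & rho0 & s0 & h1 & h2 & h3 & _ & h5).
  exists (fun rho => p rho s0); intros rho s hrho hs.
  apply (const_of_derive_zero (dom_s D) (fun x => p rho x)); try assumption; [apply dom_s_open |].
  intros x hx; assert (Hd : in_dom D t0 r0 u0 rho x) by (unfold in_dom; tauto).
  rewrite <- (Hs rho x hrho hx); exact (is_derive_d_s D (state_fun p) _ _ _ _ _ sp Hd).
Qed.

Lemma entropic_of_p_rho_zero D p : smooth D (state_fun p) ->
  (forall rho s, dom_rho D rho -> dom_s D s -> p_rho p rho s = 0) -> entropic D p.
Proof.
  intros sp Hr; destruct (box_inhabited D) as (t0 & r0 & u0 & rho0 & s0 & h1 & h2 & h3 & h4 & _).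
  exists (fun s => p rho0 s); intros rho s hrho hs.
  apply (const_of_derive_zero (dom_rho D) (fun x => p x s)); try assumption; [apply dom_rho_open |].
  intros x hx; assert (Hd : in_dom D t0 r0 u0 x s) by (unfold in_dom; tauto).
  rewrite <- (Hr x s hx hs); exact (is_derive_d_rho D (state_fun p) _ _ _ _ _ sp Hd).
Qed.

Lemma density_u_lin_comb D cs As t r u rho s :
  (forall B, In B As -> smooth D (density B)) -> in_dom D t r u rho s ->
  d_u (density (lin_comb cs As)) t r u rho s
  = fold_right (fun cA x => fst cA * d_u (density (snd cA)) t r u rho s + x) 0 (combine cs As).
Proof.
  intros H Hd; revert cs; induction As as [|A As IH]; intros [|c cs]; try exact (Derive_const 0 _).
  rewrite (density_u_lin_comb_cons D) by assumption; simpl; rewrite IH; [reflexivity |].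
  intros B HB; apply H; right; exact HB.
Qed.

(** The [U]-derivative divided by [rho] is a polynomial in [t], whose coefficients are found from
    the top by two [t]-derivatives. Only the term in [1 / r^m] is then left. *)
Lemma independence D m c0 c1 c2 c3 :
  (forall t r u rho s, in_dom D t r u rho s ->
    c0 * (rho * u) + c1 * (t * rho * u - r * rho / 2) + c2 * (t ^ 2 * rho * u - t * r * rho)
    + c3 * / r ^ m = 0) ->
  c0 = 0 /\ c1 = 0 /\ c2 = 0 /\ c3 = 0.
Proof.
  intros H.
  assert (H1 : forall t r u rho s, in_dom D t r u rho s -> c0 + c1 * t + c2 * (t * t) = 0).
  { intros t r u rho s Hd; diff DU H Hd as E.
    coords_neq0 Hd.
    lincomb (/ rho * E)%eqn; field; auto using pow_nonzero. }
  assert (H2 : forall t r u rho s, in_dom D t r u rho s -> c1 + 2 * c2 * t = 0).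
  { intros t r u rho s Hd; diff DT H1 Hd as E; lincomb E; ring. }
  destruct (box_inhabited D) as (t & r & u & rho & s & Hd).
  diff DT H2 Hd as E.
  assert (z2 : c2 = 0) by lra.
  pose proof (H2 $ Hd) as E2; rewrite z2 in E2.
  assert (z1 : c1 = 0) by lra.
  pose proof (H1 $ Hd) as E1; rewrite z1, z2 in E1.
  assert (z0 : c0 = 0) by lra.
  pose proof (H $ Hd) as E0; rewrite z0, z1, z2 in E0.
  coords_neq0 Hd.
  repeat split; try assumption.
  apply Rmult_eq_reg_r with (/ r ^ m); [lra | apply Rinv_neq_0_compat, pow_nonzero, hr].
Qed.

Lemma density_u_iscale D c A t r u rho s : smooth D (density A) -> in_dom D t r u rho s ->
  d_u (density (iscale c A)) t r u rho s = c * d_u (density A) t r u rho s.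
Proof. intros sA Hd; simpl; compute_partials Hd; ring. Qed.

Section MainTheorem.
Variables (n : nat) (D : box) (p e : R -> R -> R).
Hypothesis hn : (1 < n)%nat.
Hypothesis hp : eos_regular D p.
Hypothesis hpc : ~ eos_constant D p.
Hypothesis he : internal_energy D p e.

Let E := energy p e.
Let sp : smooth D (state_fun p) := proj1 hp.
Let hE : conserved n D p E := energy_conserved n D p hn sp e he.
Let nE : ~ vanishes D (moving_flux E) := energy_flux_nonzero D p sp e hpc.

Lemma p_rho_generic : ~ entropic D p -> generic D (p_rho p).
Proof.
  intros H; pose proof hp as (_ & [Z|G] & _); [| exact G].
  exfalso; apply H, entropic_of_p_rho_zero; assumption.
Qed.

Lemma p_s_generic : ~ barotropic D p -> generic D (p_s p).
Proof.
  intros H; pose proof hp as (_ & _ & [Z|G]); [| exact G].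
  exfalso; apply H, barotropic_of_p_s_zero; assumption.
Qed.

Lemma p_generic : generic D (p_rho p) \/ generic D (p_s p).
Proof.
  pose proof hp as (_ & [Z|G] & [Z'|G']); try tauto.
  exfalso; apply hpc, constant_of_zero_partials; assumption.
Qed.

Lemma barotropic_p_rho_generic P : barotropic_with D p P -> generic D (p_rho p).
Proof.
  intros HP; pose proof hp as (_ & [Z|G] & _); [| exact G].
  exfalso; apply hpc, constant_of_zero_partials; try assumption.
  intros rho s hrho hs; destruct (box_inhabited D) as (t & r & u & _ & _ & h1 & h2 & h3 & _ & _).
  apply (barotropic_p_s D p P HP t r u rho s); unfold in_dom; tauto.
Qed.

(** If [p_rho] vanished identically, [rho p_rho = gamma (p - p0)] with [gamma = 1 + 2/n > 0] would
    make [p] constant. *)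
Lemma polytropic_p_rho_generic kappa p0 : polytropic_with n D p kappa p0 -> generic D (p_rho p).
Proof.
  intros HP; apply p_rho_generic; intros [k Hk]; apply hpc; exists p0; intros rho s hrho hs.
  destruct (box_inhabited D) as (t & r & u & _ & _ & h1 & h2 & h3 & _ & _).
  assert (Hd : in_dom D t r u rho s) by (unfold in_dom; tauto).
  pose proof (polytropic_p_rho n D p kappa p0 HP $ Hd) as X.
  rewrite (entropic_p_rho D p k Hk $ Hd) in X.
  pose proof (lt_INR _ _ hn) as hN; simpl in hN.
  assert (0 < 2 / INR n) by (apply Rdiv_lt_0_compat; lra).
  assert (Y : (1 + 2 / INR n) * (state_fun p t r u rho s - p0) = 0) by lra.
  apply Rmult_integral in Y; destruct Y as [Y|Y]; [lra | unfold state_fun in Y; lra].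
Qed.

Lemma entropic_p_s_generic kappa : entropic_with D p kappa -> generic D (p_s p).
Proof.
  intros HP; pose proof hp as (_ & _ & [Z|G]); [| exact G].
  exfalso; apply hpc, constant_of_zero_partials; try assumption.
  intros rho s hrho hs; destruct (box_inhabited D) as (t & r & u & _ & _ & h1 & h2 & h3 & _ & _).
  apply (entropic_p_rho D p kappa HP t r u rho s); unfold in_dom; tauto.
Qed.

Lemma multiple_of_energy A c : equivalent n D p A (iscale c E) ->
  forall t r u rho s, in_dom D t r u rho s -> d_u (density A) t r u rho s = c * (rho * u).
Proof.
  intros H t r u rho s Hd.
  pose proof (proj1 hE) as sE.
  rewrite (density_u_of_equivalent n D p A (iscale c E) hn sp p_generic) with (3 := Hd); [| | exact H].
  - rewrite (density_u_iscale D) by assumption; unfold E; rewrite energy_density_u; reflexivity.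
  - apply (smooth_mult D (fun _ _ _ _ _ => c)); [apply smooth_const | exact sE].
Qed.

Lemma classified_general : ~ polytropic n D p -> ~ barotropic D p -> ~ entropic D p ->
  classified_by n D p [E].
Proof.
  intros H1 H2 H3.
  assert (Hin : forall A, In A [E] -> conserved n D p A) by (intros A [<-|[]]; exact hE).
  apply classified_intro; try assumption.
  - exact p_generic.
  - intros A [<-|[]]; split; [exact hE | exact nE].
  - intros A HA.
    destruct (span_generic n D p hn sp A HA (p_rho_generic H3) (p_s_generic H2)) as (b0 & b1 & b2 & Hb & Hpol).
    destruct Hpol as [Hpol|[-> ->]]; [tauto |].
    exists [b0]; split; [reflexivity |]; intros t r u rho s Hd.
    rewrite (density_u_lin_comb D) by (exact Hd || intros B HB; apply (Hin B HB)); cbn [combine fold_right fst snd].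
    unfold E; rewrite energy_density_u, (Hb $ Hd); field.
  - intros [|c [|]] hl H; try discriminate; intros c' [<-|[]].
    destruct (independence D (n - 1) c 0 0 0) as [z _]; [| exact z].
    intros t r u rho s Hd; pose proof (H $ Hd) as X.
    rewrite (density_u_lin_comb D) in X by (exact Hd || intros B HB; apply (Hin B HB)); cbn [combine fold_right fst snd] in X.
    unfold E in X; rewrite energy_density_u in X; lra.
Qed.

(** When the pressure is not barotropic, [p_S] is generic, which excludes an enthalpy term; in the
    barotropic case the list would be incomplete. *)
Lemma classified_polytropic kappa p0 : polytropic_with n D p kappa p0 -> ~ barotropic D p ->
  classified_by n D p [E; dilational_energy n kappa; similarity_energy n kappa].
Proof.
  intros HP H2.
  assert (hD : conserved n D p (dilational_energy n kappa)) by (apply (dilational_conserved n D p hn sp kappa p0 HP)).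
  assert (hS : conserved n D p (similarity_energy n kappa)) by (apply (similarity_conserved n D p hn sp kappa p0 HP)).
  assert (Hin : forall A, In A [E; dilational_energy n kappa; similarity_energy n kappa] -> conserved n D p A)
    by (intros A [<-|[<-|[<-|[]]]]; assumption).
  apply classified_intro; try assumption.
  - exact p_generic.
  - intros A [<-|[<-|[<-|[]]]]; (split; [assumption |]).
    + exact nE.
    + apply (dilational_flux_nonzero n D p sp kappa p0 HP hpc).
    + apply (similarity_flux_nonzero n D p sp kappa p0 HP hpc).
  - intros A HA.
    destruct (span_generic n D p hn sp A HA (polytropic_p_rho_generic kappa p0 HP) (p_s_generic H2))
      as (b0 & b1 & b2 & Hb & _).
    exists [b0; b1; b2]; split; [reflexivity |]; intros t r u rho s Hd.
    rewrite (density_u_lin_comb D) by (exact Hd || intros B HB; apply (Hin B HB)); cbn [combine fold_right fst snd].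
    unfold E; rewrite energy_density_u, dilational_density_u, similarity_density_u, (Hb $ Hd); field.
  - intros [|c0 [|c1 [|c2 [|]]]] hl H; try discriminate.
    destruct (independence D (n - 1) c0 c1 c2 0) as (z0 & z1 & z2 & _).
    { intros t r u rho s Hd; pose proof (H $ Hd) as X.
      rewrite (density_u_lin_comb D) in X by (exact Hd || intros B HB; apply (Hin B HB)); cbn [combine fold_right fst snd] in X.
      unfold E in X; rewrite energy_density_u, dilational_density_u, similarity_density_u in X; lra. }
    intros c [<-|[<-|[<-|[]]]]; assumption.
Qed.

Lemma classified_barotropic P eb : barotropic_with D p P ->
  (forall rho, dom_rho D rho -> is_derive eb rho (P rho / rho ^ 2)) -> ~ polytropic n D p ->
  classified_by n D p [E; enthalpy_flux n P eb].
Proof.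
  intros HP Heb H1.
  assert (hH : conserved n D p (enthalpy_flux n P eb)) by (apply (enthalpy_conserved n D p hn sp P eb HP Heb)).
  assert (Hin : forall A, In A [E; enthalpy_flux n P eb] -> conserved n D p A)
    by (intros A [<-|[<-|[]]]; assumption).
  apply classified_intro; try assumption.
  - exact p_generic.
  - intros A [<-|[<-|[]]]; (split; [assumption |]).
    + exact nE.
    + apply (enthalpy_flux_nonzero n D p sp P eb HP Heb).
  - intros A HA.
    destruct (span_barotropic n D p hn sp A P eb HA (barotropic_p_rho_generic P HP) HP Heb)
      as (b0 & b1 & b2 & c & Hb & Hpol).
    destruct Hpol as [Hpol|[-> ->]]; [tauto |].
    exists [b0; c]; split; [reflexivity |]; intros t r u rho s Hd.
    rewrite (density_u_lin_comb D) by (exact Hd || intros B HB; apply (Hin B HB)); cbn [combine fold_right fst snd].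
    unfold E; rewrite energy_density_u, enthalpy_density_u, (Hb $ Hd); field.
    apply pow_nonzero, (in_dom_r_neq0 Hd).
  - intros [|c0 [|c1 [|]]] hl H; try discriminate.
    destruct (independence D (n - 1) c0 0 0 c1) as (z0 & _ & _ & z1).
    { intros t r u rho s Hd; pose proof (H $ Hd) as X.
      rewrite (density_u_lin_comb D) in X by (exact Hd || intros B HB; apply (Hin B HB)); cbn [combine fold_right fst snd] in X.
      unfold E in X; rewrite energy_density_u, enthalpy_density_u in X; lra. }
    intros c [<-|[<-|[]]]; assumption.
Qed.

(** The overlap of the two special cases, where [kappa] is constant: neither the enthalpy term nor
    the quadratic dependence on [t] is excluded. *)
Lemma classified_polytropic_barotropic kappa p0 P eb :
  polytropic_with n D p kappa p0 -> barotropic_with D p P ->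
  (forall rho, dom_rho D rho -> is_derive eb rho (P rho / rho ^ 2)) ->
  classified_by n D p [E; dilational_energy n kappa; similarity_energy n kappa; enthalpy_flux n P eb].
Proof.
  intros HK HP Heb.
  assert (hD : conserved n D p (dilational_energy n kappa)) by (apply (dilational_conserved n D p hn sp kappa p0 HK)).
  assert (hS : conserved n D p (similarity_energy n kappa)) by (apply (similarity_conserved n D p hn sp kappa p0 HK)).
  assert (hH : conserved n D p (enthalpy_flux n P eb)) by (apply (enthalpy_conserved n D p hn sp P eb HP Heb)).
  assert (Hin : forall A, In A [E; dilational_energy n kappa; similarity_energy n kappa; enthalpy_flux n P eb]
    -> conserved n D p A) by (intros A [<-|[<-|[<-|[<-|[]]]]]; assumption).
  apply classified_intro; try assumption.
  - exact p_generic.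
  - intros A [<-|[<-|[<-|[<-|[]]]]]; (split; [assumption |]).
    + exact nE.
    + apply (dilational_flux_nonzero n D p sp kappa p0 HK hpc).
    + apply (similarity_flux_nonzero n D p sp kappa p0 HK hpc).
    + apply (enthalpy_flux_nonzero n D p sp P eb HP Heb).
  - intros A HA.
    destruct (span_barotropic n D p hn sp A P eb HA (barotropic_p_rho_generic P HP) HP Heb)
      as (b0 & b1 & b2 & c & Hb & _).
    exists [b0; b1; b2; c]; split; [reflexivity |]; intros t r u rho s Hd.
    rewrite (density_u_lin_comb D) by (exact Hd || intros B HB; apply (Hin B HB)); cbn [combine fold_right fst snd].
    unfold E; rewrite energy_density_u, dilational_density_u, similarity_density_u, enthalpy_density_u,
      (Hb $ Hd); field.
    apply pow_nonzero, (in_dom_r_neq0 Hd).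
  - intros [|c0 [|c1 [|c2 [|c3 [|]]]]] hl H; try discriminate.
    destruct (independence D (n - 1) c0 c1 c2 c3) as (z0 & z1 & z2 & z3).
    { intros t r u rho s Hd; pose proof (H $ Hd) as X.
      rewrite (density_u_lin_comb D) in X by (exact Hd || intros B HB; apply (Hin B HB)); cbn [combine fold_right fst snd] in X.
      unfold E in X; rewrite energy_density_u, dilational_density_u, similarity_density_u, enthalpy_density_u in X; lra. }
    intros c [<-|[<-|[<-|[<-|[]]]]]; assumption.
Qed.

Lemma weighted_additional kappa F K : entropic_with D p kappa -> entropy_weight D kappa F K ->
  nonconstant_on (dom_s D) F -> additional n D p E (weighted_energy F K).
Proof.
  intros Hk HF HN; pose proof (entropic_p_s_generic kappa Hk) as Gs.
  split; [| split].
  - apply (weighted_conserved n D p hn sp kappa F K Hk HF).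
  - apply (weighted_flux_nonzero D p sp kappa F K Hk HF Gs HN).
  - intros [c Hc]; destruct HN as (x & y & hx & hy & hxy); apply hxy.
    assert (X : forall t r u rho s, in_dom D t r u rho s -> rho * u * state_fun (fun _ s => F s) t r u rho s = c * (rho * u)).
    { intros t r u rho s Hd; rewrite <- (multiple_of_energy _ c Hc $ Hd), weighted_density_u; reflexivity. }
    pose proof (proj1 HF) as sF.
    destruct (box_inhabited D) as (t & r & u & rho & _ & h1 & h2 & h3 & h4 & _).
    assert (Y : forall z, dom_s D z -> F z = c).
    { intros z hz; assert (Hd : in_dom D t r u rho z) by (unfold in_dom; tauto).
      diff DU X Hd as Z.
      assert (W : d_u (state_fun (fun _ s => F s)) t r u rho z = 0) by (apply (Derive_const (F z))).
      rewrite W in Z; unfold state_fun in Z.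
      apply Rmult_eq_reg_l with rho; [lra | apply (in_dom_rho_neq0 Hd)]. }
    rewrite (Y x hx), (Y y hy); reflexivity.
Qed.

Lemma entropic_classification kappa A : entropic_with D p kappa -> conserved n D p A ->
  (exists c, equivalent n D p A (iscale c E)) \/
  (exists F K, entropy_weight D kappa F K /\ nonconstant_on (dom_s D) F /\
     equivalent n D p A (weighted_energy F K)).
Proof.
  intros Hk HA.
  destruct (span_entropic n D p hn sp A kappa HA (entropic_p_s_generic kappa Hk) Hk) as (F & K & HF & HAu).
  (* A constant weight [F] yields a multiple of the energy, so the two alternatives correspond to
     the two kinds of weight. *)
  destruct (classic (nonconstant_on (dom_s D) F)) as [HN|HN].
  - right; exists F, K; split; [exact HF | split; [exact HN |]].
    apply equivalent_of_density_u; try assumption.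
    + apply (weighted_conserved n D p hn sp kappa F K Hk HF).
    + intros t r u rho s Hd; rewrite weighted_density_u; apply HAu, Hd.
  - left; destruct (open_interval_inhabited _ (dom_s_open D)) as [s0 hs0]; exists (F s0).
    assert (HE : conserved n D p (iscale (F s0) E)).
    { apply (conserved_ext n D p (iadd (iscale (F s0) E) (iscale 0 E))); [exact hn | | |].
      - intros t r u rho s _; simpl; ring.
      - intros t r u rho s _; simpl; ring.
      - apply conserved_lin; assumption. }
    apply equivalent_of_density_u; try assumption.
    intros t r u rho s Hd; rewrite (HAu $ Hd).
    assert (X : F s = F s0).
    { apply NNPP; intros hx; apply HN; exists s, s0; split; [apply Hd | tauto]. }
    rewrite X; symmetry.
    pose proof (proj1 hE) as sE.
    rewrite (density_u_iscale D) by assumption; unfold E; rewrite energy_density_u; ring.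
Qed.

Lemma additional_iff : (exists A, additional n D p E A) <->
  (polytropic n D p \/ barotropic D p \/ entropic D p).
Proof.
  split.
  - intros (A & HA & _ & HnA); apply NNPP; intros H.
    apply not_or_and in H; destruct H as [H1 H]; apply not_or_and in H; destruct H as [H2 H3].
    destruct (classified_general H1 H2 H3) as (_ & HC & _).
    destruct (HC A HA) as ([|c [|]] & hl & HI & HT & h1 & h2 & h3); try discriminate.
    apply HnA; exists c, HI, HT; split; [exact h1 | split; [exact h2 |]].
    intros t r u rho s Hd; destruct (h3 $ Hd) as [e1 e2]; simpl in *; split; lra.
  - intros [[kappa [p0 HP]] | [[P HP] | [kappa HP]]].
    + exists (dilational_energy n kappa); split; [| split].
      * apply (dilational_conserved n D p hn sp kappa p0 HP).
      * apply (dilational_flux_nonzero n D p sp kappa p0 HP hpc).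
      * intros [c Hc].
        destruct (independence D (n - 1) c (-1) 0 0) as (_ & z & _); [| lra].
        intros t r u rho s Hd.
        rewrite <- (multiple_of_energy _ c Hc $ Hd), dilational_density_u; ring.
    + destruct (open_interval_inhabited _ (dom_s_open D)) as [s0 hs0].
      (* A primitive for the barotropic pressure is obtained by freezing the entropy in [e]. *)
      assert (Heb : forall rho, dom_rho D rho -> is_derive (fun x => e x s0) rho (P rho / rho ^ 2)).
      { intros rho hrho; rewrite <- (HP rho s0 hrho hs0); apply he; assumption. }
      exists (enthalpy_flux n P (fun x => e x s0)); split; [| split].
      * apply (enthalpy_conserved n D p hn sp P _ HP Heb).
      * apply (enthalpy_flux_nonzero n D p sp P _ HP Heb).
      * intros [c Hc].
        destruct (independence D (n - 1) c 0 0 (-1)) as (_ & _ & _ & z); [| lra].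
        intros t r u rho s Hd.
        rewrite <- (multiple_of_energy _ c Hc $ Hd), enthalpy_density_u; ring.
    + destruct (box_inhabited D) as (t0 & r0 & u0 & rho0 & _ & h1 & h2 & h3 & h4 & _).
      (* The weight [F = kappa] is non-constant because [p] is, and the integral of [kappa kappa']
         is [kappa^2 / 2]. *)
      exists (weighted_energy kappa (fun s => kappa s ^ 2 / 2)).
      apply (weighted_additional kappa); [exact HP | split |].
      * apply smooth_ext with (state_fun p); [| exact sp].
        intros t r u rho s Hd; apply HP; apply Hd.
      * intros s hs; assert (Hd : in_dom D t0 r0 u0 rho0 s) by (unfold in_dom; tauto).
        assert (X : is_derive kappa s (Derive kappa s)).
        { apply Derive_correct; exists (d_s (state_fun p) t0 r0 u0 rho0 s).
          apply is_derive_ext_loc with (fun x => state_fun p t0 r0 u0 rho0 x); [| der Hd].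
          generalize (open_interval_locally _ _ (dom_s_open D) hs); apply filter_imp.
          intros x hx; apply HP; assumption. }
        eapply is_derive_eq.
        { apply is_derive_Rdiv; [apply is_derive_sqr, X | apply is_derive_Rconst | lra]. }
        req; field.
      * apply NNPP; intros HN; apply hpc.
        destruct (open_interval_inhabited _ (dom_s_open D)) as [s0 hs0].
        exists (kappa s0); intros rho s hrho hs; rewrite (HP rho s hrho hs).
        apply NNPP; intros hx; apply HN; exists s, s0; tauto.
Qed.

End MainTheorem.

Theorem theorem4p4 (n : nat) (hn : (1 < n)%nat) (D : box)
  (p : R -> R -> R) (hp : eos_regular D p) (hpc : ~ eos_constant D p)
  (e : R -> R -> R) (he : internal_energy D p e) :
  let E := energy p e in
  (* conserved integrals satisfy the balance relation on transported domains *)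
  (forall A, conserved n D p A -> transport_relation n D p A) /\
  (* energy; the only one for a general equation of state *)
  (conserved n D p E /\ ~ vanishes D (moving_flux E)) /\
  (~ polytropic n D p -> ~ barotropic D p -> ~ entropic D p ->
     classified_by n D p [E]) /\
  (* special equations of state *)
  ((exists A, additional n D p E A) <->
     (polytropic n D p \/ barotropic D p \/ entropic D p)) /\
  (forall kappa p0,
     polytropic_with n D p kappa p0 -> ~ barotropic D p ->
     classified_by n D p [E; dilational_energy n kappa; similarity_energy n kappa]) /\
  (forall P eb : R -> R,
     barotropic_with D p P ->
     (forall rho, dom_rho D rho -> is_derive eb rho (P rho / rho ^ 2)) ->
     ~ polytropic n D p ->
     classified_by n D p [E; enthalpy_flux n P eb]) /\
  (forall (kappa : R -> R) (p0 : R) (P eb : R -> R),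
     polytropic_with n D p kappa p0 -> barotropic_with D p P ->
     (forall rho, dom_rho D rho -> is_derive eb rho (P rho / rho ^ 2)) ->
     classified_by n D p [E; dilational_energy n kappa; similarity_energy n kappa;
                          enthalpy_flux n P eb]) /\
  (forall kappa,
     entropic_with D p kappa ->
     (forall F K, entropy_weight D kappa F K -> nonconstant_on (dom_s D) F ->
        additional n D p E (weighted_energy F K)) /\
     (forall A, conserved n D p A ->
        (exists c, equivalent n D p A (iscale c E)) \/
        (exists F K, entropy_weight D kappa F K /\ nonconstant_on (dom_s D) F /\
           equivalent n D p A (weighted_energy F K)))).
Proof.
  intros E.
  split; [intros A; apply conserved_transport |].
  split.
  { split; [apply energy_conserved; [exact hn | exact (proj1 hp) | exact he] |].
    apply energy_flux_nonzero; [exact (proj1 hp) | exact hpc]. }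
  split; [apply classified_general; assumption |].
  split; [apply additional_iff; assumption |].
  split; [intros; eapply classified_polytropic; eassumption |].
  split; [intros; apply classified_barotropic; assumption |].
  split; [intros; eapply classified_polytropic_barotropic; eassumption |].
  intros kappa Hk; split.
  - intros; eapply weighted_additional; eassumption.
  - intros; eapply entropic_classification; eassumption.
Qed.
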